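(* Let $a,b,c,d,x_0,x_1$ be nonzero real numbers such that $a,c<0$, $b,d>0$ and $x_0,x_1>1$. Then each of the following two piecewise systems has a limit cycle: $$\begin{cases}\dot w=\left(\frac{b-ai}{2}\right)(w-1)\bigl(-2i+(w-1)(-i+x_1)\bigr), & w\in\Sigma_+^E,\\ \dot w=\frac{i}{4}(w-1)^3, & w\in\Sigma_c^E,\\ \dot w=\left(\frac{d-ci}{2}\right)(w-1)\bigl(-2i+(w-1)(i-x_0)\bigr), & w\in\Sigma_-^E,\end{cases}$$ and $$\begin{cases}\dot w=\left(\frac{b-ai}{2}\right)(w-1)\bigl(-2iw+(w-1)(-i+x_1)\bigr), & w\in\Sigma_+^I,\\ \dot w=\frac{i(w-1)^3}{4w}, & w\in\Sigma_c^I,\\ \dot w=\left(\frac{d-ci}{2}\right)(w-1)\bigl(-2iw+(w-1)(i-x_0)\bigr), & w\in\Sigma_-^I.\end{cases}$$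
   Context: The zones are $\Sigma_+^E=\{|w|<1\}$, $\Sigma_c^E=\{|w|>1,\ |w-2|>1\}$, $\Sigma_-^E=\{|w-2|<1\}$ (externally tangent circles) and $\Sigma_+^I=\{|w-\tfrac23|<\tfrac13\}$, $\Sigma_c^I=\{|w-\tfrac23|>\tfrac13,\ |w|<1\}$, $\Sigma_-^I=\{|w|>1\}$ (internally tangent circles). The dynamics on the discontinuity circles follows Filippov's convention (where both adjacent vector fields cross the curve in the same direction, trajectories are obtained by concatenation). A limit cycle is an isolated periodic orbit.
   Formalization: For the second system the limit cycle is taken on the Riemann sphere: for parameters satisfying one explicit relation the closed orbit passes through w = infinity and there is no limit cycle in the plane; for all other parameters it lies in the plane. *)

(* Defs.v *)
From HB Require Import structures.
From mathcomp Require Import all_boot all_order all_algebra.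
From mathcomp Require Import all_classical all_reals all_analysis.
From mathcomp Require Export complex.

Set Implicit Arguments.
Unset Strict Implicit.
Unset Printing Implicit Defensive.

Import Order.TTheory GRing.Theory Num.Theory.
Import numFieldNormedType.Exports.

Local Open Scope classical_set_scope.
Local Open Scope ring_scope.
Local Open Scope complex_scope.

(* R[i] itself carries no topology in the library; R[i]^o is the same type
   with the topology of the norm.  [None] is the point at infinity. *)
Definition sphere (R : realType) := one_point_compactification R[i]^o.

(* A piecewise system with three zones; the discontinuity set is the complement
   of the union of the zones, and the values of the fields outside their zones
   are irrelevant. *)
Record pwsystem (R : realType) := PwSystem {
  zone_p : set R[i]; zone_c : set R[i]; zone_m : set R[i];
  field_p : R[i] -> R[i]; field_c : R[i] -> R[i]; field_m : R[i] -> R[i] }.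

Section Filippov.
Variable R : realType.
Implicit Types (S : pwsystem R) (w : R -> R[i]) (gamma : R -> sphere R).

Definition pwdomain S : set R[i] := zone_p S `|` zone_c S `|` zone_m S.

Definition pwfield S (z : R[i]) : R[i] :=
  if z \in zone_p S then field_p S z
  else if z \in zone_c S then field_c S z else field_m S z.

(* Filippov's set-valued extension: the smallest closed convex set containing
   all the limit values of the field when the argument tends to z off the
   discontinuity set.  It is empty at a pole; the neighbourhoods are punctured
   because the junk value of the field at a pole must not count. *)
Definition filippov S (z : R[i]) : set R[i] :=
  [set v | forall K : set R[i],
     closed (K : set R[i]^o) -> convex_set (K : set (Rcomplex R)) ->
     cluster ((pwfield S : R[i]^o -> R[i]^o) @
              within (pwdomain S) (dnbhs (z : R[i]^o))) `<=` K ->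
     K v].

Definition abs_continuous (f : R -> R) (s t : R) :=
  forall e : R, 0 < e -> exists2 d : R, 0 < d &
    forall (n : nat) (l r : 'I_n -> R),
      (forall i, s <= l i /\ l i <= r i /\ r i <= t) ->
      (forall i j, i != j -> r i <= l j \/ r j <= l i) ->
      \sum_(i < n) (r i - l i) < d ->
      \sum_(i < n) `|f (r i) - f (l i)| < e.

Definition filippov_sol S w (s t : R) :=
  [/\ forall x, s < x < t -> filippov S (w x) !=set0,
      forall x y, s < x -> y < t ->
        abs_continuous (fun u => complex.Re (w u)) x y /\
        abs_continuous (fun u => complex.Im (w u)) x y
    & {ae (@lebesgue_measure R), forall x, s < x < t ->
        exists2 v : R[i], filippov S (w x) v &
          is_derive x (1 : R) (fun u => complex.Re (w u)) (complex.Re v) /\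
          is_derive x (1 : R) (fun u => complex.Im (w u)) (complex.Im v)}].

(* The system read in the coordinate u = 1/w, where w' = X(w) becomes
   u' = - u^2 X(1/u). *)
Definition inv_system S : pwsystem R :=
  let Z (A : set R[i]) := [set u | u != 0 /\ A u^-1] in
  let X (f : R[i] -> R[i]) := fun u => - u ^+ 2 * f u^-1 in
  PwSystem (Z (zone_p S)) (Z (zone_c S)) (Z (zone_m S))
           (X (field_p S)) (X (field_c S)) (X (field_m S)).

Definition inv_point (u : R[i]) : sphere R :=
  if u == 0 then None else Some u^-1.

Definition sphere_sol S gamma :=
  forall t : R, exists2 e : R, 0 < e &
    (exists2 w : R -> R[i], filippov_sol S w (t - e) (t + e) &
       forall x, t - e < x < t + e -> gamma x = Some (w x)) \/
    (exists2 u : R -> R[i], filippov_sol (inv_system S) u (t - e) (t + e) &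
       forall x, t - e < x < t + e -> gamma x = inv_point (u x)).

Definition periodic_orbit S (Gamma : set (sphere R)) :=
  exists gamma, exists T : R,
    [/\ sphere_sol S gamma, 0 < T, forall t, gamma (t + T) = gamma t,
        exists t, gamma t <> gamma 0 & Gamma = range gamma].

Definition limit_cycle S (Gamma : set (sphere R)) :=
  periodic_orbit S Gamma /\
  exists U : set (sphere R),
    [/\ open U, Gamma `<=` U &
        forall Gamma', periodic_orbit S Gamma' -> Gamma' `<=` U ->
          Gamma' = Gamma].

Definition SigmaE_p : set R[i] := [set w | `|w| < 1].
Definition SigmaE_c : set R[i] := [set w | (1 < `|w|) /\ (1 < `|w - 2|)].
Definition SigmaE_m : set R[i] := [set w | `|w - 2| < 1].

Definition SigmaI_p : set R[i] := [set w | `|w - 2 / 3| < 1 / 3].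
Definition SigmaI_c : set R[i] := [set w | (1 / 3 < `|w - 2 / 3|) /\ (`|w| < 1)].
Definition SigmaI_m : set R[i] := [set w | 1 < `|w|].

(* In the coordinate z = -2i w / (w - 1) the system of the internally tangent
   circles has the linear fields (a + bi)(z - (i - x1)) above Im z = 1 and
   (c + di)(z - (x0 - i)) below Im z = -1, and w = infinity is z = -2i.  The
   relation says that the lower arc of the closed orbit, which starts at
   x0 - i - r with r = (x0 + x1)(1 + e^(a pi/b)) / (1 - e^(a pi/b + c pi/d)),
   goes through -2i. *)
Definition orbit_through_infinity (a b c d x0 x1 : R) : Prop :=
  Num.sqrt (x0 ^+ 2 + 1) * (1 - expR (a / b * pi + c / d * pi)) =
  (x0 + x1) * (1 + expR (a / b * pi)) * expR (c / d * atan x0^-1).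

End Filippov.

(* Main.v *)
Require Import Defs.
From mathcomp Require Import all_boot all_order all_algebra.
From mathcomp Require Import all_classical all_reals all_analysis.
From mathcomp Require Import measurable_realfun ring lra.

(* A Moebius map sending w = 1 to infinity turns both systems into one system
   in the strip coordinate z: linear foci centred on the lines Im z = 1 and
   Im z = -1 outside the strip |Im z| < 1, and i/z inside.  The flow is explicit
   in each zone (logarithmic spirals, hyperbolas Re z^2 = const), and the map
   sending one passage through a half plane to the next is an affine contraction;
   its fixed point gives the closed orbit.

   Away from a closed set blocking the sliding segments and the pole, every
   crossing of Im z = 1 or Im z = -1 is transversal, so a Filippov solution,
   a priori only absolutely continuous, is classical off isolated times.  The
   signed deviation from the closed orbit, measured along the ray from the focus
   or along the hyperbolas, is multiplied by e^(at), 1 or e^(ct).  On a periodic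
   solution its absolute value is therefore constant; were it nonzero, the
   solution would never leave the strip, where Re z Im z grows at unit speed.
   Hence every periodic orbit in this neighbourhood has deviation zero, and it is
   the closed orbit by uniqueness of the flow. *)

Set Implicit Arguments.
Unset Strict Implicit.
Unset Printing Implicit Defensive.

Import Order.TTheory GRing.Theory Num.Theory.
Import numFieldNormedType.Exports.

Local Open Scope classical_set_scope.
Local Open Scope ring_scope.
Local Open Scope complex_scope.

(** The competitors of a limit cycle are arbitrary Filippov solutions on the sphere, and a return
    map would have to follow curves whose crossings are not yet known to be isolated. The deviation
    avoids this: its absolute value is monotone near every time, and local facts are glued over an
    interval. It is continuous across the lines Im z = 1 and Im z = -1 because the closed orbit
    satisfies both half return equations.

    The blocked set is bounded by the hyperbolas through the foci because beyond them, on both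
    lines, the two adjacent fields cross in the same direction. Each half return lands strictly
    beyond the focus, so the closed orbit keeps clear of the blocked set.

    The sphere cannot be replaced by the plane: for the internally tangent circles w = infinity is
    the ordinary point z = -2i, through which the orbit may pass. The coordinate 1/w gives again a
    chart z = kap + mu / (v - 1) with other constants, so each local fact is proved once for all
    such charts. *)

Local Notation Re := complex.Re.
Local Notation Im := complex.Im.

(** * Absolutely continuous functions *)

(** Cousin's lemma: the supremum of the points v with [Q s v] is itself such a point and cannot lie
    before t. The local hypothesis is asked only for intervals containing x, which leaves room for
    different behaviour on the two sides of a crossing time. *)
Lemma interval_additive_induction (R : realType) (Q : R -> R -> Prop) (s t : R) :
  s <= t ->
  (forall u v w, s <= u -> u <= v -> v <= w -> w <= t ->
     Q u v -> Q v w -> Q u w) ->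
  (forall x, s <= x <= t -> exists2 d, 0 < d &
     forall u v, s <= u -> u <= x -> x <= v -> v <= t ->
       x - d < u -> v < x + d -> Q u v) ->
  Q s t.
Proof.
move=> st Qtr Qloc.
pose E := [set u | s <= u <= t /\ Q s u].
have Es : E s.
  have [d d0 Hd] := Qloc s ltac:(by rewrite lexx st).
  by split; [rewrite lexx st | apply: Hd => //; lra].
have supE : has_sup E by split; [exists s | exists t => u [/andP[]]].
pose c := sup E.
have sc : s <= c by apply: ub_le_sup; [case: supE|].
have ct : c <= t by apply: ge_sup; [case: supE|move=> u [/andP[]]].
have [d d0 Hd] := Qloc c ltac:(by rewrite sc ct).
have [u [/andP[su ut] Qu] cdu] := sup_adherent d0 supE.
have uc : u <= c by apply: ub_le_sup; [case: supE|split; rewrite ?su ?ut].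
pose v := Num.min t (c + d / 2).
have vt : v <= t by rewrite ge_min lexx.
have cv : c <= v by rewrite le_min ct/=; lra.
have vd : v < c + d by rewrite gt_min; apply/orP; right; lra.
have Qv : Q s v.
  apply: (@Qtr _ u) => //; first exact: le_trans cv.
  exact: Hd.
have [ltct|] := ltP c t; last first.
  move=> tc; suff -> : t = v by []. by apply/eqP; rewrite eq_le vt (le_trans tc).
have : v <= c.
  apply: ub_le_sup; [by case: supE|split=> //].
  by rewrite vt (le_trans sc cv).
by rewrite ge_min leNgt ltct/=; lra.
Qed.

Section AbsContinuous.
Variable R : realType.
Let mu := @lebesgue_measure R.

(** Ordered lists replace indexed families so that the intervals chosen on adjacent pieces can be
    concatenated. *)
Lemma abs_continuous_list (f : R -> R) (s t e : R) :
  abs_continuous f s t -> 0 < e -> exists2 d : R, 0 < d &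
  forall L : seq (R * R),
    all (fun p => (s <= p.1) && (p.1 <= p.2) && (p.2 <= t)) L ->
    pairwise (fun p q => p.2 <= q.1) L ->
    \sum_(p <- L) (p.2 - p.1) < d -> \sum_(p <- L) `|f p.2 - f p.1| < e.
Proof.
move=> acf e0; have [d d0 H] := acf _ e0; exists d => // L /allP aL pL.
rewrite !(big_nth (0, 0)) !big_mkord => sL.
apply: (H _ (fun i => (nth (0, 0) L i).1) (fun i => (nth (0, 0) L i).2)) => //.
- by move=> i; have /aL/andP[/andP[]] := mem_nth (0, 0) (ltn_ord i).
- move=> i j ij; move/(pairwiseP (0, 0)) : pL => pL.
  have : (i < j)%N || (j < i)%N by rewrite -neq_ltn.
  by case/orP => lij; [left|right]; apply: pL; rewrite ?inE.
Qed.

(* The exceptional null set is covered by an open set of small measure: over the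
   intervals inside it the increments are small by absolute continuity, and
   elsewhere the derivative bounds the slopes. *)
Lemma abs_continuous_incr (f : R -> R) (s t m : R) : s <= t ->
  abs_continuous f s t ->
  {ae mu, forall x, s < x < t -> exists2 v, is_derive x (1 : R) f v & m <= v} ->
  m * (t - s) <= f t - f s.
Proof.
move=> st acf [B [mB B0 NB]].
(* The error e enters three times: in the slope, in the total length of the exceptional intervals,
   and in the increments over them. *)
suff H e : 0 < e -> (m - e) * (t - s) - `|m - e| * e - e <= f t - f s.
  apply/ler_addgt0Pr => e e0.
  pose k := (t - s) + `|m| + 3.
  have k0 : 0 < k by rewrite /k; have := normr_ge0 m; lra.
  pose e' := Num.min 1 (e / k).
  have e'0 : 0 < e' by rewrite lt_min ltr01 divr_gt0.
  have e'1 : e' <= 1 by rewrite ge_min lexx.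
  have e'k : e' * k <= e by rewrite -ler_pdivlMr// ge_min lexx orbT.
  have := H _ e'0.
  have : `|m - e'| <= `|m| + 1.
    by rewrite (le_trans (ler_normB _ _))// lerD2l gtr0_norm.
  rewrite /k in e'k; have := normr_ge0 (m - e').
  nra.
move=> e0.
have [d d0 Hd] := abs_continuous_list acf e0.
pose d' := Num.min d e.
have d'0 : 0 < d' by rewrite lt_min d0.
(* The endpoints join the null set because the derivative is controlled only inside the interval. *)
pose B' := B `|` [set s; t].
have mB' : measurable B' by do 2?apply: measurableU => //.
have B'0 : (mu B' = 0)%E.
  apply/eqP; rewrite eq_le measure_ge0 andbT.
  apply: (le_trans (measureU2 _ _ _)) => //; first by apply: measurableU.
  have mu1 x : mu [set x] = 0%E by exact: lebesgue_measure_set1.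
  rewrite [X in (X + _)%E]B0 add0e; apply: (le_trans (measureU2 _ _ _)) => //.
  by rewrite [X in (X + _)%E]mu1 add0e [X in (X <= _)%E]mu1.
have [G [oG B'G muG]] := @lebesgue_regularity_outer R B' d' mB'
  ltac:(by rewrite [X in (X < _)%E]B'0) d'0.
have mG : measurable G by exact: open_measurable.
have {}muG : (mu G < d'%:E)%E.
  have GE : G = B' `|` (G `\` B') by rewrite setDUK.
  rewrite GE; apply: (le_lt_trans (measureU2 _ _ _)) => //.
    exact: measurableD.
  by rewrite [X in (X + _)%E]B'0 add0e.
have mGI u v : measurable (G `&` `]u, v]) by exact: measurableI.
have muGI u v : (mu (G `&` `]u, v]) < d'%:E)%E.
  apply: le_lt_trans muG; apply: le_measure; rewrite ?inE//.
  exact: mGI.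
have finG u v : (mu (G `&` `]u, v]) \is a fin_num)%E.
  by rewrite ge0_fin_numE; [exact: lt_le_trans (muGI _ _) (leey _)|exact: measure_ge0].
pose g u v := fine (mu (G `&` `]u, v])).
have gD u v w : u <= v -> v <= w -> g u w = g u v + g v w.
  move=> uv vw; rewrite /g -fineD// -measureU//; last first.
    rewrite -subset0 => x /= [[_]] ; rewrite !in_itv/= => /andP[_ xv] [_] /andP[vx _].
    by move: (lt_le_trans vx xv); rewrite ltxx.
  1,2: exact: mGI.
  rewrite -setIUr; congr (fine (mu (_ `&` _))).
  by rewrite -itv_bndbnd_setU// bnd_simp.
(* [L] lists the intervals left to absolute continuity; their total length is at most the measure of
   [G] between u and v, and outside them f has slope at least m - e. The property is additive, so
   checking it near each point is enough. *)
pose Q u v := exists L : seq (R * R),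
  [/\ all (fun p => (u <= p.1) && (p.1 <= p.2) && (p.2 <= v)) L,
      pairwise (fun p q => p.2 <= q.1) L,
      \sum_(p <- L) (p.2 - p.1) <= g u v &
      (m - e) * ((v - u) - \sum_(p <- L) (p.2 - p.1))
         - \sum_(p <- L) `|f p.2 - f p.1| <= f v - f u].
have [L [aL pL sL fL]] : Q s t.
  apply: interval_additive_induction => //.
    move=> u v w su uv vw wt [L1 [a1 p1 s1 f1]] [L2 [a2 p2 s2 f2]].
    exists (L1 ++ L2); split.
    - rewrite all_cat; apply/andP; split.
        by apply: sub_all a1 => p /andP[/andP[-> ->]] /le_trans -> .
      by apply: sub_all a2 => p /andP[/andP[/(le_trans uv)-> ->]].
    - rewrite pairwise_cat p1 p2 !andbT; apply/allrelP => p q pL1 qL2.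
      move/allP : a1 => /(_ _ pL1) /andP[_ pv].
      move/allP : a2 => /(_ _ qL2) /andP[/andP[vq _] _].
      exact: le_trans vq.
    - by rewrite big_cat/= (gD u v w)// lerD.
    - by rewrite !big_cat/=; nra.
  move=> x /andP[sx xt].
  (* Near a point of the open cover the whole interval goes into the list; near any other point the
     derivative bounds the slope and the list is empty. *)
  have [Gx|Gx] := pselect (G x).
    move: oG; rewrite openE => /(_ _ Gx) /nbhs_ballP[r /= r0 xrG].
    exists r => // u v su ux xv vt xu vx.
    exists [:: (u, v)]; rewrite !big_cons !big_nil/= !addr0 lexx (le_trans ux xv) lexx/=.
    split=> //.
      rewrite /g (_ : G `&` _ = `]u, v]%classic).
        have -> : mu `]u, v]%classic = (v - u)%:E; last by [].
        rewrite /mu lebesgue_measure_itv/= lte_fin; have [//|uv] := ltP u v.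
        by congr (_%:E); lra.
      rewrite setIC; apply/setIidPl => y /=; rewrite in_itv/= => /andP[uy yv].
      by apply: xrG; rewrite /ball/= ltr_norml; apply/andP; split; lra.
    by rewrite subrr mulr0 sub0r lerNl -normrN ler_norm.
  have /= : ~ (~` (fun x => s < x < t -> exists2 v, is_derive x (1 : R) f v & m <= v)) x.
    by move=> /NB Bx; apply: Gx; apply: B'G; left.
  move/contrapT => /(_ _)[].
    rewrite !lt_neqAle sx xt !andbT; apply/andP; split; apply/negP => /eqP xE.
      by apply: Gx; apply: B'G; right; left; rewrite xE.
    by apply: Gx; apply: B'G; right; right; rewrite xE.
  move=> v dfx mv.
  have [fx Dfx] := dfx.
  have : (fun h : R => h^-1 *: (f (h + x) - f x)) @ 0^' --> (v : R).
    move: fx; rewrite /derivable => /cvg_ex[l Hl].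
    have -> : v = l.
      rewrite -Dfx; apply: (@cvg_lim R) => //.
    apply: cvg_trans Hl; apply: near_eq_cvg; near=> h.
    by rewrite [h *: 1]mulr1.
  move=> /cvgrPdist_lt /(_ _ e0); rewrite /dnbhs near_withinE.
  move=> /nbhs_ballP[r /= r0 Hr].
  have Hq h : `|h| < r -> h != 0 -> (m - e) <= (f (h + x) - f x) / h.
    move=> hr h0.
    have := Hr h; rewrite /ball/= sub0r normrN => /(_ hr h0).
    by rewrite ltr_norml [X in v - X]mulrC => /andP[_]; lra.
  exists r => // u w su ux xw wt xu wx.
  exists [::]; split => //=; rewrite ?big_nil.
    by rewrite /g fine_ge0.
  rewrite !subr0.
  have Hw : (m - e) * (w - x) <= f w - f x.
    have [->|wx0] := eqVneq w x; first by rewrite !subrr mulr0.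
    have wx0' : 0 < w - x by rewrite subr_gt0 lt_neqAle eq_sym wx0.
    rewrite -ler_pdivlMr// -{1}(subrK x w); apply: Hq; last by rewrite subr_eq0.
    by rewrite gtr0_norm//; lra.
  have Hu : (m - e) * (x - u) <= f x - f u.
    have [->|ux0] := eqVneq u x; first by rewrite !subrr mulr0.
    have ux0' : 0 < x - u by rewrite subr_gt0 lt_neqAle ux0.
    have := Hq (u - x); rewrite subrK subr_eq0 ux0 distrC gtr0_norm// => /(_ ltac:(lra) isT).
    have -> : (f u - f x) / (u - x) = (f x - f u) / (x - u).
      by rewrite -[X in X / _ = _]opprB -[X in _ / X = _]opprB invrN mulrNN.
    by rewrite ler_pdivlMr.
  lra.
have gst : g s t < d'.
  by rewrite -lte_fin /g fineK// ltey.
have sL0 : 0 <= \sum_(p <- L) (p.2 - p.1).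
  rewrite big_seq; apply: sumr_ge0 => p /(allP aL)/andP[/andP[_ +] _].
  by rewrite subr_ge0.
have sLd : \sum_(p <- L) (p.2 - p.1) < d.
  by apply: (le_lt_trans sL); apply: (lt_le_trans gst); rewrite ge_min lexx.
have sLe : \sum_(p <- L) (p.2 - p.1) < e.
  by apply: (le_lt_trans sL); apply: (lt_le_trans gst); rewrite ge_min lexx orbT.
have := Hd L aL pL sLd.
have : - (`|m - e| * e) <= - ((m - e) * \sum_(p <- L) (p.2 - p.1)).
  rewrite lerN2; apply: (le_trans (ler_norm _)); rewrite normrM ler_wpM2l//.
  by rewrite (ger0_norm sL0) ltW.
lra.
Unshelve. all: by end_near.
Qed.

End AbsContinuous.

(** * Complex curves *)

Lemma complexP (R : rcfType) (x y : R[i]) : Re x = Re y -> Im x = Im y -> x = y.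
Proof. by case: x => a b; case: y => c d /= -> ->. Qed.

Lemma reD (R : rcfType) (x y : R[i]) : Re (x + y) = Re x + Re y.
Proof. by case: x y => a b [c d]. Qed.
Lemma imD (R : rcfType) (x y : R[i]) : Im (x + y) = Im x + Im y.
Proof. by case: x y => a b [c d]. Qed.
Lemma reN (R : rcfType) (x : R[i]) : Re (- x) = - Re x.
Proof. by case: x. Qed.
Lemma imN (R : rcfType) (x : R[i]) : Im (- x) = - Im x.
Proof. by case: x. Qed.
Lemma reM (R : rcfType) (x y : R[i]) : Re (x * y) = Re x * Re y - Im x * Im y.
Proof. by case: x y => a b [c d]. Qed.
Lemma imM (R : rcfType) (x y : R[i]) : Im (x * y) = Re x * Im y + Im x * Re y.
Proof. by case: x y => a b [c d]. Qed.
Lemma reV (R : rcfType) (x : R[i]) : Re x^-1 = Re x / (Re x ^+ 2 + Im x ^+ 2).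
Proof. by case: x. Qed.
Lemma imV (R : rcfType) (x : R[i]) : Im x^-1 = - Im x / (Re x ^+ 2 + Im x ^+ 2).
Proof. by case: x => a b /=; rewrite mulNr. Qed.
Definition reimE := (reD, imD, reN, imN, reM, imM, reV, imV).

Lemma complex_neq0 (R : rcfType) (x : R[i]) : x != 0 -> 0 < Re x ^+ 2 + Im x ^+ 2.
Proof.
case: x => a b; rewrite eq_complex/= => /nandP H.
rewrite lt_neqAle addr_ge0 ?sqr_ge0// andbT eq_sym paddr_eq0 ?sqr_ge0// !sqrf_eq0.
by apply/nandP.
Qed.

(** Balls of R[i] have complex radii, and a positive complex number is a positive real; squares in
    Re and Im get rid of these radii. *)
Lemma nbhs_complexP (R : realType) (v0 : R[i]) (P : set R[i]) :
  nbhs (v0 : R[i]^o) P <->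
  exists2 e : R, 0 < e &
    forall v, `|Re v - Re v0| < e -> `|Im v - Im v0| < e -> P v.
Proof.
split.
  move=> /nbhs_ballP[[r r'] /=]; rewrite ltcE/= => /andP[/eqP -> r0] HP.
  exists (r / 2); first by lra.
  move=> v vr vi; apply: HP; rewrite -ball_normE/= normc_def ltcR.
  rewrite -[X in _ < X](@ger0_norm _ r) ?ltW// -sqrtr_sqr ltr_sqrt ?exprn_gt0//.
  rewrite !reimE; move: vr vi; rewrite !ltr_norml => /andP[? ?] /andP[? ?]; nra.
move=> [e e0 HP]; apply/nbhs_ballP; exists (e%:C); first by rewrite /= ltcR.
move=> v; rewrite -ball_normE/= normc_def ltcR !reimE => H.
by apply: HP; apply: le_lt_trans H; rewrite distrC -sqrtr_sqr ler_wsqrtr//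
  ?lerDl ?lerDr ?sqr_ge0.
Qed.

Section RealDerivatives.
Variable R : realType.
Implicit Types (f g : R -> R) (t : R).

Lemma is_derive1_cst (k : R) t : is_derive t (1 : R) (fun=> k) (0 : R).
Proof. exact: is_derive_cst. Qed.

Lemma is_derive1_id t : is_derive t (1 : R) (fun u => u) (1 : R).
Proof. exact: is_derive_id. Qed.

Lemma is_derive1D f g t a b : is_derive t (1 : R) f a -> is_derive t (1 : R) g b ->
  is_derive t (1 : R) (fun u => f u + g u) (a + b).
Proof. exact: is_deriveD. Qed.

Lemma is_derive1B f g t a b : is_derive t (1 : R) f a -> is_derive t (1 : R) g b ->
  is_derive t (1 : R) (fun u => f u - g u) (a - b).
Proof. exact: is_deriveB. Qed.

Lemma is_derive1M f g t a b : is_derive t (1 : R) f a -> is_derive t (1 : R) g b ->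
  is_derive t (1 : R) (fun u => f u * g u) (a * g t + f t * b).
Proof.
move=> df dg; have := is_deriveM df dg.
by rewrite /GRing.scale/= addrC (mulrC a).
Qed.

Lemma is_derive1V f t a : f t != 0 -> is_derive t (1 : R) f a ->
  is_derive t (1 : R) (fun u => (f u)^-1) (- a / f t ^+ 2).
Proof.
move=> f0 df; have := is_deriveV f0 df.
by congr is_derive; rewrite /GRing.scale/= mulNr [X in - X]mulrC mulNr ?exprVn.
Qed.

End RealDerivatives.

Section ComplexCurves.
Variable R : realType.
Implicit Types (z w : R -> R[i]) (t : R).

Definition cderiv z t (v : R[i]) :=
  is_derive t (1 : R) (fun u => Re (z u)) (Re v) /\
  is_derive t (1 : R) (fun u => Im (z u)) (Im v).

Definition ccont z t :=
  {for t, continuous (fun u => Re (z u))} /\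
  {for t, continuous (fun u => Im (z u))}.

Lemma cderiv_cont z t v : cderiv z t v -> ccont z t.
Proof.
by move=> [[d1 _] [d2 _]]; split; apply: differentiable_continuous;
  exact/derivable1_diffP.
Qed.

Lemma cderiv_cst (c : R[i]) t : cderiv (fun=> c) t 0.
Proof. by split; apply: is_derive_cst. Qed.

Lemma cderivD z w t v1 v2 :
  cderiv z t v1 -> cderiv w t v2 -> cderiv (fun u => z u + w u) t (v1 + v2).
Proof.
move=> [z1 z2] [w1 w2]; rewrite /cderiv reD imD; split.
  under eq_fun do rewrite reD; exact: is_derive1D.
under eq_fun do rewrite imD; exact: is_derive1D.
Qed.

Lemma cderivM z w t v1 v2 :
  cderiv z t v1 -> cderiv w t v2 ->
  cderiv (fun u => z u * w u) t (v1 * w t + z t * v2).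
Proof.
move=> [z1 z2] [w1 w2]; split.
  under eq_fun do rewrite reM.
  have := is_derive1B (is_derive1M z1 w1) (is_derive1M z2 w2).
  by congr is_derive; rewrite !reimE; ring.
under eq_fun do rewrite imM.
have := is_derive1D (is_derive1M z1 w2) (is_derive1M z2 w1).
by congr is_derive; rewrite !reimE; ring.
Qed.

Lemma cderivV z t v : z t != 0 -> cderiv z t v ->
  cderiv (fun u => (z u)^-1) t (- v / z t ^+ 2).
Proof.
move=> zt0 [z1 z2].
have n0 : Re (z t) ^+ 2 + Im (z t) ^+ 2 != 0 by rewrite lt0r_neq0// complex_neq0.
pose n u := Re (z u) ^+ 2 + Im (z u) ^+ 2.
have dn := is_derive1D (is_derive1M z1 z1) (is_derive1M z2 z2).
have nV : is_derive t (1 : R) (fun u => (n u)^-1) _ := @is_derive1V _ n _ _ n0 dn.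
split.
  under eq_fun do rewrite reV.
  have := is_derive1M z1 nV.
  congr is_derive; rewrite expr2 !reimE /n.
  move: n0; set x := Re (z t); set y := Im (z t) => n0; clearbody x y.
  have e : (x * x - y * y) ^+ 2 + (x * y + y * x) ^+ 2 = (x ^+ 2 + y ^+ 2) ^+ 2 by ring.
  by field; rewrite e expf_eq0/= n0.
under eq_fun do rewrite imV mulNr.
have := is_deriveN (is_derive1M z2 nV).
congr is_derive; rewrite expr2 !reimE /n.
move: n0; set x := Re (z t); set y := Im (z t) => n0; clearbody x y.
have e : (x * x - y * y) ^+ 2 + (x * y + y * x) ^+ 2 = (x ^+ 2 + y ^+ 2) ^+ 2 by ring.
by field; rewrite e expf_eq0/= n0.
Qed.

Lemma ccontM z w t : ccont z t -> ccont w t -> ccont (fun u => z u * w u) t.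
Proof.
move=> [z1 z2] [w1 w2]; split; rewrite /prop_for.
  under eq_fun do rewrite reM.
  by apply: cvgB; apply: cvgM.
under eq_fun do rewrite imM.
by apply: cvgD; apply: cvgM.
Qed.

Lemma ccontD z w t : ccont z t -> ccont w t -> ccont (fun u => z u + w u) t.
Proof.
move=> [z1 z2] [w1 w2]; split; rewrite /prop_for.
  by under eq_fun do rewrite reD; apply: cvgD.
by under eq_fun do rewrite imD; apply: cvgD.
Qed.

Lemma ccont_cst (c : R[i]) t : ccont (fun=> c) t.
Proof. by split; apply: cvg_cst. Qed.

Lemma ccontV z t : z t != 0 -> ccont z t -> ccont (fun u => (z u)^-1) t.
Proof.
move=> zt0 [z1 z2].
have n0 : Re (z t) ^+ 2 + Im (z t) ^+ 2 != 0 by rewrite lt0r_neq0// complex_neq0.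
have nV : (fun u => (Re (z u) ^+ 2 + Im (z u) ^+ 2)^-1) @ t -->
    (Re (z t) ^+ 2 + Im (z t) ^+ 2)^-1.
  by apply: cvgV => //; apply: cvgD; rewrite expr2; under eq_fun do rewrite expr2;
    apply: cvgM.
split; rewrite /prop_for.
  by under eq_fun do rewrite reV; exact: cvgM.
under eq_fun do rewrite imV; apply: cvgM => //.
exact: cvgN.
Qed.

Lemma cderiv0_cst z (a b : R) : a <= b ->
  (forall s, a <= s <= b -> ccont z s) ->
  (forall s, a < s < b -> cderiv z s 0) -> z a = z b.
Proof.
rewrite le_eqVlt => /predU1P[-> //|ab] cz dz.
suff H (f : R -> R) : (forall s, a <= s <= b -> {for s, continuous f}) ->
    (forall s, a < s < b -> is_derive s (1 : R) f 0) -> f a = f b.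
  by apply: complexP; apply: (H (fun u => _ (z u))) => s /[dup] si;
    [move/cz => []|move/dz=> []|move/cz => []|move/dz=> []].
move=> cf df.
have df' x : x \in `]a, b[%R -> is_derive x (1 : R) f 0.
  by rewrite in_itv/=; exact: df.
have cf' : {within `[a, b], continuous f}.
  by apply: continuous_in_subspaceT => x; rewrite inE/= in_itv/=; exact: cf.
have [c _] := MVT ab df' cf'.
by rewrite mul0r => /eqP; rewrite subr_eq0 => /eqP.
Qed.

Lemma ccontP z t : ccont z t <-> forall e : R, 0 < e -> exists2 d : R, 0 < d &
  forall s, `|s - t| < d -> `|Re (z s) - Re (z t)| < e /\ `|Im (z s) - Im (z t)| < e.
Proof.
split.
  move=> [/cvgrPdist_lt c1 /cvgrPdist_lt c2] e e0.
  have /nbhs_ballP[r /= r0 H] : \forall s \near t,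
      `|Re (z t) - Re (z s)| < e /\ `|Im (z t) - Im (z s)| < e.
    by near=> s; split; near: s; [exact: c1|exact: c2].
  exists r => // s sr; rewrite (distrC (Re (z s))) (distrC (Im (z s))).
  by apply: H; rewrite -ball_normE/= distrC.
move=> H; split; apply/cvgrPdist_lt => e /H[d d0 Hd]; apply/nbhs_ballP;
  exists d => //= s; rewrite /= distrC => /Hd[]; by rewrite ?(distrC (Re (z s))) ?(distrC (Im (z s))).
Unshelve. all: by end_near.
Qed.

End ComplexCurves.

(** * The piecewise linear system in the strip coordinate *)

Section Spiral.
Variable R : realType.
Implicit Types (a b h k : R) (z u : R[i]).

(** The complex exponential e^((a + bi)h). *)
Definition spiral a b h : R[i] :=
  (expR (a * h) * cos (b * h)) +i* (expR (a * h) * sin (b * h)).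

Lemma spiral0 a b : spiral a b 0 = 1.
Proof. by rewrite /spiral !mulr0 expR0 cos0 sin0 mulr1 mulr0. Qed.

Lemma spiralD a b h k : spiral a b (h + k) = spiral a b h * spiral a b k.
Proof.
by apply: complexP; rewrite !reimE /= !mulrDr expRD ?cosD ?sinD; ring.
Qed.

Lemma cderiv_spiral a b h : cderiv (spiral a b) h ((a +i* b) * spiral a b h).
Proof.
have lin k : is_derive h (1 : R) (fun x => k * x) k.
  have := is_derive1M (is_derive_cst k h 1) (is_derive_id h 1).
  by rewrite mul0r add0r mulr1.
have e : is_derive h (1 : R) (fun x => expR (a * x)) (a * expR (a * h)).
  by have := @is_derive1_comp _ (@expR R) _ _ _ _ (is_derive_expR _) (lin a);
    congr is_derive; rewrite mulrC.
have co : is_derive h (1 : R) (fun x => cos (b * x)) (- (b * sin (b * h))).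
  have := @is_derive1_comp _ (@cos R) _ _ _ _ (is_derive_cos _) (lin b).
  by congr is_derive; rewrite mulNr mulrC.
have si : is_derive h (1 : R) (fun x => sin (b * x)) (b * cos (b * h)).
  by have := @is_derive1_comp _ (@sin R) _ _ _ _ (is_derive_sin _) (lin b);
    congr is_derive; rewrite mulrC.
split.
  have := is_derive1M e co; congr is_derive; rewrite !reimE /=; ring.
have := is_derive1M e si; congr is_derive; rewrite !reimE /=; ring.
Qed.

Definition cmod u := Num.sqrt (Re u ^+ 2 + Im u ^+ 2).
(** The argument with values in [0, pi], correct only in the closed upper half plane. This is
    enough, since each focus lies on the boundary of the half plane that its field governs. *)
Definition carg u := acos (Re u / cmod u).

Lemma cmod_gt0 u : u != 0 -> 0 < cmod u.
Proof. by move=> /complex_neq0; rewrite sqrtr_gt0. Qed.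

Lemma cargP u : u != 0 -> 0 <= Im u ->
  [/\ 0 <= carg u <= pi, Re u = cmod u * cos (carg u) &
      Im u = cmod u * sin (carg u)].
Proof.
move=> u0 imu; have r0 := cmod_gt0 u0.
have rr : cmod u ^+ 2 = Re u ^+ 2 + Im u ^+ 2.
  by rewrite sqr_sqrtr// addr_ge0 ?sqr_ge0.
have nr : -1 <= Re u / cmod u <= 1.
  by rewrite ler_pdivlMr// ler_pdivrMr// mulN1r mul1r -ler_norml -sqrtr_sqr
    ler_wsqrtr// lerDl sqr_ge0.
have acE : cos (carg u) = Re u / cmod u by rewrite /carg acosK.
have H0 : 0 <= carg u <= pi by rewrite acos_ge0 ?acos_lepi.
split => //; first by rewrite acE mulrC divfK ?lt0r_neq0.
have s0 : 0 <= sin (carg u) by rewrite sin_ge0_pi.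
apply/eqP; rewrite -(@eqrXn2 _ 2) ?mulr_ge0 ?(ltW r0)//.
by rewrite exprMn sin2cos2 acE mulrBr mulr1 -exprMn [cmod u * _]mulrC
  divfK ?lt0r_neq0// rr addrAC subrr add0r.
Qed.

Lemma polarK (r t : R) u : 0 < r -> 0 <= t <= pi ->
  Re u = r * cos t -> Im u = r * sin t -> cmod u = r /\ carg u = t.
Proof.
move=> r0 t0 ru iu.
have rE : cmod u = r.
  by rewrite /cmod ru iu !exprMn -mulrDr cos2Dsin2 mulr1 sqrtr_sqr gtr0_norm.
split => //; rewrite /carg rE ru mulrAC divff ?lt0r_neq0// mul1r cosK// in_itv.
Qed.

(** The bound on b h rules out a full turn: the angle [carg u + b * h] lies strictly between -pi and
    2 pi, and there a nonnegative sine forces it into [0, pi]. *)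
Lemma polar_spiral a b h u v : u != 0 -> 0 <= Im u -> 0 <= Im v ->
  `|b * h| < pi -> v = u * spiral a b h ->
  cmod v = cmod u * expR (a * h) /\ carg v = carg u + b * h.
Proof.
move=> u0 imu imv bh vE.
have [au ru iu] := cargP u0 imu.
have Rv : Re v = cmod u * expR (a * h) * cos (carg u + b * h).
  by rewrite vE reM ru iu /= cosD; ring.
have Iv : Im v = cmod u * expR (a * h) * sin (carg u + b * h).
  by rewrite vE imM ru iu /= sinD; ring.
have r0 : 0 < cmod u * expR (a * h) by rewrite mulr_gt0 ?cmod_gt0 ?expR_gt0.
apply: polarK => //.
have {imv} : 0 <= sin (carg u + b * h) by move: imv; rewrite Iv pmulr_rge0.
move: bh au; rewrite ltr_norml => /andP[b1 b2] /andP[a1 a2] s0.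
apply/andP; split; rewrite leNgt; apply/negP => H.
  have : 0 < sin (- (carg u + b * h)) by apply: sin_gt0_pi; apply/andP; split; lra.
  by rewrite sinN; lra.
have : 0 < sin (carg u + b * h - pi) by apply: sin_gt0_pi; apply/andP; split; lra.
have e : sin (carg u + b * h) = - sin (carg u + b * h - pi).
  by rewrite -sinDpi subrK.
by rewrite e in s0; lra.
Qed.

End Spiral.

Variant zone := Up | Lf | Lw | Rt.

Definition opp_zone k :=
  match k with Up => Lw | Lf => Rt | Lw => Up | Rt => Lf end.

(* Focus a b x is the field (a + bi)(z - (-x + i)) above Im z = 1.  Rotating by pi
   exchanges the two half planes, so in a pair F, G the field below Im z = -1 is
   the one of G read at - z. *)
Record focus (R : realType) := Focus { fa : R; fb : R; fx : R }.

(** * Zones, explicit flow and signed deviation in the strip coordinate *)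

Section Strip.
Variable R : realType.
Implicit Types (F G : focus R) (z : R[i]) (k : zone).

(** The strip is cut along the imaginary axis, which its unblocked part does not meet. On each side
    z can be recovered from z^2. *)
Definition inzone k z : Prop :=
  match k with
  | Up => 1 < Im z
  | Lf => [/\ Re z < 0, -1 < Im z & Im z < 1]
  | Lw => Im z < -1
  | Rt => [/\ 0 < Re z, -1 < Im z & Im z < 1]
  end.

(* The zone entered after, resp. left before, the passage through z of a
   solution that avoids the blocked set. *)
Definition zone_after z : zone :=
  if 0 < Re z then if 1 <= Im z then Up else if -1 <= Im z then Rt else Lw
  else if 1 < Im z then Up else if -1 < Im z then Lf else Lw.

Definition zone_before z : zone :=
  if 0 < Re z then if 1 < Im z then Up else if -1 < Im z then Rt else Lw
  else if 1 <= Im z then Up else if -1 <= Im z then Lf else Lw.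

Definition focus_pt F : R[i] := (- fx F) +i* 1.

Definition focus_field F z := (fa F +i* fb F) * (z - focus_pt F).

Definition zfield F G k z :=
  match k with
  | Up => focus_field F z
  | Lw => - focus_field G (- z)
  | _ => 'i%C / z
  end.

(* Removes from the strip the part between the hyperbolas through the two foci,
   which contains the sliding segments and the pole. *)
Definition unblocked F G z : Prop :=
  [\/ 1 < `|Im z|,
      0 < Re z /\ fx G ^+ 2 < Re z ^+ 2 - Im z ^+ 2 + 1 |
      Re z < 0 /\ fx F ^+ 2 < Re z ^+ 2 - Im z ^+ 2 + 1].

(** At a crossing time the two one-sided derivatives may differ, so nothing is asked of the
    derivative at t itself. The zones on both sides of t are functions of the point [z t], which
    builds in the direction of crossing. *)
Definition zsol_at F G (z : R -> R[i]) t : Prop :=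
  [/\ unblocked F G (z t), ccont z t,
      exists2 e : R, 0 < e & forall s, t < s < t + e ->
        inzone (zone_after (z t)) (z s) /\
        cderiv z s (zfield F G (zone_after (z t)) (z s)) &
      exists2 e : R, 0 < e & forall s, t - e < s < t ->
        inzone (zone_before (z t)) (z s) /\
        cderiv z s (zfield F G (zone_before (z t)) (z s))].

Definition zsol F G (z : R -> R[i]) : Prop := forall t, zsol_at F G z t.

(** In the strip z z' = i integrates to z^2 + 2ih; this fixes the end point only up to sign. *)
Definition flow F G k z (h : R) z' : Prop :=
  match k with
  | Up => z' - focus_pt F = (z - focus_pt F) * spiral (fa F) (fb F) h
  | Lw => - z' - focus_pt G = (- z - focus_pt G) * spiral (fa G) (fb G) h
  | _ => z' ^+ 2 = z ^+ 2 + 0 +i* (2 * h)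
  end.

(** In polar coordinates at the focus the closed orbit leaves X + i with angle 0 and radius X +
    [fx F], and has the equation r = (X + fx) e^((a/b) theta). The deviation is the difference of
    the radii at equal angle. *)
Definition spiral_dev F (X : R) z :=
  cmod (z - focus_pt F) -
  (X + fx F) * expR (fa F / fb F * carg (z - focus_pt F)).

(** In the strip the square root is the absolute value of the abscissa at which the hyperbola
    through z meets the lines Im z = 1 and Im z = -1. The closed orbit has abscissa X on the right
    and -Y on the left. *)
Definition dev F G (X Y : R) k z : R :=
  match k with
  | Up => spiral_dev F X z
  | Lw => spiral_dev G Y (- z)
  | Rt => Num.sqrt (Re z ^+ 2 - Im z ^+ 2 + 1) - X
  | Lf => Num.sqrt (Re z ^+ 2 - Im z ^+ 2 + 1) - Y
  end.

Definition rate F G k : R :=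
  match k with Up => fa F | Lw => fa G | _ => 0 end.

Lemma zfield_opp F G k z :
  zfield G F (opp_zone k) (- z) = - zfield F G k z.
Proof. by case: k => /=; rewrite ?opprK// invrN mulrN. Qed.

Lemma inzone_opp k z : inzone (opp_zone k) (- z) <-> inzone k z.
Proof.
by case: k => /=; rewrite !reimE; split; [| | case| case | | | case| case] => *;
  try split; lra.
Qed.

Lemma unblocked_opp F G z : unblocked G F (- z) <-> unblocked F G z.
Proof.
rewrite /unblocked !reimE normrN !sqrrN.
split; (case=> [?|[? ?]|[? ?]]; [exact: Or31|apply: Or33|apply: Or32]);
  split=> //; lra.
Qed.

Lemma dev_opp F G X Y k z : dev G F Y X (opp_zone k) (- z) = dev F G X Y k z.
Proof. by case: k => /=; rewrite ?opprK// !reimE !sqrrN. Qed.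

Lemma inzone_after k z : inzone k z -> zone_after z = k.
Proof.
by case: k => /= [?|[? ? ?]|?|[? ? ?]]; rewrite /zone_after;
  repeat case: ifPn; rewrite -?leNgt -?ltNge => * //; exfalso; lra.
Qed.

Lemma inzone_before k z : inzone k z -> zone_before z = k.
Proof.
by case: k => /= [?|[? ? ?]|?|[? ? ?]]; rewrite /zone_before;
  repeat case: ifPn; rewrite -?leNgt -?ltNge => * //; exfalso; lra.
Qed.

Lemma zone_after_opp F G z : unblocked F G z ->
  zone_after (- z) = opp_zone (zone_after z).
Proof.
have e : Im z < -1 -> Im z < 1 by move=> ?; lra.
have e' : 1 < Im z -> -1 < Im z by move=> ?; lra.
case=> [|[r0 _]|[r0 _]].
- rewrite lter_normr => /orP[H|H].
    by rewrite (@inzone_after Up z)// (@inzone_after Lw (- z))//= imN ltrN2.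
  by rewrite (@inzone_after Lw z) ?(@inzone_after Up (- z))//= ?imN// ltrNr.
- rewrite /zone_after !reimE oppr_gt0 r0 ltNge (ltW r0)/= ltrNr ltrN2 !leNgt.
  by case: (ltP (Im z) (-1)) e => [_ ->|]//; case: (ltP (Im z) 1).
- rewrite /zone_after !reimE oppr_gt0 r0 [0 < Re z]ltNge (ltW r0)/= lerNr lerN2.
  rewrite ![Im z <= _]leNgt.
  by case: (ltP 1 (Im z)) e' => [_ ->|]//; case: (ltP (-1) (Im z)).
Qed.

Lemma zone_before_opp F G z : unblocked F G z ->
  zone_before (- z) = opp_zone (zone_before z).
Proof.
have e : Im z <= -1 -> Im z < 1 by move=> ?; lra.
have e' : 1 <= Im z -> -1 <= Im z by move=> ?; lra.
case=> [|[r0 _]|[r0 _]].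
- rewrite lter_normr => /orP[H|H].
    by rewrite (@inzone_before Up z)// (@inzone_before Lw (- z))//= imN ltrN2.
  by rewrite (@inzone_before Lw z) ?(@inzone_before Up (- z))//= ?imN// ltrNr.
- rewrite /zone_before !reimE oppr_gt0 r0 ltNge (ltW r0)/= lerNr lerN2.
  rewrite [1 < _]ltNge [-1 < _]ltNge.
  by case: (leP (Im z) (-1)) e => [_ /(_ isT)/ltW ->|]//; case: (leP (Im z) 1).
- rewrite /zone_before !reimE oppr_gt0 r0 [0 < Re z]ltNge (ltW r0)/= ltrNr ltrN2.
  rewrite ![Im z < _]ltNge.
  by case: (leP 1 (Im z)) e' => [_ ->|]//; case: (leP (-1) (Im z)).
Qed.

Lemma flow_sym F G k z h z' : flow F G k z h z' -> flow F G k z' (- h) z.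
Proof.
have E (u v : R[i]) (a b : R) : v = u * spiral a b h -> u = v * spiral a b (- h).
  by move=> ->; rewrite -mulrA -spiralD subrr spiral0 mulr1.
case: k => /=; [exact: E| |exact: E|] => ->;
  by apply: complexP; rewrite !reimE/=; ring.
Qed.

(** In the strip the sign of Re z, fixed by the zone, selects the square root. *)
Lemma flow_uniq F G k z h z1 z2 : inzone k z1 -> inzone k z2 ->
  flow F G k z h z1 -> flow F G k z h z2 -> z1 = z2.
Proof.
have S (u v : R[i]) : u ^+ 2 = v ^+ 2 -> 0 < Re u * Re v -> u = v.
  move=> /eqP; rewrite eqf_sqr => /orP[/eqP//|/eqP ->].
  by rewrite reN mulNr oppr_gt0 ltNge -expr2 sqr_ge0.
case: k => /=.
- by move=> _ _ <- /addIr.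
- by move=> [r1 _ _] [r2 _ _] <- /esym /S; apply; rewrite nmulr_rgt0.
- by move=> _ _ <- /addIr/oppr_inj.
- by move=> [r1 _ _] [r2 _ _] <- /esym /S; apply; rewrite mulr_gt0.
Qed.

(** The quantities (z - focus) e^(-(a + bi)u) and z^2 - 2iu are constant in time. Only continuity is
    used at s and t, so the formula holds up to crossing times. *)
Lemma flow_cderiv F G k (z : R -> R[i]) (s t : R) : s <= t ->
  (forall u, s <= u <= t -> ccont z u) ->
  (forall u, s < u < t -> inzone k (z u) /\ cderiv z u (zfield F G k (z u))) ->
  flow F G k (z s) (t - s) (z t).
Proof.
move=> st cz dz.
have spi H (p : R -> R[i]) : (forall u, s <= u <= t -> ccont p u) ->
    (forall u, s < u < t -> cderiv p u (focus_field H (p u))) ->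
    p t - focus_pt H = (p s - focus_pt H) * spiral (fa H) (fb H) (t - s).
  move=> cp dp.
  pose g u := (p u + - focus_pt H) * spiral (- fa H) (- fb H) u.
  have : g s = g t.
    apply: cderiv0_cst => // u ui.
      apply: ccontM; first by apply: ccontD; [exact: cp|exact: ccont_cst].
      exact: cderiv_cont (cderiv_spiral _ _ _).
    have := cderivM (cderivD (dp _ ui) (cderiv_cst (- focus_pt H) u))
      (cderiv_spiral (- fa H) (- fb H) u).
    congr cderiv; rewrite /focus_field.
    rewrite addr0 (_ : (- fa H) +i* (- fb H) = - (fa H +i* fb H))//; ring.
  have sN u : spiral (- fa H) (- fb H) u = spiral (fa H) (fb H) (- u).
    by rewrite /spiral !mulNr !mulrN.
  rewrite /g !sN => /(congr1 ( *%R^~ (spiral (fa H) (fb H) t))).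
  by rewrite -!mulrA -!spiralD addNr spiral0 mulr1 [- s + t]addrC => ->.
have str : (forall u, s < u < t -> z u != 0 /\ cderiv z u ('i%C / z u)) ->
    z t ^+ 2 = z s ^+ 2 + 0 +i* (2 * (t - s)).
  move=> dz'.
  pose g u := z u * z u + ((- 2 +i* 0) * 'i%C) * (u +i* 0).
  have lin u : cderiv (fun u : R => u +i* 0) u (1 +i* 0).
    by split; [exact: is_derive_id|exact: is_derive_cst].
  have : g s = g t.
    apply: cderiv0_cst => // u ui.
      apply: ccontD; first by apply: ccontM; exact: cz.
      by apply: ccontM; [exact: ccont_cst|exact: cderiv_cont (lin u)].
    have [zu0 dzu] := dz' _ ui.
    have := cderivD (cderivM dzu dzu)
      (cderivM (cderiv_cst ((- 2 +i* 0) * 'i%C) u) (lin u)).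
    congr cderiv; rewrite mul0r add0r [z u * _]mulrC divfK//.
    by apply: complexP; rewrite !reimE/=; ring.
  rewrite /g => /eqP; rewrite -subr_eq => /eqP/esym; rewrite -!expr2 => ->.
  by apply: complexP; rewrite !reimE/=; ring.
case: k dz => /= dz.
- by apply: spi => // u /dz[].
- apply: str => u /dz[[ru _ _] ?]; split => //.
  by apply/eqP => u0; move: ru; rewrite u0 ltxx.
- apply: (spi G (fun u => - z u)).
    move=> u /cz cu; have := ccontM (ccont_cst (- 1) u) cu.
    by congr ccont; apply/funext => v; rewrite mulN1r.
  move=> u /dz[_ du]; have := cderivM (cderiv_cst (- 1) u) du.
  rewrite mul0r add0r mulN1r opprK; congr cderiv.
  by apply/funext => v; rewrite mulN1r.
- apply: str => u /dz[[ru _ _] ?]; split => //.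
  by apply/eqP => u0; move: ru; rewrite u0 ltxx.
Qed.

Lemma zsol_flow_after F G (z : R -> R[i]) t : zsol F G z -> exists2 e : R, 0 < e &
  forall h, 0 < h < e -> inzone (zone_after (z t)) (z (t + h)) /\
    flow F G (zone_after (z t)) (z t) h (z (t + h)).
Proof.
move=> sz; have [_ _ [e e0 He] _] := sz t; exists e => // h /andP[h0 he].
split; first by have [|] := He (t + h); first by apply/andP; split; lra.
have hE : t + h - t = h by rewrite addrAC subrr add0r.
have := @flow_cderiv F G (zone_after (z t)) z t (t + h); rewrite hE; apply; first by lra.
  by move=> u _; case: (sz u).
by move=> u /andP[tu uth]; apply: He; apply/andP; split; lra.
Qed.

Lemma zsol_flow_before F G (z : R -> R[i]) t : zsol F G z -> exists2 e : R, 0 < e &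
  forall h, 0 < h < e -> inzone (zone_before (z t)) (z (t - h)) /\
    flow F G (zone_before (z t)) (z t) (- h) (z (t - h)).
Proof.
move=> sz; have [_ _ _ [e e0 He]] := sz t; exists e => // h /andP[h0 he].
split; first by have [|] := He (t - h); first by apply/andP; split; lra.
apply: flow_sym; have hE : t - (t - h) = h by rewrite opprB addrC subrK.
have := @flow_cderiv F G (zone_before (z t)) z (t - h) t; rewrite hE; apply; first by lra.
  by move=> u _; case: (sz u).
by move=> u /andP[tu uth]; apply: He; apply/andP; split; lra.
Qed.

End Strip.

(** * The deviation inside a zone and across the two lines *)

Section Deviation.
Variable R : realType.
Implicit Types (F G : focus R) (k : zone) (X Y : R).

Definition contracting F : Prop := [/\ fa F < 0, 0 < fb F & 1 < fx F].

(** Half a turn about the focus -x + i multiplies the distance to it by e^(a pi/b) and carries X + i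
    to -Y + i. The strip then leads to -Y - i, which is Y + i after rotation by pi, ready for the
    same map with the other focus. *)
Definition half_return F X Y : Prop :=
  Y = fx F + expR (fa F / fb F * pi) * (X + fx F).

(** The arc comes down beyond the focus; this is what keeps the closed orbit off the blocked set. *)
Lemma half_return_gt F X Y : contracting F -> 0 < X -> half_return F X Y ->
  fx F < Y.
Proof.
move=> [_ _ x1] X0 ->; rewrite ltrDl mulr_gt0 ?expR_gt0//; lra.
Qed.

(** The radius is multiplied by e^(ah) and the angle grows by bh, so e^((a/b) theta) is multiplied
    by the same factor e^(ah). *)
Lemma spiral_dev_flow F X (z z' : R[i]) (h : R) : contracting F ->
  z != focus_pt F -> 1 <= Im z -> 1 <= Im z' -> `|fb F * h| < pi ->
  z' - focus_pt F = (z - focus_pt F) * spiral (fa F) (fb F) h ->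
  spiral_dev F X z' = expR (fa F * h) * spiral_dev F X z.
Proof.
move=> [_ b0 _] zc iz iz' bh zz'.
have [] := @polar_spiral _ (fa F) (fb F) h (z - focus_pt F) (z' - focus_pt F) _ _ _ bh zz'.
- by rewrite subr_eq0.
- by rewrite !reimE /= subr_ge0.
- by rewrite !reimE /= subr_ge0.
rewrite /spiral_dev => -> ->.
set t := carg _.
have -> : fa F / fb F * (t + fb F * h) = fa F / fb F * t + fa F * h.
  by field; rewrite lt0r_neq0.
by rewrite expRD; ring.
Qed.

(** The focus lies on the bounding hyperbola itself. Polar coordinates at the focus are thus defined
    at every unblocked point. *)
Lemma unblocked_focus_pt F G : 0 <= fx F -> ~ unblocked F G (focus_pt F).
Proof.
rewrite /unblocked /focus_pt /= normr1 ltxx => x0 [//|[? _]|[_ ?]]; first by lra.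
nra.
Qed.

Lemma zone_closure k (z : R[i]) : zone_after z = k \/ zone_before z = k ->
  match k return Prop with Up => 1 <= Im z | Lw => Im z <= -1 | _ => True end.
Proof.
rewrite /zone_after /zone_before.
by case: k => //; case; repeat case: ifPn; rewrite -?leNgt -?ltNge => * //; lra.
Qed.

Lemma dev_flow F G X Y k (z z' : R[i]) (h : R) : contracting F -> contracting G ->
  unblocked F G z -> zone_after z = k \/ zone_before z = k -> inzone k z' ->
  `|fb F * h| < pi -> `|fb G * h| < pi -> flow F G k z h z' ->
  dev F G X Y k z' = expR (rate F G k * h) * dev F G X Y k z.
Proof.
move=> cF cG uz zk kz' hF hG.
have str : z' ^+ 2 = z ^+ 2 + 0 +i* (2 * h) ->
    Re z' ^+ 2 - Im z' ^+ 2 = Re z ^+ 2 - Im z ^+ 2.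
  by move=> /(congr1 (@complex.Re R)); rewrite !expr2 !reimE /= addr0.
have xF : 0 <= fx F by case: cF => _ _ ?; lra.
have xG : 0 <= fx G by case: cG => _ _ ?; lra.
have := zone_closure zk; case: k kz' {zk} => /= kz' iz.
- apply: spiral_dev_flow => //; last exact: ltW.
  by apply/eqP => zE; apply: (@unblocked_focus_pt F G) => //; rewrite -zE.
- by move=> /str ->; rewrite mul0r expR0 mul1r.
- apply: spiral_dev_flow => //; rewrite ?imN; [|lra|lra].
  apply/eqP => zE; apply: (@unblocked_focus_pt G F) => //; rewrite -zE.
  exact/unblocked_opp.
- by move=> /str ->; rewrite mul0r expR0 mul1r.
Qed.

(** On the right the angle is 0 and the radius Re z + fx, so both sides give Re z - X. On the left
    the angle is pi and the radius -(Re z + fx); there [half_return] turns (X + fx) e^(a pi/b) into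
    Y - fx, and both sides give -Re z - Y. *)
Lemma dev_top F G X Y (z : R[i]) : contracting F -> 0 < X -> half_return F X Y ->
  unblocked F G z -> Im z = 1 ->
  dev F G X Y (zone_before z) z = dev F G X Y (zone_after z) z.
Proof.
move=> [a0 b0 x1] X0 HY uz iz.
rewrite /zone_before /zone_after iz !ltxx !lexx (_ : (-1 < 1) = true); last by lra.
have sq : Num.sqrt (Re z ^+ 2 - Im z ^+ 2 + 1) = `|Re z|.
  by rewrite iz expr1n subrK sqrtr_sqr.
have rc : Re (z - focus_pt F) = Re z + fx F by rewrite !reimE /= opprK.
have ic : Im (z - focus_pt F) = 0 by rewrite !reimE /= iz subrr.
case: uz; rewrite ?iz ?normr1 ?ltxx// => -[r0 H].
  rewrite r0 /= sq gtr0_norm// /spiral_dev.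
  have [||||-> ->] := @polarK _ (Re z + fx F) 0 (z - focus_pt F).
  - lra.
  - by rewrite lexx pi_ge0.
  - by rewrite cos0 mulr1.
  - by rewrite sin0 mulr0.
  by rewrite mulr0 expR0; ring.
rewrite ltNge (ltW r0) /= sq ltr0_norm// /spiral_dev.
have [||||-> ->] := @polarK _ (- (Re z + fx F)) pi (z - focus_pt F).
- by rewrite expr1n subrK in H; nra.
- by rewrite pi_ge0 lexx.
- by rewrite cospi rc; ring.
- by rewrite sinpi mulr0.
by rewrite HY; ring.
Qed.

Lemma dev_before_after F G X Y (z : R[i]) : contracting F -> contracting G ->
  0 < X -> 0 < Y -> half_return F X Y -> half_return G Y X -> unblocked F G z ->
  dev F G X Y (zone_before z) z = dev F G X Y (zone_after z) z.
Proof.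
move=> cF cG X0 Y0 HY HX uz.
have [iz|iz1] := eqVneq (Im z) 1; first exact: dev_top.
have [iz|iz2] := eqVneq (Im z) (-1).
  have uz' : unblocked G F (- z) by exact/unblocked_opp.
  rewrite -(dev_opp _ _ _ _ (zone_before z)) -(dev_opp _ _ _ _ (zone_after z)).
  rewrite -(zone_after_opp uz) -(zone_before_opp uz).
  by apply: dev_top => //; rewrite imN iz opprK.
suff -> : zone_before z = zone_after z by [].
rewrite /zone_before /zone_after.
by rewrite ![1 <= _]le_eqVlt ![-1 <= _]le_eqVlt ![_ == Im z]eq_sym (negbTE iz1) (negbTE iz2).
Qed.

End Deviation.

(** * Vanishing of the deviation on periodic solutions *)

Section PeriodicSolution.
Variable R : realType.
Variables (F G : focus R) (X Y : R).
Hypotheses (cF : contracting F) (cG : contracting G).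
Hypotheses (X0 : 0 < X) (Y0 : 0 < Y).
Hypotheses (HY : half_return F X Y) (HX : half_return G Y X).

Definition total_dev (z : R[i]) := dev F G X Y (zone_after z) z.

Lemma total_dev_local (z : R -> R[i]) t : zsol F G z -> exists2 e : R, 0 < e &
  forall h, 0 < h < e ->
    [/\ total_dev (z (t + h)) =
          expR (rate F G (zone_after (z t)) * h) * total_dev (z t),
        total_dev (z (t - h)) =
          expR (- (rate F G (zone_before (z t)) * h)) * total_dev (z t),
        inzone (zone_after (z t)) (z (t + h)) /\
          flow F G (zone_after (z t)) (z t) h (z (t + h)) &
        inzone (zone_before (z t)) (z (t - h)) /\
          flow F G (zone_before (z t)) (z t) (- h) (z (t - h))].
Proof.
move=> sz; have [uz _ _ _] := sz t.
have [e1 e10 H1] := zsol_flow_after t sz.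
have [e2 e20 H2] := zsol_flow_before t sz.
have [_ bF _] := cF; have [_ bG _] := cG.
(* The last two bounds keep the rotation below half a turn, as polar coordinates require. *)
exists (Num.min (Num.min e1 e2) (Num.min (pi / fb F) (pi / fb G))).
  by rewrite !lt_min e10 e20 !divr_gt0 ?pi_gt0.
move=> h; rewrite !lt_min => /andP[h0 /andP[/andP[he1 he2] /andP[hF hG]]].
have [|k1 f1] := H1 h; first by rewrite h0.
have [|k2 f2] := H2 h; first by rewrite h0.
have hF' : `|fb F * h| < pi.
  by rewrite gtr0_norm ?mulr_gt0// mulrC -ltr_pdivlMr.
have hG' : `|fb G * h| < pi.
  by rewrite gtr0_norm ?mulr_gt0// mulrC -ltr_pdivlMr.
split => //.
  by rewrite /total_dev (inzone_after k1); apply: dev_flow => //; left.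
rewrite /total_dev (inzone_after k2) -mulrN.
rewrite -(dev_before_after (F := F) (G := G) (X := X) (Y := Y) (z := z t))//.
by apply: dev_flow => //; [right|rewrite mulrN normrN..].
Qed.

Lemma rate_le0 k : rate F G k <= 0.
Proof. by case: k cF cG => /= -[? _ _] [? _ _]; lra. Qed.

Lemma total_dev_nincr (z : R -> R[i]) s t : zsol F G z -> s <= t ->
  `|total_dev (z t)| <= `|total_dev (z s)|.
Proof.
move=> sz st.
apply: (@interval_additive_induction _
  (fun u v => `|total_dev (z v)| <= `|total_dev (z u)|) s t) => //.
  by move=> u v w _ _ _ _ uv vw; exact: le_trans uv.
move=> x _; have [e e0 He] := total_dev_local x sz.
have exp_le k h : 0 < h -> expR (rate F G k * h) <= 1.
  by move=> h0; rewrite -expR0 ler_expR mulr_le0_ge0 ?rate_le0// ltW.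
have Hr v : x <= v -> v < x + e -> `|total_dev (z v)| <= `|total_dev (z x)|.
  rewrite le_eqVlt => /predU1P[->//|xv] vxe.
  have [|+ _ _ _] := He (v - x); first by apply/andP; split; lra.
  rewrite addrC subrK => ->; rewrite normrM ger0_norm ?expR_ge0//.
  by rewrite ler_piMl// exp_le// subr_gt0.
have Hl u : u <= x -> x - e < u -> `|total_dev (z x)| <= `|total_dev (z u)|.
  rewrite le_eqVlt => /predU1P[->//|ux] uxe.
  have [|_ + _ _] := He (x - u); first by apply/andP; split; lra.
  rewrite opprB addrC subrK => ->; rewrite normrM ger0_norm ?expR_ge0//.
  by rewrite ler_peMl// expRN invf_ge1 ?expR_gt0// exp_le// subr_gt0.
exists e => // u v _ ux xv _ xu vx; apply: le_trans (Hr _ xv vx) (Hl _ ux _); lra.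
Qed.

Lemma periodic_total_dev0 (z : R -> R[i]) T : zsol F G z -> 0 < T ->
  (forall t, z (t + T) = z t) -> forall t, total_dev (z t) = 0.
Proof.
move=> sz T0 zT t0; apply/eqP/negPn/negP => d0.
have cst t : t0 <= t <= t0 + T -> `|total_dev (z t)| = `|total_dev (z t0)|.
  move=> /andP[t0t tT]; apply/eqP; rewrite eq_le total_dev_nincr//=.
  by rewrite -[z t0]zT total_dev_nincr.
pose D t := Re (z t) * Im (z t).
(* Both [fa F] and [fa G] are negative, so a zero rate leaves only the strip, where the imaginary
   part of z^2 gains 2h. *)
have flowD k h (u v : R[i]) : rate F G k = 0 -> flow F G k u h v ->
    Re v * Im v = Re u * Im u + h.
  have [aF _ _] := cF; have [aG _ _] := cG.
  have H : v ^+ 2 = u ^+ 2 + 0 +i* (2 * h) -> Re v * Im v = Re u * Im u + h.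
    move=> /(congr1 (@complex.Im R)); rewrite !expr2 !reimE /=; lra.
  by case: k => //= e; exfalso; lra.
have expR_eq1 k h (x y : R) : 0 < h -> x != 0 -> expR (rate F G k * h) * x = y ->
    `|x| = `|y| -> rate F G k = 0.
  move=> h0 x0 <-; rewrite normrM ger0_norm ?expR_ge0// => /esym.
  rewrite -{2}[`|x|]mul1r => /mulIf; rewrite normr_eq0 => /(_ x0).
  by rewrite -expR0 => /expR_inj /eqP; rewrite mulf_eq0 (gt_eqF h0) orbF => /eqP.
suff : D (t0 + T) - D t0 = t0 + T - t0.
  by rewrite /D zT subrr => /eqP; rewrite addrAC subrr add0r eq_sym (gt_eqF T0).
apply: (@interval_additive_induction _
  (fun u v => D v - D u = v - u) t0 (t0 + T)); first lra.
  by move=> u v w _ _ _ _ uv vw; lra.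
move=> x /andP[t0x xT]; have [e e0 He] := total_dev_local x sz.
have xd : total_dev (z x) != 0 by rewrite -normr_eq0 cst ?t0x// normr_eq0.
exists e => // u v t0u ux xv vT xu vx.
have -> : D v - D u = (D v - D x) + (D x - D u) by lra.
have -> : v - u = (v - x) + (x - u) by lra.
congr (_ + _).
  move: xv; rewrite le_eqVlt => /predU1P[->|xv]; first by rewrite !subrr.
  have vx0 : 0 < v - x < e by apply/andP; split; lra.
  have [d1 _ [_ f1] _] := He _ vx0.
  have vE : x + (v - x) = v by lra.
  rewrite vE in d1 f1; rewrite /D; have := flowD _ _ _ _ _ f1; move=> ->; first by ring.
  apply: (expR_eq1 _ (v - x) (total_dev (z x)) (total_dev (z v))) => //.
    by case/andP: vx0.
  rewrite !cst//; last by rewrite t0x.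
  by rewrite (le_trans t0x (ltW xv)).
move: ux; rewrite le_eqVlt => /predU1P[->|ux]; first by rewrite !subrr.
have ux0 : 0 < x - u < e by apply/andP; split; lra.
have [_ d1 _ [_ f1]] := He _ ux0.
have uE : x - (x - u) = u by lra.
rewrite uE in d1 f1; rewrite /D; have := flowD _ _ _ _ _ f1; move=> ->; first by ring.
apply: (expR_eq1 _ (x - u) (total_dev (z u)) (total_dev (z x))) => //.
- by case/andP: ux0.
- by rewrite d1 mulf_neq0// gt_eqF// expR_gt0.
- by rewrite d1 mulrA -expRD subrr expR0 mul1r.
- by rewrite !cst// ?t0x// t0u (le_trans (ltW ux) xT).
Qed.

End PeriodicSolution.

(** * Uniqueness of classical solutions in both directions of time *)

Section Uniqueness.
Variable R : realType.
Variables (F G : focus R).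

(** Agreement and disagreement are both locally constant in time. The first holds because a common
    point determines the zones on both sides and hence the flow, the second by continuity. Stating
    this as an equivalence treats past and future together. *)
Lemma zsol_uniq (z w : R -> R[i]) (t0 s0 : R) : zsol F G z -> zsol F G w ->
  z t0 = w s0 -> forall h, z (t0 + h) = w (s0 + h).
Proof.
move=> sz sw zw.
pose E h := z (t0 + h) = w (s0 + h).
have H p r : p <= r -> (E p <-> E r).
  move=> pr; apply: (@interval_additive_induction _ (fun u v => E u <-> E v)) => //.
    by move=> a b c _ _ _ _ [ab ba] [bc cb]; split; [move/ab|move/cb].
  move=> x _.
  have [Ex|nEx] := pselect (E x).
    have [e1 e10 H1] := zsol_flow_after (t0 + x) sz.
    have [e2 e20 H2] := zsol_flow_after (s0 + x) sw.
    have [e3 e30 H3] := zsol_flow_before (t0 + x) sz.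
    have [e4 e40 H4] := zsol_flow_before (s0 + x) sw.
    pose e := Num.min (Num.min e1 e2) (Num.min e3 e4).
    have e0 : 0 < e by rewrite !lt_min e10 e20 e30.
    have ER y : x <= y -> y < x + e -> E y.
      rewrite le_eqVlt => /predU1P[<-//|xy]; rewrite -ltrBlDl !lt_min.
      move=> /andP[/andP[y1 y2] _].
      have [|k1 f1] := H1 (y - x); first by rewrite subr_gt0 xy.
      have [|k2 f2] := H2 (y - x); first by rewrite subr_gt0 xy.
      rewrite -Ex in k2 f2.
      have := flow_uniq k1 k2 f1 f2.
      by rewrite -!addrA [x + _]addrC subrK.
    have EL y : y <= x -> x - e < y -> E y.
      rewrite le_eqVlt => /predU1P[->//|xy]; rewrite ltrBlDr -ltrBlDl !lt_min.
      move=> /andP[_ /andP[y1 y2]].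
      have [|k1 f1] := H3 (x - y); first by rewrite subr_gt0 xy.
      have [|k2 f2] := H4 (x - y); first by rewrite subr_gt0 xy.
      rewrite -Ex in k2 f2.
      have := flow_uniq k1 k2 f1 f2.
      by rewrite -!addrA opprB [x + _]addrC subrK.
    exists e => // a b _ ax xb _ xa bx; split=> _; [exact: ER|exact: EL].
  have [_ /ccontP cz _ _] := sz (t0 + x).
  have [_ /ccontP cw _ _] := sw (s0 + x).
  have [e e0 He] : exists2 e, 0 < e & forall y, x - e < y -> y < x + e -> ~ E y.
    pose u := z (t0 + x) - w (s0 + x).
    have u0 : 0 < `|Re u| + `|Im u|.
      rewrite lt_neqAle addr_ge0// andbT eq_sym paddr_eq0// !normr_eq0.
      apply/negP => /andP[/eqP r0 /eqP i0]; apply: nEx; rewrite /E.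
      by apply/eqP; rewrite -subr_eq0; apply/eqP/complexP.
    have u4 : 0 < (`|Re u| + `|Im u|) / 4 by rewrite divr_gt0.
    have [d1 d10 D1] := cz _ u4; have [d2 d20 D2] := cw _ u4.
    exists (Num.min d1 d2); first by rewrite lt_min d10.
    move=> y; rewrite ltrBlDr -ltrBlDl lt_min => /andP[a1 a2].
    rewrite -ltrBlDl lt_min => /andP[b1 b2] Ey.
    have n1 : `|(t0 + y) - (t0 + x)| < d1 by rewrite ltr_norml; apply/andP; split; lra.
    have n2 : `|(s0 + y) - (s0 + x)| < d2 by rewrite ltr_norml; apply/andP; split; lra.
    have [r1 i1] := D1 _ n1; have [r2 i2] := D2 _ n2.
    rewrite Ey in r1 i1.
    set q := (_ / 4) in r1 i1 r2 i2.
    have ru : `|Re u| < q + q.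
      move: r1 r2; rewrite /u reD reN !ltr_norml => /andP[? ?] /andP[? ?].
      by apply/andP; split; lra.
    have iu : `|Im u| < q + q.
      move: i1 i2; rewrite /u imD imN !ltr_norml => /andP[? ?] /andP[? ?].
      by apply/andP; split; lra.
    rewrite /q in ru iu; exfalso; clear -ru iu.
    by set a := `|_| in ru iu; set b := `|_| in ru iu; lra.
  exists e => // a b _ ax xb _ xa bx; split=> Ea; exfalso.
    by apply: (He a) => //; lra.
  by apply: (He b) => //; lra.
move=> h.
have [h0|h0] := leP 0 h; first by apply/(H 0 h h0); rewrite /E !addr0.
by apply/(H h 0 (ltW h0)); rewrite /E !addr0.
Qed.

End Uniqueness.

(** * The closed orbit *)

Section Hyperbola.
Variable R : realType.
Implicit Types (X s : R) (z : R[i]).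

(** The modulus of X^2 - 1 + 2is, that is, |z|^2 for the square root z of this number. [hypx] is the
    real part of that root, chosen positive. *)
Definition hypN X s : R := Num.sqrt ((X ^+ 2 - 1) ^+ 2 + 4 * s ^+ 2).
Definition hypx X s : R := Num.sqrt ((X ^+ 2 - 1 + hypN X s) / 2).
(* The solution of z' = i/z with Re z Im z = s at time s and passing through
   X + i at time X. *)
Definition hyp X s : R[i] := hypx X s +i* (s / hypx X s).

Lemma hypN_sqr X s : hypN X s ^+ 2 = (X ^+ 2 - 1) ^+ 2 + 4 * s ^+ 2.
Proof. by rewrite sqr_sqrtr// addr_ge0 ?sqr_ge0// mulr_ge0 ?sqr_ge0. Qed.

Lemma hypN_gt0 X s : 1 < X -> 0 < hypN X s.
Proof.
move=> X1; rewrite sqrtr_gt0; apply: ltr_pwDl; last by rewrite mulr_ge0 ?sqr_ge0.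
by rewrite exprn_gt0//; nra.
Qed.

Lemma hypx_gt0 X s : 1 < X -> 0 < hypx X s.
Proof. by move=> X1; rewrite sqrtr_gt0; have := hypN_gt0 s X1; nra. Qed.

Lemma hypx_sqr X s : 1 < X -> hypx X s ^+ 2 = (X ^+ 2 - 1 + hypN X s) / 2.
Proof. by move=> X1; rewrite sqr_sqrtr//; have := hypN_gt0 s X1; nra. Qed.

Lemma hyp_sqr X s : 1 < X -> Re (hyp X s) ^+ 2 - Im (hyp X s) ^+ 2 = X ^+ 2 - 1.
Proof.
move=> X1; rewrite /= exprMn exprVn hypx_sqr//.
have N0 := hypN_gt0 s X1; have NE := hypN_sqr X s; have X2 : 1 < X ^+ 2 by nra.
move: NE; set M := X ^+ 2 - 1; set N := hypN X s => NE.
have h0 : 0 < M + N by rewrite /M /N; lra.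
have -> : s ^+ 2 = (M + N) * (N - M) / 4.
  by rewrite (_ : (M + N) * (N - M) = N ^+ 2 - M ^+ 2); [rewrite NE -/M; field|ring].
by field; rewrite lt0r_neq0.
Qed.

Lemma hyp_mul X s : 1 < X -> Re (hyp X s) * Im (hyp X s) = s.
Proof. by move=> X1 /=; rewrite mulrC divfK// lt0r_neq0// hypx_gt0. Qed.

Lemma hypP X z : 1 < X -> 0 < Re z -> Re z ^+ 2 - Im z ^+ 2 = X ^+ 2 - 1 ->
  hyp X (Re z * Im z) = z.
Proof.
move=> X1 r0 e.
have NE : hypN X (Re z * Im z) = Re z ^+ 2 + Im z ^+ 2.
  rewrite /hypN -e (_ : _ + _ = (Re z ^+ 2 + Im z ^+ 2) ^+ 2); last by ring.
  by rewrite sqrtr_sqr ger0_norm// addr_ge0 ?sqr_ge0.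
have xE : hypx X (Re z * Im z) = Re z.
  rewrite /hypx NE -e (_ : _ / 2 = Re z ^+ 2); last by field.
  by rewrite sqrtr_sqr gtr0_norm.
by apply: complexP; rewrite /= xE// mulrAC divff ?lt0r_neq0// mul1r.
Qed.

(** With x + iy on the hyperbola, |y| >= 1 would give x^2 >= X^2 and then s^2 = x^2 y^2 >= X^2. *)
Lemma hyp_Im_lt1 X s : 1 < X -> - X < s < X -> -1 < Im (hyp X s) < 1.
Proof.
move=> X1 /andP[s1 s2]; have sq := hyp_sqr s X1; have sE := hyp_mul s X1.
have : 0 < Re (hyp X s) by exact: hypx_gt0.
move: sq sE; set x := Re _; set y := Im _ => sq sE x0.
rewrite -ltr_norml ltNge; apply/negP => y1.
have y2 : 1 <= y ^+ 2 by rewrite -real_normK ?num_real// exprn_ege1.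
have x2 : X ^+ 2 <= x ^+ 2 by nra.
have : s ^+ 2 < X ^+ 2 by nra.
have : X ^+ 2 <= s ^+ 2 by rewrite -sE exprMn; nra.
lra.
Qed.

Lemma hyp_end X : 1 < X -> hyp X X = X +i* 1.
Proof.
by move=> X1; rewrite -[X in hyp _ X]mulr1; apply: (@hypP X (X +i* 1)) => //=; lra.
Qed.

Lemma hyp_start X : 1 < X -> hyp X (- X) = X +i* -1.
Proof.
move=> X1; rewrite -[X in - X]mulr1 -mulrN; apply: (@hypP X (X +i* -1)) => //=.
  lra.
ring.
Qed.

(** For z = x + iy the field is i/z = (y + ix) / |z|^2, and |z|^2 is [hypN X s] on this curve. *)
Lemma cderiv_hyp X s : 1 < X -> cderiv (hyp X) s ('i%C / hyp X s).
Proof.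
move=> X1.
have N0 := hypN_gt0 s X1; have x0 := hypx_gt0 s X1.
pose n (u : R) := (X ^+ 2 - 1) ^+ 2 + 4 * (u * u).
have n0 : 0 < n s by rewrite /n -expr2 -sqrtr_gt0.
have dn : is_derive s (1 : R) n (8 * s).
  have := is_derive1D (is_derive1_cst ((X ^+ 2 - 1) ^+ 2) s)
    (is_derive1M (is_derive1_cst 4 s) (is_derive1M (is_derive1_id s) (is_derive1_id s))).
  by congr is_derive; ring.
have dN : is_derive s (1 : R) (hypN X) (4 * s / hypN X s).
  have := @is_derive1_comp _ Num.sqrt n _ _ _ (is_derive1_sqrt n0) dn.
  have -> : Num.sqrt \o n = hypN X.
    by apply/funext => u; rewrite /hypN expr2.
  by congr is_derive; rewrite (_ : Num.sqrt (n s) = hypN X s) /hypN ?expr2//; field; rewrite -expr2 lt0r_neq0.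
have xs0 : 0 < (X ^+ 2 - 1 + hypN X s) / 2 by nra.
have dx : is_derive s (1 : R) (hypx X) (s / hypN X s / hypx X s).
  have := @is_derive1_comp _ Num.sqrt (fun u => (X ^+ 2 - 1 + hypN X u) / 2) _ _ _
    (is_derive1_sqrt xs0)
    (is_derive1M (is_derive1D (is_derive1_cst (X ^+ 2 - 1) s) dN) (is_derive1_cst 2^-1 s)).
  by congr is_derive; rewrite -/(hypx X s); field; rewrite !lt0r_neq0.
have dy := is_derive1M (is_derive1_id s) (is_derive1V (lt0r_neq0 x0) dx).
have ne : hypx X s ^+ 2 + (s / hypx X s) ^+ 2 = hypN X s.
  by have := hyp_sqr s X1; rewrite /= => ?; have := hypx_sqr s X1; lra.
split.
  move: dx; congr is_derive; rewrite !reimE /= ne.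
  by field; rewrite !lt0r_neq0.
move: dy; congr is_derive; rewrite !reimE /= ne.
have sE : s ^+ 2 = hypx X s ^+ 2 * (hypN X s - hypx X s ^+ 2).
  by rewrite -{1}ne; field; rewrite lt0r_neq0.
have -> : 1 / hypx X s + s * (- (s / hypN X s / hypx X s) / hypx X s ^+ 2) =
   (hypx X s ^+ 2 * hypN X s - s ^+ 2) / (hypN X s * hypx X s ^+ 3).
  by field; rewrite !lt0r_neq0.
by rewrite sE; field; rewrite !lt0r_neq0.
Qed.

End Hyperbola.

(** * Explicit arcs of the closed orbit *)

Section Pieces.
Variable R : realType.
Implicit Types (F G : focus R) (k : zone) (p z : R -> R[i]) (s t : R).

(** The equation is imposed on the closed interval, while the zone is imposed only inside: each arc
    comes from a curve that solves the equation of its own zone also at the ends, on the boundary of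
    that zone. *)
Definition piece F G k p (u v : R) : Prop :=
  [/\ forall s, u <= s <= v -> unblocked F G (p s) /\ cderiv p s (zfield F G k (p s)),
      forall s, u < s < v -> inzone k (p s),
      zone_after (p u) = k & zone_before (p v) = k].

Lemma cderiv_opp p s v : cderiv p s v -> cderiv (fun u => - p u) s (- v).
Proof.
move=> dp; have := cderivM (cderiv_cst (- 1) s) dp.
rewrite mul0r add0r mulN1r; congr cderiv.
by apply/funext => u; rewrite mulN1r.
Qed.

Lemma cderiv_shift p s (c : R) v : cderiv p (s - c) v -> cderiv (fun u => p (u - c)) s v.
Proof.
have ds : is_derive s (1 : R) (fun u : R => u - c) (1 : R).
  by have := is_derive1B (is_derive1_id s) (is_derive1_cst c s); rewrite subr0.
move=> [d1 d2]; split.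
  have := @is_derive1_comp _ (fun u => Re (p u)) (fun u : R => u - c) _ _ _ d1 ds.
  by rewrite mulr1.
have := @is_derive1_comp _ (fun u => Im (p u)) (fun u : R => u - c) _ _ _ d2 ds.
by rewrite mulr1.
Qed.

(** By this symmetry only the upper and the left arc have to be constructed; the lower and the right
    one are their images. *)
Lemma piece_opp F G k p u v : u <= v -> piece F G k p u v ->
  piece G F (opp_zone k) (fun s => - p s) u v.
Proof.
move=> uv [up ip ap bp].
have [uu _] := up u ltac:(by rewrite lexx uv).
have [uv' _] := up v ltac:(by rewrite lexx uv).
split.
- move=> s /up[us ds]; split; first exact/unblocked_opp.
  by rewrite zfield_opp; exact: cderiv_opp.
- by move=> s /ip ?; apply/inzone_opp.
- by rewrite (zone_after_opp uu) ap.
- by rewrite (zone_before_opp uv') bp.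
Qed.

Lemma piece_shift F G k p u v c : piece F G k p u v ->
  piece F G k (fun s => p (s - c)) (u + c) (v + c).
Proof.
move=> [up ip ap bp]; split; rewrite ?addrK//.
- move=> s /andP[us sv]; have [|us' ds] := up (s - c).
    by rewrite lerBrDr us lerBlDr.
  by split => //; exact: cderiv_shift.
- by move=> s /andP[us sv]; apply: ip; rewrite ltrBrDr us ltrBlDr.
Qed.

Lemma near_cderiv p z s v : (\forall u \near s, p u = z u) ->
  cderiv p s v -> cderiv z s v.
Proof.
by move=> pz [d1 d2]; split; [apply: near_eq_is_derive d1|apply: near_eq_is_derive d2];
  apply: filterS pz => u ->.
Qed.

(** One-sided data: where two arcs meet, the later one supplies this germ and the earlier one
    [germ_before], and neither needs to know the other. *)
Definition germ_after F G z t : Prop :=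
  unblocked F G (z t) /\ exists2 p, ccont p t & exists2 e : R, 0 < e &
    z t = p t /\ forall s, t < s < t + e -> z s = p s /\
      inzone (zone_after (z t)) (p s) /\
      cderiv p s (zfield F G (zone_after (z t)) (p s)).

Definition germ_before F G z t : Prop :=
  exists2 p, ccont p t & exists2 e : R, 0 < e &
    z t = p t /\ forall s, t - e < s < t -> z s = p s /\
      inzone (zone_before (z t)) (p s) /\
      cderiv p s (zfield F G (zone_before (z t)) (p s)).

Lemma zsol_germs F G z :
  (forall t, germ_after F G z t) -> (forall t, germ_before F G z t) -> zsol F G z.
Proof.
move=> za zb t; have [ut [p cp [e e0 [ze He]]]] := za t.
have [q cq [f f0 [zf Hf]]] := zb t.
split => //.
- apply/ccontP => r r0.
  move/ccontP : cp => /(_ _ r0)[dp dp0 Dp]; move/ccontP : cq => /(_ _ r0)[dq dq0 Dq].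
  exists (Num.min (Num.min dp dq) (Num.min e f)); first by rewrite !lt_min dp0 dq0 e0.
  move=> s; rewrite !lt_min => /andP[/andP[sp sq]].
  rewrite 2![`|s - t| < _]ltr_norml => /andP[/andP[s1 s2] /andP[s3 s4]].
  have [st|ts|->] := ltgtP s t; last by rewrite !subrr normr0.
    by have [|-> _] := Hf s; [apply/andP; split; lra|rewrite zf; exact: Dq].
  by have [|-> _] := He s; [apply/andP; split; lra|rewrite ze; exact: Dp].
- exists e => // s se; have [zs [ks ds]] := He _ se; rewrite zs; split => //.
  apply: near_cderiv ds; have /andP[s1 s2] := se.
  near=> u; have [|//] := He u; apply/andP; split; near: u.
    exact: lt_nbhsr.
  exact: lt_nbhsl.
- exists f => // s sf; have [zs [ks ds]] := Hf _ sf; rewrite zs; split => //.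
  apply: near_cderiv ds; have /andP[s1 s2] := sf.
  near=> u; have [|//] := Hf u; apply/andP; split; near: u.
    exact: lt_nbhsr.
  exact: lt_nbhsl.
Unshelve. all: by end_near.
Qed.

Lemma piece_germs F G k p u v z : piece F G k p u v ->
  (forall s, u <= s <= v -> z s = p s) ->
  (forall t, u <= t < v -> germ_after F G z t) /\
  (forall t, u < t <= v -> germ_before F G z t).
Proof.
move=> [up ip ap bp] zp; split => t /andP[ut tv].
  have tI : u <= t <= v by rewrite ut ltW.
  have [uz dt] := up _ tI.
  have zk : zone_after (z t) = k.
    rewrite zp//; move: ut; rewrite le_eqVlt => /predU1P[<-//|ut].
    by apply: inzone_after; apply: ip; rewrite ut.
  split; first by rewrite zp.
  exists p; first exact: cderiv_cont dt.
  exists (v - t); first by rewrite subr_gt0.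
  split; first exact: zp.
  move=> s /andP[ts sv]; rewrite zk.
  have [_ ds] := up s ltac:(by apply/andP; split; lra).
  split; first by apply: zp; apply/andP; split; lra.
  by split => //; apply: ip; apply/andP; split; lra.
have tI : u <= t <= v by rewrite tv ltW.
have [uz dt] := up _ tI.
have zk : zone_before (z t) = k.
  rewrite zp//; move: tv; rewrite le_eqVlt => /predU1P[->//|tv].
  by apply: inzone_before; apply: ip; rewrite ut.
exists p; first exact: cderiv_cont dt.
exists (t - u); first by rewrite subr_gt0.
split; first exact: zp.
move=> s /andP[ts sv]; rewrite zk.
have [_ ds] := up s ltac:(by apply/andP; split; lra).
split; first by apply: zp; apply/andP; split; lra.
by split => //; apply: ip; apply/andP; split; lra.
Qed.

Definition spiral_arc F (X : R) s : R[i] :=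
  focus_pt F + (X + fx F)%:C * spiral (fa F) (fb F) s.

(** The sign selects the left branch, and the shift makes the arc start from -Y + i at time pi / b,
    when the spiral ends. *)
Definition hyp_arc F (Y : R) s : R[i] := - hyp Y (s - pi / fb F - Y).

Definition half_loop F (X Y : R) s : R[i] :=
  if s <= pi / fb F then spiral_arc F X s else hyp_arc F Y s.

(** Half a turn at angular speed b, then a passage through the strip during which Re z Im z runs
    from -Y to Y at unit speed. *)
Definition half_time F (Y : R) : R := pi / fb F + Y * 2.

Lemma Im_spiral_arc F (X : R) s :
  Im (spiral_arc F X s) = 1 + (X + fx F) * expR (fa F * s) * sin (fb F * s).
Proof. by rewrite /spiral_arc !reimE /=; ring. Qed.

Lemma Re_spiral_arc F (X : R) s :
  Re (spiral_arc F X s) = - fx F + (X + fx F) * expR (fa F * s) * cos (fb F * s).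
Proof. by rewrite /spiral_arc !reimE /=; ring. Qed.

Lemma spiral_arc0 F (X : R) : spiral_arc F X 0 = X +i* 1.
Proof.
by rewrite /spiral_arc spiral0 mulr1; apply: complexP; rewrite !reimE /=; ring.
Qed.

Lemma spiral_arc_end F (X Y : R) : contracting F -> half_return F X Y ->
  spiral_arc F X (pi / fb F) = (- Y) +i* 1.
Proof.
move=> [a0 b0 x1] HY; apply: complexP; rewrite ?Re_spiral_arc ?Im_spiral_arc /=.
  rewrite (_ : fb F * _ = pi); last by field; rewrite lt0r_neq0.
  by rewrite cospi HY (_ : fa F * _ = fa F / fb F * pi); ring.
rewrite (_ : fb F * _ = pi); last by field; rewrite lt0r_neq0.
by rewrite sinpi; ring.
Qed.

Lemma hyp_arc_start F (Y : R) : 1 < Y -> hyp_arc F Y (pi / fb F) = (- Y) +i* 1.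
Proof.
move=> Y1; rewrite /hyp_arc subrr sub0r hyp_start//.
by apply: complexP; rewrite !reimE /= ?opprK.
Qed.

Lemma hyp_arc_end F (Y : R) : 1 < Y -> hyp_arc F Y (half_time F Y) = - (Y +i* 1).
Proof.
move=> Y1; rewrite /hyp_arc /half_time (_ : _ - Y = Y) ?hyp_end//; ring.
Qed.

Lemma top_piece F G (X Y : R) : contracting F -> half_return F X Y ->
  fx F < Y -> fx G < X -> 1 < fx G -> piece F G Up (spiral_arc F X) 0 (pi / fb F).
Proof.
move=> cF HY YF XG G1; have [a0 b0 x1] := cF.
have Xx : 0 < X + fx F by lra.
have ip s : 0 < s < pi / fb F -> inzone Up (spiral_arc F X s).
  move=> /andP[s0 s1]; rewrite /inzone Im_spiral_arc ltrDl !mulr_gt0 ?expR_gt0//.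
  by apply: sin_gt0_pi; rewrite mulr_gt0//= mulrC -ltr_pdivlMr.
split => //.
- move=> s /andP[s0 s1]; split.
    move: s0 s1; rewrite le_eqVlt => /predU1P[<- _|s0].
      rewrite spiral_arc0; apply: Or32 => /=; split; first lra.
      by rewrite expr1n subrK; nra.
    rewrite le_eqVlt => /predU1P[->|s1].
      rewrite (spiral_arc_end cF HY); apply: Or33 => /=; split; first lra.
      by rewrite expr1n subrK; nra.
    apply: Or31; apply: lt_le_trans (ler_norm _).
    by apply: (ip s); rewrite s0.
  have := cderivD (cderiv_cst (focus_pt F) s)
    (cderivM (cderiv_cst (X + fx F)%:C s) (cderiv_spiral (fa F) (fb F) s)).
  congr cderiv; rewrite /= /focus_field /spiral_arc; ring.
- by rewrite spiral_arc0 /zone_after /= lexx ifT//; lra.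
- by rewrite (spiral_arc_end cF HY) /zone_before /= lexx ifF//; apply/negbTE; rewrite -leNgt; lra.
Qed.

Lemma left_piece F G (Y : R) : contracting F -> fx F < Y ->
  piece F G Lf (hyp_arc F Y) (pi / fb F) (half_time F Y).
Proof.
move=> [a0 b0 x1] YF; have Y1 : 1 < Y by lra.
have r0 s : Re (hyp_arc F Y s) < 0.
  by rewrite /hyp_arc reN oppr_lt0 hypx_gt0.
split.
- move=> s _; split.
    by apply: Or33; split; rewrite // /hyp_arc !reimE !sqrrN hyp_sqr// subrK; nra.
  have /cderiv_opp := cderiv_shift (cderiv_shift (cderiv_hyp (s - pi / fb F - Y) Y1)).
  by congr cderiv; rewrite /= /hyp_arc invrN mulrN.
- rewrite /half_time => s /andP[s0 s1]; split=> //; rewrite /hyp_arc reimE;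
  by have /andP[? ?] := @hyp_Im_lt1 _ Y (s - pi / fb F - Y) Y1 ltac:(by apply/andP; split; lra); lra.
- rewrite hyp_arc_start// /zone_after /= ifF; last by apply/negbTE; rewrite -leNgt; lra.
  by rewrite ltxx ifT//; lra.
- rewrite hyp_arc_end// /zone_before /= ifF; last by apply/negbTE; rewrite -leNgt; lra.
  by rewrite lexx ifF//; apply/negbTE; rewrite -ltNge; lra.
Qed.

Lemma half_loop_left F (X Y : R) s : contracting F -> half_return F X Y ->
  fx F < Y -> pi / fb F <= s -> half_loop F X Y s = hyp_arc F Y s.
Proof.
move=> cF HY YF; rewrite le_eqVlt /half_loop => /predU1P[<-|s1].
  rewrite lexx (spiral_arc_end cF HY) hyp_arc_start//; case: cF => _ _; lra.
by rewrite leNgt s1.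
Qed.

(** The time is read off the point: the angle at the focus divided by b in the half plane, Re z Im z
    in the strip. Zero deviation then fixes the radius or the hyperbola. *)
Lemma half_loop_onto F G (X Y : R) (z : R[i]) : contracting F -> 0 < X -> 0 < Y ->
  half_return F X Y -> unblocked F G z ->
  zone_after z = Up \/ zone_after z = Lf -> dev F G X Y (zone_after z) z = 0 ->
  exists2 s, 0 <= s <= half_time F Y & half_loop F X Y s = z.
Proof.
move=> cF X0 Y0 HY uz kz dz; have [a0 b0 x1] := cF.
have YF := half_return_gt cF X0 HY.
case: kz => kz; rewrite kz /= in dz.
  have iz : 1 <= Im z by have := @zone_closure _ Up z (or_introl kz).
  have zc : z - focus_pt F != 0.
    rewrite subr_eq0; apply/eqP => zE; apply: (@unblocked_focus_pt _ F G); first lra.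
    by rewrite -zE.
  have [|/andP[t0 tpi] rz imz] := @cargP _ (z - focus_pt F) zc.
    by rewrite !reimE /= subr_ge0.
  set th := carg _ in t0 tpi rz imz dz.
  move/eqP : dz; rewrite subr_eq0 => /eqP dz; rewrite dz in rz imz.
  exists (th / fb F).
    rewrite divr_ge0 ?(ltW b0)//= /half_time; apply: ler_wpDr; first lra.
    by rewrite ler_pM2r ?invr_gt0.
  rewrite /half_loop ler_pM2r ?invr_gt0// tpi.
  rewrite -[RHS](subrK (focus_pt F)) addrC; congr (_ + _); apply: complexP.
    rewrite rz !reimE /= (_ : fb F * _ = th); last by field; rewrite lt0r_neq0.
    by rewrite (_ : fa F * _ = fa F / fb F * th); ring.
  rewrite imz !reimE /= (_ : fb F * _ = th); last by field; rewrite lt0r_neq0.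
  by rewrite (_ : fa F * _ = fa F / fb F * th); ring.
have [r0 i1] : Re z < 0 /\ -1 <= Im z <= 1.
  move: uz kz; rewrite /unblocked /zone_after => uz.
  have [r0|r0] := ltP 0 (Re z); first by case: ifPn => // _; case: ifP.
  case: ltP => // i1; case: ltP => // i2 _.
  case: uz => [|[? _]|[? _]]; [|lra|split=> //; apply/andP; split=> //; exact: ltW].
  by rewrite lter_normr => /orP[]; lra.
have sq : Re z ^+ 2 - Im z ^+ 2 = Y ^+ 2 - 1.
  have h0 : 0 <= Re z ^+ 2 - Im z ^+ 2 + 1 by case/andP: i1 => ? ?; nra.
  have <- : Num.sqrt (Re z ^+ 2 - Im z ^+ 2 + 1) = Y by lra.
  by rewrite sqr_sqrtr//; ring.
have Y1 : 1 < Y by lra.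
have hz := @hypP _ Y (- z) Y1.
rewrite !reimE !sqrrN mulrNN oppr_gt0 in hz.
have {}hz := hz r0 sq.
have sY : - Y <= Re z * Im z <= Y.
  rewrite -ler_norml -(@ler_pXn2r _ 2) ?nnegrE ?(ltW Y0)//.
  rewrite real_normK ?num_real// exprMn.
  case/andP: i1 => ? ?; have : Im z ^+ 2 <= 1 by nra.
  have : Re z ^+ 2 <= Y ^+ 2 by nra.
  have := sqr_ge0 (Re z); have := sqr_ge0 (Im z); nra.
(* Re z Im z is the time elapsed since the middle of the strip passage. *)
exists (pi / fb F + Y + Re z * Im z).
  have : 0 < pi / fb F by rewrite divr_gt0 ?pi_gt0.
  by case/andP: sY => ? ? ?; rewrite /half_time; apply/andP; split; lra.
rewrite half_loop_left//; last by case/andP: sY => ? ?; lra.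
rewrite /hyp_arc (_ : _ - Y = Re z * Im z); last by ring.
by rewrite hz opprK.
Qed.

End Pieces.

(** The composite of the two half returns is affine in X with slope [be * al] < 1; the witness is
    its fixed point. *)
Lemma half_returns_exist (R : realType) (F G : focus R) :
  contracting F -> contracting G -> exists X Y : R,
  [/\ 0 < X, 0 < Y, half_return F X Y & half_return G Y X].
Proof.
move=> [aF bF xF] [aG bG xG].
have lt1 (a b : R) : a < 0 -> 0 < b -> 0 < expR (a / b * pi) < 1.
  move=> a0 b0; rewrite expR_gt0 -expR0 ltr_expR.
  by rewrite nmulr_rlt0 ?pi_gt0// pmulr_llt0 ?invr_gt0.
rewrite /half_return.
have := lt1 _ _ aF bF; have := lt1 _ _ aG bG.
set al := expR _; set be := expR _ => /andP[al0 al1] /andP[be0 be1].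
have k0 : 0 < 1 - be * al by nra.
pose X := (fx G + al * (fx F + be * fx F + fx G)) / (1 - be * al).
have X0 : 0 < X.
  apply: divr_gt0 => //.
  have : 0 < al * (fx F + be * fx F + fx G).
    have bF0 : 0 < be * fx F by apply: mulr_gt0; lra.
    by apply: mulr_gt0 => //; lra.
  lra.
exists X, (fx F + be * (X + fx F)); split => //.
  have : 0 < be * (X + fx F) by apply: mulr_gt0; lra.
  lra.
by rewrite /X; field; rewrite lt0r_neq0.
Qed.

(** * Gluing the arcs into a periodic solution *)

Section Orbit.
Variable R : realType.
Variables (F G : focus R) (X Y : R).
Hypotheses (cF : contracting F) (cG : contracting G).
Hypotheses (X0 : 0 < X) (Y0 : 0 < Y).
Hypotheses (HY : half_return F X Y) (HX : half_return G Y X).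

Let YF : fx F < Y := half_return_gt cF X0 HY.
Let XG : fx G < X := half_return_gt cG Y0 HX.

Definition loop (s : R) : R[i] :=
  if s <= half_time F Y then half_loop F X Y s
  else - half_loop G Y X (s - half_time F Y).

Definition loop_time : R := half_time F Y + half_time G X.

Definition closed_orbit (t : R) : R[i] := loop (t - loop_time * (Num.floor (t / loop_time))%:~R).

Lemma half_time_gt0 H (Z : R) : contracting H -> 0 < Z -> 0 < half_time H Z.
Proof.
by move=> [_ b0 _] Z0; rewrite /half_time addr_gt0 ?mulr_gt0 ?invr_gt0 ?pi_gt0.
Qed.

Lemma half_time_ge H (Z : R) : 0 < Z -> pi / fb H <= half_time H Z.
Proof. by move=> Z0; rewrite /half_time lerDl mulr_ge0 ?ltW. Qed.

Lemma loop_time_gt0 : 0 < loop_time.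
Proof. by rewrite addr_gt0 ?half_time_gt0. Qed.

Let pF : 0 < pi / fb F. Proof. by case: cF => _ b0 _; rewrite divr_gt0 ?pi_gt0. Qed.
Let pG : 0 < pi / fb G. Proof. by case: cG => _ b0 _; rewrite divr_gt0 ?pi_gt0. Qed.
Let X1 : 1 < X. Proof. by case: cG => _ _ ?; apply: lt_trans XG. Qed.
Let Y1 : 1 < Y. Proof. by case: cF => _ _ ?; apply: lt_trans YF. Qed.

Lemma loop_second s : half_time F Y <= s ->
  loop s = - half_loop G Y X (s - half_time F Y).
Proof.
rewrite le_eqVlt /loop => /predU1P[<-|s1]; last by rewrite leNgt s1.
rewrite lexx subrr (half_loop_left cF HY)//; last exact: half_time_ge.
by rewrite hyp_arc_end// /half_loop (ltW pG) spiral_arc0.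
Qed.

Lemma loop0 : loop 0 = X +i* 1.
Proof.
by rewrite /loop (ltW (half_time_gt0 cF Y0)) /half_loop (ltW pF) spiral_arc0.
Qed.

Lemma loop_end : loop loop_time = loop 0.
Proof.
rewrite loop0 loop_second; last by rewrite /loop_time lerDl ltW// half_time_gt0.
rewrite /loop_time addrC addKr (half_loop_left cG HX)//; last exact: half_time_ge.
by rewrite hyp_arc_end// opprK.
Qed.

Lemma closed_orbitE (n : int) s : 0 <= s <= loop_time ->
  closed_orbit (s + loop_time * n%:~R) = loop s.
Proof.
move=> /andP[s0]; have T0 := loop_time_gt0.
rewrite /closed_orbit (_ : (s + _) / loop_time = s / loop_time + n%:~R); last first.
  by field; rewrite lt0r_neq0.
rewrite le_eqVlt => /predU1P[->|sT].
  rewrite divff ?lt0r_neq0// -[1]/(1%:~R) -intrD intrKfloor intrD mulrDr mulr1.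
  by rewrite subrr loop_end.
rewrite (_ : Num.floor _ = n) ?addrK//; apply: floor_def.
by rewrite lerDr divr_ge0 ?(ltW T0)//= intrD addrC ltrD2l ltr_pdivrMr// mul1r.
Qed.

Lemma closed_orbit_periodic t : closed_orbit (t + loop_time) = closed_orbit t.
Proof.
have T0 := loop_time_gt0.
rewrite /closed_orbit (_ : (t + _) / loop_time = t / loop_time + 1%:~R); last first.
  by field; rewrite lt0r_neq0.
rewrite floorDrz ?intr_int// intrKfloor intrD; congr loop; ring.
Qed.

(** The intervals are half open on opposite sides for the two germs, so that the four arcs tile each
    period in both cases. *)
Lemma loop_piece k p u v (n : int) : piece F G k p u v -> 0 <= u -> v <= loop_time ->
  (forall s, u <= s <= v -> loop s = p s) ->
  (forall t, u <= t - loop_time * n%:~R < v -> germ_after F G closed_orbit t) /\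
  (forall t, u < t - loop_time * n%:~R <= v -> germ_before F G closed_orbit t).
Proof.
move=> pp u0 vT lp.
have [|ga gb] := piece_germs (z := closed_orbit) (piece_shift (loop_time * n%:~R) pp).
  move=> s /andP[us sv]; rewrite -lp; last by rewrite lerBrDr us lerBlDr.
  by rewrite -{1}(subrK (loop_time * n%:~R) s) closed_orbitE// lerBrDr lerBlDr; apply/andP; split; lra.
split=> t; first by rewrite lerBrDr ltrBlDr; exact: ga.
by rewrite ltrBrDr lerBlDr; exact: gb.
Qed.

Lemma closed_orbit_zsol : zsol F G closed_orbit.
Proof.
have hF := half_time_gt0 cF Y0; have hG := half_time_gt0 cG X0.
have [_ _ xF1] := cF; have [_ _ xG1] := cG.
have P1 := top_piece cF HY YF XG xG1.
have P2 := @left_piece _ F G Y cF YF.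
have P3 := piece_shift (half_time F Y) (piece_opp (ltW pG) (top_piece cG HX XG YF xF1)).
have h2 : pi / fb G <= half_time G X by apply: half_time_ge.
have P4 := piece_shift (half_time F Y) (piece_opp h2 (@left_piece _ G F X cG XG)).
rewrite add0r in P3; rewrite [half_time G X + _]addrC -/loop_time in P4.
have h1 : pi / fb F <= half_time F Y by apply: half_time_ge.
have Q1 n := loop_piece n P1 (lexx 0).
have Q2 n := loop_piece n P2 (ltW pF).
have Q3 n := loop_piece n P3 (ltW hF).
have Q4 n := loop_piece n P4.
have per : loop_time = half_time F Y + half_time G X by [].
have {}Q1 n : _ := Q1 n ltac:(lra) ltac:(
  by move=> s /andP[s0 s1]; rewrite /loop (le_trans s1 h1) /half_loop s1).
have {}Q2 n : _ := Q2 n ltac:(lra) ltac:(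
  by move=> s /andP[s0 s1]; rewrite /loop s1 (half_loop_left cF HY)).
have {}Q3 n : _ := Q3 n ltac:(lra) ltac:(
  by move=> s /andP[s0 s1]; rewrite loop_second// /half_loop lerBlDr s1).
have u4 : 0 <= pi / fb G + half_time F Y by rewrite addr_ge0 ?ltW.
have l4 s : pi / fb G + half_time F Y <= s <= loop_time ->
    loop s = - hyp_arc G X (s - half_time F Y).
  move=> /andP[s0 s1]; rewrite loop_second; last by apply: le_trans s0; rewrite lerDr ltW.
  by rewrite (half_loop_left cG HX)// lerBrDr.
have {}Q4 n := Q4 n u4 (lexx _) l4.
have T0 := loop_time_gt0.
apply: zsol_germs => t.
  pose n := Num.floor (t / loop_time).
  have : 0 <= t - loop_time * n%:~R < loop_time.
    have /andP[n1 n2] := floor_itv (t / loop_time).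
    rewrite subr_ge0 ltrBlDl mulrC -ler_pdivlMr// n1/=.
    by rewrite -[X in _ + X]mul1r -mulrDl -ltr_pdivrMr// -[1]/(1%:~R) -intrD.
  move=> /andP[t0 tT].
  have [c1|c1] := ltP (t - loop_time * n%:~R) (pi / fb F).
    by apply: (Q1 n).1; rewrite t0.
  have [c2|c2] := ltP (t - loop_time * n%:~R) (half_time F Y).
    by apply: (Q2 n).1; rewrite c1.
  have [c3|c3] := ltP (t - loop_time * n%:~R) (pi / fb G + half_time F Y).
    by apply: (Q3 n).1; rewrite c2.
  by apply: (Q4 n).1; rewrite c3.
(* For germs before t the period must be the interval open at 0 and closed at [loop_time], so n is
   the ceiling of t / [loop_time] minus one. *)
pose n := - Num.floor (- t / loop_time) - 1.
have : 0 < t - loop_time * n%:~R <= loop_time.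
  have := floor_itv (- t / loop_time).
  rewrite intrD ler_pdivlMr// ltr_pdivrMr// => /andP[n1 n2].
  rewrite /n intrB intrN; apply/andP; split; nra.
move=> /andP[t0 tT].
have [c1|c1] := leP (t - loop_time * n%:~R) (pi / fb F).
  by apply: (Q1 n).2; rewrite t0.
have [c2|c2] := leP (t - loop_time * n%:~R) (half_time F Y).
  by apply: (Q2 n).2; rewrite c1.
have [c3|c3] := leP (t - loop_time * n%:~R) (pi / fb G + half_time F Y).
  by apply: (Q3 n).2; rewrite c2.
by apply: (Q4 n).2; rewrite c3.
Qed.

Lemma loop_onto (z : R[i]) : unblocked F G z -> total_dev F G X Y z = 0 ->
  exists t, closed_orbit t = z.
Proof.
move=> uz dz.
have H0 := half_time_gt0 cF Y0; have H1 := half_time_gt0 cG X0.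
suff [s s0 sz] : exists2 s, 0 <= s <= loop_time & loop s = z.
  by exists (s + loop_time * 0%:~R); rewrite closed_orbitE.
have [kz|kz] : (zone_after z = Up \/ zone_after z = Lf) \/
    (zone_after (- z) = Up \/ zone_after (- z) = Lf).
  rewrite (zone_after_opp uz).
  by case: (zone_after z) => /=; [left; left|left; right|right; left|right; right].
  have [s /andP[s0 sh] sz] := half_loop_onto cF X0 Y0 HY uz kz dz.
  exists s; first by rewrite s0 /loop_time; lra.
  by rewrite /loop sh.
have uz' : unblocked G F (- z) by exact/unblocked_opp.
have [|s /andP[s0 sh] sz] := half_loop_onto cG Y0 X0 HX uz' kz.
  by rewrite (zone_after_opp uz) dev_opp.
exists (s + half_time F Y); first by rewrite /loop_time; apply/andP; split; lra.
by rewrite loop_second ?lerDr// addrK sz opprK.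
Qed.

Lemma zsol_periodic_orbit (z : R -> R[i]) T : zsol F G z -> 0 < T ->
  (forall t, z (t + T) = z t) -> exists s, forall h, z h = closed_orbit (s + h).
Proof.
move=> sz T0 zT.
have [uz _ _ _] := sz 0.
have dz := periodic_total_dev0 cF cG X0 Y0 HY HX sz T0 zT 0.
have [s sE] := loop_onto uz dz.
exists s => h; rewrite -{1}(add0r h).
by apply: (zsol_uniq sz closed_orbit_zsol).
Qed.

Lemma closed_orbit_nonconst : exists t, closed_orbit t <> closed_orbit 0.
Proof.
exists (pi / fb F).
have hF := half_time_gt0 cF Y0; have hG := half_time_gt0 cG X0.
have h1 : pi / fb F <= half_time F Y by apply: half_time_ge.
have := @closed_orbitE 0 (pi / fb F); rewrite mulr0 addr0 => ->; last first.
  by rewrite (ltW pF)/= (le_trans h1)// /loop_time lerDl ltW.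
have := @closed_orbitE 0 0; rewrite mulr0 addr0 => ->; last by rewrite lexx ltW// loop_time_gt0.
rewrite loop0 /loop h1 /half_loop lexx (spiral_arc_end cF HY) => -[] ?; have := X0; have := Y0; lra.
Qed.

(** After rotation by pi the point -2i becomes 2i, seen from the focus as [fx G] + i: its modulus is
    the square root and its angle atan(1 / [fx G]). The equation says that its deviation is zero. *)
Lemma closed_orbit_at_infinity t : closed_orbit t = 0 +i* -2 ->
  Num.sqrt (fx G ^+ 2 + 1) = (Y + fx G) * expR (fa G / fb G * atan (fx G)^-1).
Proof.
move=> ot.
have := periodic_total_dev0 cF cG X0 Y0 HY HX closed_orbit_zsol loop_time_gt0 closed_orbit_periodic t.
rewrite ot /total_dev (@inzone_after _ Lw)/=; last by rewrite ltrN2 ltr1n.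
rewrite /spiral_dev => /eqP; rewrite subr_eq0 => /eqP.
have [_ _ x1] := cG.
have s0 : 0 < Num.sqrt (fx G ^+ 2 + 1) by rewrite sqrtr_gt0; nra.
have cE : Num.sqrt (1 + (fx G)^-1 ^+ 2) = Num.sqrt (fx G ^+ 2 + 1) / fx G.
  have -> : 1 + (fx G)^-1 ^+ 2 = (fx G ^+ 2 + 1) / fx G ^+ 2.
    by field; rewrite lt0r_neq0//; lra.
  by rewrite sqrtrM ?sqrtrV ?sqrtr_sqr ?gtr0_norm//; nra.
have co : cos (atan (fx G)^-1) = fx G / Num.sqrt (fx G ^+ 2 + 1).
  by rewrite cos_atan cE invf_div.
have co0 : cos (atan (fx G)^-1) != 0 by rewrite co mulf_neq0 ?invr_eq0 ?lt0r_neq0//; lra.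
have si : sin (atan (fx G)^-1) = (Num.sqrt (fx G ^+ 2 + 1))^-1.
  have := atanK (fx G)^-1; rewrite /tan => /(canRL (mulfVK co0)) ->.
  by rewrite co mulrA mulVf ?mul1r// lt0r_neq0//; lra.
have [||||-> ->//] := @polarK _ (Num.sqrt (fx G ^+ 2 + 1)) (atan (fx G)^-1) (- (0 +i* -2) - focus_pt G).
- by [].
- have a0 : 0 < atan (fx G)^-1 by rewrite -(@atan0 R) lt_atan// invr_gt0; lra.
  by rewrite ltW//= ltW// (lt_trans (atan_ltpi2 _))// ltr_pdivrMr// ltr_pMr ?pi_gt0// ltr1n.
- by rewrite co mulrC divfK ?lt0r_neq0// !reimE /=; ring.
- by rewrite si mulfV ?lt0r_neq0// !reimE /=; ring.
Qed.

End Orbit.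

(** * Filippov sets in a Moebius chart *)

Section ComplexTopology.
Variable R : realType.
Local Notation C := (R[i]^o).

Definition ccontinuous (f : R[i] -> R[i]) (v : R[i]) := {for (v : C), continuous (f : C -> C)}.

Lemma ccontinuousM f g v : ccontinuous f v -> ccontinuous g v -> ccontinuous (fun x => f x * g x) v.
Proof. by rewrite /ccontinuous /prop_for /continuous_at => cf cg; apply: (cvgM cf cg). Qed.
Lemma ccontinuousD f g v : ccontinuous f v -> ccontinuous g v -> ccontinuous (fun x => f x + g x) v.
Proof. by rewrite /ccontinuous /prop_for /continuous_at => cf cg; apply: (cvgD cf cg). Qed.
Lemma ccontinuous_cst c v : ccontinuous (fun=> c) v.
Proof.
move=> P Pc; apply: (@filterS _ (nbhs (v : C)) _ setT); last exact: filterT.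
by move=> x _; exact: (nbhs_singleton Pc).
Qed.
Lemma ccontinuous_id v : ccontinuous (fun x => x) v.
Proof. by move=> P. Qed.
Lemma ccontinuousV f v : f v != 0 -> ccontinuous f v -> ccontinuous (fun x => (f x)^-1) v.
Proof. by rewrite /ccontinuous /prop_for /continuous_at => f0 cf; apply: (cvgV f0 cf). Qed.

Lemma ccontinuousP f v : ccontinuous f v <->
  forall P, nbhs (f v : C) P -> nbhs (v : C) (fun x => P (f x)).
Proof. by []. Qed.

(** The implication covers the case p = v as well. It discards the exceptional points 0 and 1 of a
    chart from punctured neighbourhoods. *)
Lemma nbhs_neq (v p : R[i]) : nbhs (v : C) (fun x => x != v -> x != p).
Proof.
have [->|pv] := eqVneq p v.
  by apply/nbhs_complexP; exists 1.
have u0 : 0 < Re (p - v) ^+ 2 + Im (p - v) ^+ 2 by apply: complex_neq0; rewrite subr_eq0.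
apply/nbhs_complexP; pose e := Num.sqrt ((Re (p - v) ^+ 2 + Im (p - v) ^+ 2) / 2).
have e2 : e ^+ 2 = (Re (p - v) ^+ 2 + Im (p - v) ^+ 2) / 2 by rewrite sqr_sqrtr//; lra.
exists e; first by rewrite sqrtr_gt0; lra.
move=> x rx ix _; apply/eqP => xp; rewrite xp in rx ix.
have r2 : Re (p - v) ^+ 2 < e ^+ 2.
  by rewrite reD reN -(real_normK (num_real (Re p - _))) ltr_pXn2r// nnegrE// sqrtr_ge0.
have i2 : Im (p - v) ^+ 2 < e ^+ 2.
  by rewrite imD imN -(real_normK (num_real (Im p - _))) ltr_pXn2r// nnegrE// sqrtr_ge0.
lra.
Qed.

Lemma closed_halfplane (k l m : R) :
  closed ([set q | m <= k * Re q + l * Im q] : set C).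
Proof.
rewrite -[X in closed X]setCK; apply: open_closedC; rewrite openE => q /= /negP.
rewrite -ltNge => qm; apply/nbhs_complexP.
have kl0 : 0 < `|k| + `|l| + 1 by rewrite ltr_wpDl// addr_ge0.
pose e := (m - (k * Re q + l * Im q)) / (`|k| + `|l| + 1).
have e0 : 0 < e by rewrite divr_gt0// subr_gt0.
have eE : (`|k| + `|l| + 1) * e = m - (k * Re q + l * Im q).
  by rewrite mulrC divfK// lt0r_neq0.
exists e => // v rv iv; apply/negP; rewrite -ltNge.
have kv : k * (Re v - Re q) <= `|k| * e.
  by apply: le_trans (ler_norm _) _; rewrite normrM ler_wpM2l// ltW.
have lv : l * (Im v - Im q) <= `|l| * e.
  by apply: le_trans (ler_norm _) _; rewrite normrM ler_wpM2l// ltW.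
by rewrite !mulrDl in eE; rewrite !mulrBr in kv lv; lra.
Qed.

Lemma convex_halfplane (k l m : R) :
  convex_set ([set q | m <= k * Re q + l * Im q] : set (Rcomplex R)).
Proof.
move=> x y lam; rewrite !inE/= => hx hy.
have cE : conv lam x y = ((lam%:num * Re x + (1 - lam%:num) * Re y) +i*
    (lam%:num * Im x + (1 - lam%:num) * Im y)).
  by case: x {hx} => xr xi; case: y {hy} => yr yi.
rewrite cE /=.
have l0 : 0 <= lam%:num by []. 
have l1 : lam%:num <= 1 by [].
have := ler_wpM2l l0 hx; have := ler_wpM2l (_ : 0 <= 1 - lam%:num) hy.
rewrite subr_ge0 => /(_ l1); nra.
Qed.

Lemma abs_continuous_cont (f : R -> R) (s t x e : R) : abs_continuous f s t ->
  s < x < t -> 0 < e -> exists2 d : R, 0 < d &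
  forall y, `|y - x| < d -> `|f y - f x| < e.
Proof.
move=> acf /andP[sx xt] e0; have [d d0 Hd] := abs_continuous_list acf e0.
exists (Num.min d (Num.min (x - s) (t - x))); first by rewrite !lt_min d0 !subr_gt0 sx.
move=> y; rewrite !lt_min => /andP[yd /andP[ys yt]].
move: ys yt; rewrite 2![`|y - x| < _]ltr_norml => /andP[y1 y2] /andP[y3 y4].
have [yx|xy] := leP y x.
  have := Hd [:: (y, x)]; rewrite /= !big_seq1 /= distrC; apply=> //.
    by rewrite andbT; apply/andP; split; [apply/andP; split|]; lra.
  by rewrite distrC ger0_norm// in yd; lra.
have := Hd [:: (x, y)]; rewrite /= !big_seq1 /=; apply=> //.
  by rewrite andbT; apply/andP; split; [apply/andP; split|]; lra.
by rewrite ger0_norm// in yd; lra.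
Qed.

Lemma abs_continuous_lin (f g : R -> R) (k l s t : R) :
  abs_continuous f s t -> abs_continuous g s t ->
  abs_continuous (fun u => k * f u + l * g u) s t.
Proof.
move=> acf acg e e0.
have kl0 : 0 < `|k| + `|l| + 1 by rewrite ltr_wpDl// addr_ge0.
have q0 : 0 < e / (`|k| + `|l| + 1) by rewrite divr_gt0.
have [d1 d10 H1] := acf _ q0; have [d2 d20 H2] := acg _ q0.
exists (Num.min d1 d2); first by rewrite lt_min d10.
move=> n a b ab dis; rewrite lt_min => /andP[s1 s2].
have {}H1 := H1 n a b ab dis s1; have {}H2 := H2 n a b ab dis s2.
apply: (@le_lt_trans _ _ (\sum_(i < n) (`|k| * `|f (b i) - f (a i)| +
    `|l| * `|g (b i) - g (a i)|))).
  apply: ler_sum => i _; rewrite -!normrM.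
  apply: le_trans (ler_normD _ _); rewrite le_eqVlt; apply/orP; left; apply/eqP; congr `|_|; ring.
rewrite big_split -!mulr_sumr /=.
set qq := e / _ in H1 H2 q0.
have eE : (`|k| + `|l| + 1) * qq = e by rewrite mulrC divfK// lt0r_neq0.
have := ler_wpM2l (normr_ge0 k) (ltW H1); have := ler_wpM2l (normr_ge0 l) (ltW H2).
by rewrite -eE; lra.
Qed.

End ComplexTopology.

(** * Linear bounds passing from the field to Filippov solutions *)

Section FilippovBounds.
Variable R : realType.
Local Notation C := (R[i]^o).
Implicit Types (S : pwsystem R) (k l m : R).

Lemma nbhs_halfplane k l m (q0 : R[i]) : m < k * Re q0 + l * Im q0 ->
  nbhs (q0 : C) (fun q => m < k * Re q + l * Im q).
Proof.
move=> H; have /closed_openC oH := @closed_halfplane R (- k) (- l) (- m).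
apply: filterS (open_nbhs_nbhs (conj oH _)) => [q /=|/=].
  by move/negP; rewrite -ltNge; lra.
by apply/negP; rewrite -ltNge; lra.
Qed.

(** A closed half plane is closed and convex, hence one of the sets K in the definition. As k and l
    are arbitrary, lower bounds also provide upper ones. *)
Lemma filippov_halfplane S (v1 q : R[i]) k l m :
  nbhs (v1 : C) (fun v => v != v1 -> pwdomain S v ->
    m <= k * Re (pwfield S v) + l * Im (pwfield S v)) ->
  filippov S v1 q -> m <= k * Re q + l * Im q.
Proof.
move=> H /(_ [set q | m <= k * Re q + l * Im q]); apply.
- exact: closed_halfplane.
- exact: convex_halfplane.
move=> p cp; have := @closed_halfplane R k l m; apply => B pB.
exact: cp.
Qed.

Lemma filippov_sol_incr S (v : R -> R[i]) (s0 t0 t : R) k l m :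
  filippov_sol S v s0 t0 -> s0 < t < t0 ->
  nbhs (v t : C) (fun v' => v' != 0 -> v' != 1 -> pwdomain S v' ->
    m <= k * Re (pwfield S v') + l * Im (pwfield S v')) ->
  exists2 e : R, 0 < e & forall x y, t - e < x -> x <= y -> y < t + e ->
    m * (y - x) <= k * Re (v y) + l * Im (v y) - (k * Re (v x) + l * Im (v x)).
Proof.
(* Passing to the interior gives a neighbourhood of every nearby point [v u], as the bound on the
   Filippov set at that point requires. *)
move=> [_ acv dv] /andP[s0t tt0] /nbhs_interior /nbhs_complexP[r r0 Hr].
have [acR acI] := acv ((s0 + t) / 2) ((t + t0) / 2) ltac:(lra) ltac:(lra).
have ti : (s0 + t) / 2 < t < (t + t0) / 2 by apply/andP; split; lra.
have [d1 d10 D1] := abs_continuous_cont acR ti r0.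
have [d2 d20 D2] := abs_continuous_cont acI ti r0.
exists (Num.min (Num.min d1 d2) (Num.min (t - s0) (t0 - t))).
  by rewrite !lt_min d10 d20 !subr_gt0 s0t.
set e := Num.min _ _ => x y ex xy ye.
have [e1 e2 e3 e4] : [/\ e <= d1, e <= d2, e <= t - s0 & e <= t0 - t].
  by split; rewrite /e !ge_min lexx ?orbT.
have [acx acy] := acv x y ltac:(lra) ltac:(lra).
apply: (@abs_continuous_incr _ (fun u => k * Re (v u) + l * Im (v u))) => //.
  exact: abs_continuous_lin.
case: dv => N [mN N0 dvN]; exists N; split => // u nu; apply: dvN => Hu; apply: nu => /andP[xu uy].
have [|q fq [dr di]] := Hu; first by apply/andP; split; lra.
exists (k * Re q + l * Im q).
  have := is_derive1D (is_derive1M (is_derive1_cst k u) dr) (is_derive1M (is_derive1_cst l u) di).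
  by congr is_derive; rewrite !mul0r !add0r.
apply: filippov_halfplane fq.
have ud : `|u - t| < e by rewrite ltr_norml; apply/andP; split; lra.
have := Hr (v u) (D1 u (lt_le_trans ud e1)) (D2 u (lt_le_trans ud e2)).
move=> vuP; apply: filterS3 vuP (nbhs_neq (v u) 0) (nbhs_neq (v u) 1).
by move=> w Hw w0 w1 wv; apply: Hw; [exact: w0|exact: w1].
Qed.

End FilippovBounds.

(** * Transversal crossings of the two lines *)

Section Crossing.
Variable R : realType.
Variables (F G : focus R).
Hypotheses (cF : contracting F) (cG : contracting G).
Local Notation C := (R[i]^o).

(* The zones are listed as: the one entered, then the one left. *)
Variant crossing (z : R[i]) : zone -> zone -> Prop :=
| NoCrossing k of inzone k z : crossing z k k
| TopRight of Im z = 1 & fx G < Re z : crossing z Up Rt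
| TopLeft of Im z = 1 & Re z < - fx F : crossing z Lf Up
| BottomRight of Im z = -1 & fx G < Re z : crossing z Rt Lw
| BottomLeft of Im z = -1 & Re z < - fx F : crossing z Lw Lf.

(** On Im z = 1 and Im z = -1 the blocking inequality reduces to Re z > [fx G] on the right and Re z
    < -[fx F] on the left. *)
Lemma crossingP (z : R[i]) : unblocked F G z ->
  crossing z (zone_after z) (zone_before z).
Proof.
have [_ _ xF] := cF; have [_ _ xG] := cG.
have nc k : inzone k z -> crossing z (zone_after z) (zone_before z).
  by move=> kz; rewrite (inzone_after kz) (inzone_before kz); exact: NoCrossing.
have [i1 _|i1] := ltP 1 (Im z); first exact: (nc Up).
have [i2 _|i2] := ltP (Im z) (-1); first exact: (nc Lw).
case; first by rewrite lter_normr => /orP[]; lra.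
  move=> [r0 H].
  move: i1 i2; rewrite le_eqVlt => /predU1P[iz _|i1].
    rewrite /zone_after /zone_before r0 iz lexx ltxx ifT; last by lra.
    by apply: TopRight => //; rewrite iz expr1n subrK in H; nra.
  rewrite le_eqVlt => /predU1P[iz|i2]; last exact: (nc Rt).
  rewrite /zone_after /zone_before r0 -iz lexx ltxx ifF; last by apply/negbTE; rewrite -ltNge; lra.
  rewrite ifF; last by apply/negbTE; rewrite -leNgt; lra.
  by apply: BottomRight => //; rewrite -iz sqrrN expr1n subrK in H; nra.
move=> [r0 H].
have r0' : (0 < Re z) = false by apply/negbTE; rewrite -leNgt ltW.
move: i1 i2; rewrite le_eqVlt => /predU1P[iz _|i1].
  rewrite /zone_after /zone_before r0' iz lexx ltxx ifT; last by lra.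
  by apply: TopLeft => //; rewrite iz expr1n subrK in H; nra.
rewrite le_eqVlt => /predU1P[iz|i2]; last exact: (nc Lf).
rewrite /zone_after /zone_before r0' -iz lexx ltxx ifF; last by apply/negbTE; rewrite -leNgt; lra.
rewrite ifF; last by apply/negbTE; rewrite -ltNge; lra.
by apply: BottomLeft => //; rewrite -iz sqrrN expr1n subrK in H; nra.
Qed.

Lemma nbhs_Re_gt (z : R[i]) (c : R) : c < Re z -> nbhs (z : C) (fun z => c < Re z).
Proof.
move=> H; have := @nbhs_halfplane R 1 0 c z; rewrite mul1r mul0r addr0 => /(_ H).
by apply: filterS => w; rewrite mul1r mul0r addr0.
Qed.
Lemma nbhs_Re_lt (z : R[i]) (c : R) : Re z < c -> nbhs (z : C) (fun z => Re z < c).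
Proof.
move=> H; have := @nbhs_halfplane R (-1) 0 (- c) z.
rewrite mulN1r mul0r addr0 ltrN2 => /(_ H).
by apply: filterS => w; rewrite mulN1r mul0r addr0 ltrN2.
Qed.
Lemma nbhs_Im_gt (z : R[i]) (c : R) : c < Im z -> nbhs (z : C) (fun z => c < Im z).
Proof.
move=> H; have := @nbhs_halfplane R 0 1 c z; rewrite mul1r mul0r add0r => /(_ H).
by apply: filterS => w; rewrite mul1r mul0r add0r.
Qed.
Lemma nbhs_Im_lt (z : R[i]) (c : R) : Im z < c -> nbhs (z : C) (fun z => Im z < c).
Proof.
move=> H; have := @nbhs_halfplane R 0 (-1) (- c) z.
rewrite mulN1r mul0r add0r ltrN2 => /(_ H).
by apply: filterS => w; rewrite mulN1r mul0r add0r ltrN2.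
Qed.

Lemma inzone_open k (z : R[i]) : inzone k z -> nbhs (z : C) (inzone k).
Proof.
case: k => /= [|[r i1 i2]||[r i1 i2]].
- exact: nbhs_Im_gt.
- by apply: filterS3 (nbhs_Re_lt r) (nbhs_Im_gt i1) (nbhs_Im_lt i2).
- exact: nbhs_Im_lt.
- by apply: filterS3 (nbhs_Re_gt r) (nbhs_Im_gt i1) (nbhs_Im_lt i2).
Qed.

Lemma crossing_adjacent (z0 : R[i]) k1 k2 : crossing z0 k1 k2 ->
  nbhs (z0 : C) (fun z => Im z != 1 -> Im z != -1 -> inzone k1 z \/ inzone k2 z).
Proof.
have [_ _ xF] := cF; have [_ _ xG] := cG.
have lN1 : (-1 : R) < 1 by lra.
case=> [k /inzone_open|iz r|iz r|iz r|iz r].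
- by apply: filterS => z; left.
- have i1 : -1 < Im z0 by rewrite iz.
  have r0 : 0 < Re z0 by lra.
  apply: filterS2 (nbhs_Im_gt i1) (nbhs_Re_gt r0) => z ? ? z1 _.
  by move: z1; rewrite neq_lt => /orP[]; [right|left].
- have i1 : -1 < Im z0 by rewrite iz.
  have r0 : Re z0 < 0 by lra.
  apply: filterS2 (nbhs_Im_gt i1) (nbhs_Re_lt r0) => z ? ? z1 _.
  by move: z1; rewrite neq_lt => /orP[]; [left|right].
- have i1 : Im z0 < 1 by rewrite iz.
  have r0 : 0 < Re z0 by lra.
  apply: filterS2 (nbhs_Im_lt i1) (nbhs_Re_gt r0) => z ? ? _.
  by rewrite neq_lt => /orP[]; [right|left].
- have i1 : Im z0 < 1 by rewrite iz.
  have r0 : Re z0 < 0 by lra.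
  apply: filterS2 (nbhs_Im_lt i1) (nbhs_Re_lt r0) => z ? ? _.
  by rewrite neq_lt => /orP[]; [left|right].
Qed.

(** A single zone accumulating at the point suffices to show that its Filippov set is not empty; the
    one directly above is always available. *)
Lemma crossing_upward (z0 : R[i]) k1 k2 : crossing z0 k1 k2 -> exists k,
  exists2 e : R, 0 < e & forall tau, 0 < tau < e -> inzone k (z0 + 0 +i* tau).
Proof.
have [_ _ xF] := cF; have [_ _ xG] := cG.
case=> [k /inzone_open/nbhs_complexP[e e0 He]|iz r|iz r|iz r|iz r].
- exists k, e => // tau /andP[t0 te]; apply: He; rewrite !reimE /= addrAC subrr add0r.
    by rewrite normr0.
  by rewrite gtr0_norm.
- by exists Up, 1 => // tau /andP[t0 te]; rewrite /= !reimE /= iz; lra.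
- by exists Up, 1 => // tau /andP[t0 te]; rewrite /= !reimE /= iz; lra.
- by exists Rt, 1 => // tau /andP[t0 te]; rewrite /= !reimE /= iz; split; lra.
- by exists Lf, 1 => // tau /andP[t0 te]; rewrite /= !reimE /= iz; split; lra.
Qed.

(** Here sg is 1 on the right and -1 on the left. Im(i/z) has the sign of Re z; the upper field has
    imaginary part b (Re z + [fx F]) on Im z = 1, the lower one d (Re z - [fx G]) on Im z = -1, with
    b = [fb F] and d = [fb G]. *)
Lemma crossing_transversal (z0 : R[i]) k1 k2 : crossing z0 k1 k2 -> inzone k1 z0 \/
  exists sg : R, [/\ sg = 1 \/ sg = -1, 0 < sg * Im (zfield F G k1 z0),
    0 < sg * Im (zfield F G k2 z0) &
    nbhs (z0 : C) (fun z => (0 < sg * (Im z - Im z0) -> inzone k1 z) /\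
                            (sg * (Im z - Im z0) < 0 -> inzone k2 z))].
Proof.
have [_ bF xF] := cF; have [_ bG xG] := cG.
have lN1 : (-1 : R) < 1 by lra.
have inv_i : Re z0 != 0 -> exists2 n : R, 0 < n & Im ('i%C / z0) = Re z0 * n.
  move=> r0; exists (Re z0 ^+ 2 + Im z0 ^+ 2)^-1.
    rewrite invr_gt0; apply: ltr_pwDl (sqr_ge0 _); by rewrite exprn_even_gt0.
  by rewrite !reimE /=; ring.
case=> [k|iz r|iz r|iz r|iz r]; [by left|right..].
- have i1 : -1 < Im z0 by rewrite iz.
  have r0 : 0 < Re z0 by lra.
  have [n n0 nE] := inv_i (lt0r_neq0 r0).
  exists 1; split; [by left| | |].
  + by rewrite mul1r /= /focus_field !reimE /= iz subrr mulr0 add0r opprK; apply: mulr_gt0; lra.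
  + by rewrite mul1r /= nE mulr_gt0.
  apply: filterS2 (nbhs_Im_gt i1) (nbhs_Re_gt r0) => z ? ?.
  by rewrite mul1r iz subr_gt0 subr_lt0; split.
- have i1 : -1 < Im z0 by rewrite iz.
  have r0 : Re z0 < 0 by lra.
  have [n n0 nE] := inv_i (ltr0_neq0 r0).
  exists (-1); split; [by right| | |].
  + by rewrite mulN1r /= nE; nra.
  + by rewrite mulN1r /= /focus_field !reimE /= iz subrr mulr0 add0r opprK; nra.
  apply: filterS2 (nbhs_Im_gt i1) (nbhs_Re_lt r0) => z ? ?.
  by rewrite mulN1r iz oppr_gt0 oppr_lt0 subr_gt0 subr_lt0; split.
- have i1 : Im z0 < 1 by rewrite iz.
  have r0 : 0 < Re z0 by lra.
  have [n n0 nE] := inv_i (lt0r_neq0 r0).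
  exists 1; split; [by left| | |].
  + by rewrite mul1r /= nE mulr_gt0.
  + by rewrite mul1r /= /focus_field !reimE /= iz; nra.
  apply: filterS2 (nbhs_Im_lt i1) (nbhs_Re_gt r0) => z ? ?.
  by rewrite mul1r iz subr_gt0 subr_lt0; split.
- have i1 : Im z0 < 1 by rewrite iz.
  have r0 : Re z0 < 0 by lra.
  have [n n0 nE] := inv_i (ltr0_neq0 r0).
  exists (-1); split; [by right| | |].
  + by rewrite mulN1r /= /focus_field !reimE /= iz; nra.
  + by rewrite mulN1r /= nE; nra.
  apply: filterS2 (nbhs_Im_lt i1) (nbhs_Re_lt r0) => z ? ?.
  by rewrite mulN1r iz oppr_gt0 oppr_lt0 subr_gt0 subr_lt0; split.
Qed.

End Crossing.

(** * Moebius charts and the field read in them *)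

Section Chart.
Variable R : realType.
Variables (F G : focus R).
Local Notation C := (R[i]^o).
Implicit Types (S : pwsystem R) (kap mu v z : R[i]).

(** Sends v = 1, the point of tangency, to infinity and v = infinity to kap. *)
Definition chart_map kap mu v := kap + mu / (v - 1).
Definition chart_inv kap mu z := 1 + mu / (z - kap).
(** The pullback of [zfield]: the factor in front is dv/dz. *)
Definition chart_field kap mu k v :=
  - (v - 1) ^+ 2 / mu * zfield F G k (chart_map kap mu v).

(* The point v = 0 is left out because inv_system removes u = 0 from all its
   zones; Filippov sets, defined by punctured neighbourhoods, do not see it. *)
Definition chart S kap mu : Prop := mu != 0 /\ forall v, v != 0 -> v != 1 ->
  [/\ [/\ zone_p S v <-> 1 < Im (chart_map kap mu v),
          zone_c S v <-> -1 < Im (chart_map kap mu v) < 1 &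
          zone_m S v <-> Im (chart_map kap mu v) < -1],
      zone_p S v -> field_p S v = chart_field kap mu Up v,
      zone_c S v -> field_c S v = chart_field kap mu Rt v &
      zone_m S v -> field_m S v = chart_field kap mu Lw v].

Lemma chart_invK kap mu z : mu != 0 -> z != kap ->
  chart_map kap mu (chart_inv kap mu z) = z.
Proof.
move=> m0 zk; rewrite /chart_map /chart_inv addrAC subrr add0r.
by field; rewrite m0 subr_eq0 zk.
Qed.

Lemma chart_mapK kap mu v : mu != 0 -> v != 1 ->
  chart_inv kap mu (chart_map kap mu v) = v.
Proof.
move=> m0 v1; rewrite /chart_map /chart_inv.
have -> : kap + mu / (v - 1) - kap = mu / (v - 1) by rewrite addrAC subrr add0r.
by field; rewrite m0 subr_eq0 v1.
Qed.

Lemma chart_map_neq kap mu v : mu != 0 -> v != 1 -> chart_map kap mu v != kap.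
Proof.
move=> m0 v1; rewrite /chart_map -subr_eq0 addrAC subrr add0r.
by rewrite mulf_neq0// invr_eq0 subr_eq0.
Qed.

Lemma chart_inv_neq1 kap mu z : mu != 0 -> z != kap -> chart_inv kap mu z != 1.
Proof.
move=> m0 zk; rewrite /chart_inv -subr_eq0 addrAC subrr add0r.
by rewrite mulf_neq0// invr_eq0 subr_eq0.
Qed.

Lemma ccontinuousB (f : R[i] -> R[i]) c v : ccontinuous f v -> ccontinuous (fun x => f x - c) v.
Proof. by move=> cf; apply: ccontinuousD => //; exact: ccontinuous_cst. Qed.

Lemma chart_map_ccontinuous kap mu v : v != 1 -> ccontinuous (chart_map kap mu) v.
Proof.
move=> v1; apply: ccontinuousD; first exact: ccontinuous_cst.
apply: ccontinuousM; first exact: ccontinuous_cst.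
by apply: ccontinuousV; [rewrite subr_eq0|apply: ccontinuousB; exact: ccontinuous_id].
Qed.

Lemma chart_inv_ccontinuous kap mu z : z != kap -> ccontinuous (chart_inv kap mu) z.
Proof.
move=> v1; apply: ccontinuousD; first exact: ccontinuous_cst.
apply: ccontinuousM; first exact: ccontinuous_cst.
by apply: ccontinuousV; [rewrite subr_eq0|apply: ccontinuousB; exact: ccontinuous_id].
Qed.

Lemma chart_field_ccontinuous kap mu k v : v != 1 -> chart_map kap mu v != 0 ->
  ccontinuous (chart_field kap mu k) v.
Proof.
move=> v1 z0.
have cm := chart_map_ccontinuous (kap := kap) (mu := mu) v1.
have cN f : ccontinuous f v -> ccontinuous (fun x => - f x) v.
  move=> cf; have := ccontinuousM (@ccontinuous_cst R (- 1) v) cf.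
  by congr ccontinuous; apply/funext => x; rewrite mulN1r.
apply: ccontinuousM.
  apply: ccontinuousM; last exact: ccontinuous_cst.
  apply: cN; have cv : ccontinuous (fun x => x - 1) v by apply: ccontinuousB; exact: ccontinuous_id.
  have := ccontinuousM cv cv; congr ccontinuous.
case: k; rewrite /zfield /focus_field.
- by apply: ccontinuousM; [exact: ccontinuous_cst|exact: ccontinuousB].
- by apply: ccontinuousM; [exact: ccontinuous_cst|exact: ccontinuousV].
- by apply: (cN); apply: ccontinuousM; [exact: ccontinuous_cst|apply: ccontinuousB; exact: cN].
- by apply: ccontinuousM; [exact: ccontinuous_cst|exact: ccontinuousV].
Qed.

Lemma pwfield_chart S kap mu k v : chart S kap mu -> v != 0 -> v != 1 ->
  inzone k (chart_map kap mu v) ->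
  pwdomain S v /\ pwfield S v = chart_field kap mu k v.
Proof.
move=> [m0 /(_ v)] H v0 v1; have [[zp zc zm] fp fc fm] := H v0 v1.
have st : -1 < Im (chart_map kap mu v) < 1 -> pwdomain S v /\
   pwfield S v = chart_field kap mu Rt v.
  move=> i1; have cv : zone_c S v by exact/zc.
  split; first by left; right.
  rewrite /pwfield memNset; last by move/zp; case/andP: i1 => ? ? ?; lra.
  by rewrite mem_set// fc.
case: k => /= kz.
- have pv : zone_p S v by exact/zp.
  by split; [left; left|rewrite /pwfield mem_set// fp].
- by case: kz => _ i1 i2; apply: st; rewrite i1.
- have mv : zone_m S v by exact/zm.
  split; first by right.
  rewrite /pwfield memNset; last by move/zp => ?; lra.
  by rewrite memNset ?fm//; move/zc => /andP[? ?]; lra.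
- by case: kz => _ i1 i2; apply: st; rewrite i1.
Qed.

Lemma pwdomain_chart S kap mu v : chart S kap mu -> v != 0 -> v != 1 ->
  pwdomain S v -> Im (chart_map kap mu v) != 1 /\ Im (chart_map kap mu v) != -1.
Proof.
move=> [m0 /(_ v)] H v0 v1; have [[zp zc zm] _ _ _] := H v0 v1.
have lN1 : (-1 : R) < 1 by lra.
case=> [[/zp i1|/zc /andP[i1 i2]]|/zm i1].
- by split; rewrite gt_eqF//; lra.
- by split; [rewrite lt_eqF|rewrite gt_eqF].
- by split; rewrite lt_eqF//; lra.
Qed.

Hypotheses (cF : contracting F) (cG : contracting G).

Lemma unblocked_neq0 z : unblocked F G z -> z != 0.
Proof.
have [_ _ xF] := cF; have [_ _ xG] := cG.
move=> uz; apply/eqP => z0; move: uz; rewrite z0 /unblocked /= normr0.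
by case=> [|[]|[]]; rewrite ?ltxx// ltr10.
Qed.

(** Near a crossing only the two adjacent fields occur, and both are continuous across the line;
    strict bounds at the point persist nearby. *)
Lemma pwfield_near S kap mu v0 k1 k2 (k l m : R) : chart S kap mu -> v0 != 1 ->
  chart_map kap mu v0 != 0 -> crossing F G (chart_map kap mu v0) k1 k2 ->
  m < k * Re (chart_field kap mu k1 v0) + l * Im (chart_field kap mu k1 v0) ->
  m < k * Re (chart_field kap mu k2 v0) + l * Im (chart_field kap mu k2 v0) ->
  nbhs (v0 : C) (fun v => v != 0 -> v != 1 -> pwdomain S v ->
    m <= k * Re (pwfield S v) + l * Im (pwfield S v)).
Proof.
move=> cS v1 z0 cr m1 m2.
have N1 := (ccontinuousP _ _).1 (chart_map_ccontinuous (kap := kap) (mu := mu) v1) _ (crossing_adjacent cF cG cr).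
have N2 := (ccontinuousP _ _).1 (chart_field_ccontinuous (kap := kap) (mu := mu) (k := k1) v1 z0) _ (nbhs_halfplane m1).
have N3 := (ccontinuousP _ _).1 (chart_field_ccontinuous (kap := kap) (mu := mu) (k := k2) v1 z0) _ (nbhs_halfplane m2).
apply: filterS3 N1 N2 N3 => v /= A1 A2 A3 v0' v1' dv.
have [i1 i2] := pwdomain_chart cS v0' v1' dv.
have [kz|kz] := A1 i1 i2.
  by have [_ ->] := pwfield_chart cS v0' v1' kz; exact: ltW.
by have [_ ->] := pwfield_chart cS v0' v1' kz; exact: ltW.
Qed.

(** Along the points whose z lies just above that of v0, all in zone k, the field tends to this
    value, which is therefore a cluster value. *)
Lemma filippov_chart_field S kap mu v0 k (e : R) : chart S kap mu -> v0 != 1 ->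
  chart_map kap mu v0 != 0 -> 0 < e ->
  (forall tau, 0 < tau < e -> inzone k (chart_map kap mu v0 + 0 +i* tau)) ->
  filippov S v0 (chart_field kap mu k v0).
Proof.
move=> cS v1 z0 e0 He K clK cvK; apply => A B FA fB; have m0 := cS.1.
have zk := chart_map_neq kap m0 v1; set z1 := chart_map kap mu v0 in z0 He zk *.
have H1 : nbhs (v0 : C) (fun v => v != v0 -> pwdomain S v -> A (pwfield S v)) by exact: FA.
have H2 := (ccontinuousP _ _).1 (chart_field_ccontinuous (kap := kap) (mu := mu) (k := k) v1 z0) _ fB.
have H3 := @nbhs_neq R v0 0; have H4 := @nbhs_neq R v0 1.
pose P v := ((v != v0 -> pwdomain S v -> A (pwfield S v)) /\
  B (chart_field kap mu k v)) /\ ((v != v0 -> v != 0) /\ (v != v0 -> v != 1)).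
have H : nbhs (v0 : C) P by apply: filterI; apply: filterI.
have := (ccontinuousP _ _).1 (chart_inv_ccontinuous (mu := mu) zk).
rewrite [chart_inv _ _ _]chart_mapK// => /(_ _ H) HH.
have /nbhs_complexP[r r0 Hr] :
    nbhs (z1 : C) (fun z => P (chart_inv kap mu z) /\ (z != z1 -> z != kap)).
  by apply: filterI => //; exact: nbhs_neq.
pose tau := Num.min e r / 2.
have t0 : 0 < tau by rewrite divr_gt0// lt_min e0.
have te : tau < e /\ tau < r.
  have : Num.min e r <= e /\ Num.min e r <= r by rewrite !ge_min !lexx orbT.
  by rewrite /tau => -[? ?]; move: t0; rewrite /tau => ?; split; lra.
pose z2 := z1 + 0 +i* tau.
have z21 : z2 != z1.
  rewrite /z2 -subr_eq0 addrAC subrr add0r; apply/eqP => -[] ?; lra.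
have [||[[A1 A2] [A3 A4]] A5] := Hr z2.
- by rewrite !reimE /= addrAC subrr add0r normr0.
- by rewrite !reimE /= addrAC subrr add0r gtr0_norm//; case: te.
have zk2 := A5 z21.
have kz2 : inzone k z2 by apply: He; rewrite t0; case: te.
have v2v0 : chart_inv kap mu z2 != v0.
  apply/eqP => e2; move/eqP: z21; apply.
  by rewrite -(chart_invK m0 zk2) e2.
have v20 := A3 v2v0; have v21 := A4 v2v0.
rewrite -(chart_invK m0 zk2) in kz2.
have [dv fv] := pwfield_chart cS v20 v21 kz2.
exists (pwfield S (chart_inv kap mu z2)); split; first exact: A1.
by rewrite fv.
Qed.

Lemma cderiv_chart_map kap mu k (v : R -> R[i]) t : mu != 0 -> v t != 1 ->
  cderiv v t (chart_field kap mu k (v t)) ->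
  cderiv (fun s => chart_map kap mu (v s)) t (zfield F G k (chart_map kap mu (v t))).
Proof.
move=> m0 v1 dv; have v10 : v t - 1 != 0 by rewrite subr_eq0.
have d1 : cderiv (fun s => v s - 1) t (chart_field kap mu k (v t)).
  by have := cderivD dv (cderiv_cst (- 1) t); rewrite addr0.
have := cderivD (cderiv_cst kap t) (cderivM (cderiv_cst mu t) (cderivV v10 d1)).
congr cderiv; rewrite /chart_field; field.
by rewrite m0 v10.
Qed.

Lemma cderiv_chart_inv kap mu k (z : R -> R[i]) t : mu != 0 -> z t != kap ->
  cderiv z t (zfield F G k (z t)) ->
  cderiv (fun s => chart_inv kap mu (z s)) t (chart_field kap mu k (chart_inv kap mu (z t))).
Proof.
move=> m0 zk dz; have zk0 : z t - kap != 0 by rewrite subr_eq0.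
have d1 : cderiv (fun s => z s - kap) t (zfield F G k (z t)).
  by have := cderivD dz (cderiv_cst (- kap) t); rewrite addr0.
have := cderivD (cderiv_cst 1 t) (cderivM (cderiv_cst mu t) (cderivV zk0 d1)).
congr cderiv; rewrite /chart_field chart_invK// /chart_inv; field.
by rewrite m0 zk0.
Qed.

End Chart.

(** * From Filippov solutions to classical ones *)

Section FilippovToClassical.
Variable R : realType.
Local Notation C := (R[i]^o).

(** The hypotheses bound f and -f from below, the form in which [filippov_sol_incr] delivers its
    estimates. *)
Lemma is_derive_squeeze (f : R -> R) (t g : R) :
  (forall m, m < g -> exists2 e : R, 0 < e & forall x y, t - e < x -> x <= y ->
     y < t + e -> m * (y - x) <= f y - f x) ->
  (forall m, m < - g -> exists2 e : R, 0 < e & forall x y, t - e < x -> x <= y ->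
     y < t + e -> m * (y - x) <= - (f y - f x)) ->
  is_derive t (1 : R) f g.
Proof.
move=> Hlo Hhi.
have H : (fun h : R => h^-1 *: (f (h + t) - f t)) @ 0^' --> (g : R).
  apply/cvgrPdist_le => e e0; rewrite /dnbhs near_withinE; apply/nbhs_ballP.
  have [e1 e10 H1] := Hlo (g - e) ltac:(lra).
  have [e2 e20 H2] := Hhi (- g - e) ltac:(lra).
  exists (Num.min e1 e2); first by rewrite /= lt_min e10.
  move=> h; rewrite -ball_normE /= sub0r normrN lt_min => /andP[h1 h2] h0.
  move: h1 h2; rewrite 2!ltr_norml => /andP[a1 a2] /andP[b1 b2].
  rewrite [_ *: _]mulrC ler_norml.
  have [hp|hn|] := ltgtP h 0; last by move=> hE; rewrite hE eqxx in h0.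
    have := H1 (h + t) t ltac:(lra) ltac:(lra) ltac:(lra).
    have := H2 (h + t) t ltac:(lra) ltac:(lra) ltac:(lra).
    have -> : t - (h + t) = - h by lra.
    have -> : (f (h + t) - f t) / h = (f t - f (h + t)) / (- h).
      by rewrite invrN mulrN -mulNr opprB.
    move=> A1 A2; have nh : 0 < - h by lra.
    have B1 : g - e <= (f t - f (h + t)) / (- h) by rewrite ler_pdivlMr.
    have B2 : (f t - f (h + t)) / (- h) <= g + e by rewrite ler_pdivrMr//; lra.
    by apply/andP; split; lra.
  have := H1 t (h + t) ltac:(lra) ltac:(lra) ltac:(lra).
  have := H2 t (h + t) ltac:(lra) ltac:(lra) ltac:(lra).
  have -> : h + t - t = h by lra.
  move=> A1 A2.
  have B1 : g - e <= (f (h + t) - f t) / h by rewrite ler_pdivlMr.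
  have B2 : (f (h + t) - f t) / h <= g + e by rewrite ler_pdivrMr//; lra.
  by apply/andP; split; lra.
have H' : (fun h : R => h^-1 *: (f (h *: (1 : R) + t) - f t)) @ 0^' --> (g : R).
  apply: cvg_trans H; apply: near_eq_cvg; near=> h.
  by rewrite [h *: 1]mulr1.
apply: DeriveDef; first by apply/cvg_ex; exists g.
exact: cvg_lim H'.
Unshelve. all: by end_near.
Qed.

Lemma ccont_nbhs (z : R -> R[i]) t (P : set R[i]) : ccont z t -> nbhs (z t : C) P ->
  exists2 e : R, 0 < e & forall s, `|s - t| < e -> P (z s).
Proof.
move=> /ccontP cz /nbhs_complexP[r /cz[d d0 Hd] Hr]; exists d => // s /Hd[]; exact: Hr.
Qed.

Lemma near_ccont (p z : R -> R[i]) t : (\forall u \near t, p u = z u) ->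
  ccont p t -> ccont z t.
Proof.
move=> pz /ccontP cp; apply/ccontP => e /cp[d d0 Hd].
move/nbhs_ballP : (pz) => [r /= r0 Hr].
exists (Num.min d r); first by rewrite lt_min d0.
move=> s; rewrite lt_min => /andP[sd sr].
have <- : p s = z s by apply: Hr; rewrite -ball_normE /= distrC.
have <- : p t = z t by apply: Hr; rewrite -ball_normE /= subrr normr0.
exact: Hd.
Qed.

Variables (F G : focus R).
Hypotheses (cF : contracting F) (cG : contracting G).
Variables (S : pwsystem R) (kap mu : R[i]).
Hypothesis cS : chart F G S kap mu.

Lemma filippov_sol_ccont (v : R -> R[i]) (s0 t0 t : R) :
  filippov_sol S v s0 t0 -> s0 < t < t0 -> ccont v t.
Proof.
move=> [_ acv _] /andP[s0t tt0].
have [acR acI] := acv ((s0 + t) / 2) ((t + t0) / 2) ltac:(lra) ltac:(lra).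
have ti : (s0 + t) / 2 < t < (t + t0) / 2 by apply/andP; split; lra.
apply/ccontP => e e0.
have [d1 d10 D1] := abs_continuous_cont acR ti e0.
have [d2 d20 D2] := abs_continuous_cont acI ti e0.
exists (Num.min d1 d2); first by rewrite lt_min d10.
by move=> s; rewrite lt_min => /andP[? ?]; split; [exact: D1|exact: D2].
Qed.

(** The field is continuous inside a zone, so the almost everywhere inclusion squeezes the slopes of
    both components at every time. *)
Lemma filippov_sol_cderiv (v : R -> R[i]) k (s0 t0 t : R) :
  filippov_sol S v s0 t0 -> s0 < t < t0 -> v t != 1 ->
  chart_map kap mu (v t) != 0 -> inzone k (chart_map kap mu (v t)) ->
  cderiv v t (chart_field F G kap mu k (v t)).
Proof.
move=> sv ti v1 z0 kz.
have H (a b m : R) : m < a * Re (chart_field F G kap mu k (v t)) +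
      b * Im (chart_field F G kap mu k (v t)) ->
    exists2 e : R, 0 < e & forall x y, t - e < x -> x <= y -> y < t + e ->
      m * (y - x) <= a * Re (v y) + b * Im (v y) - (a * Re (v x) + b * Im (v x)).
  move=> mg; apply: (filippov_sol_incr sv ti).
  exact: (pwfield_near cF cG cS v1 z0 (NoCrossing F G kz) mg mg).
split; apply: is_derive_squeeze => m mg.
- have [|e e0 He] := H 1 0 m; first by rewrite mul1r mul0r addr0.
  by exists e => // x y ex xy ye; have := He x y ex xy ye; lra.
- have [|e e0 He] := H (-1) 0 m; first by rewrite mulN1r mul0r addr0.
  by exists e => // x y ex xy ye; have := He x y ex xy ye; lra.
- have [|e e0 He] := H 0 1 m; first by rewrite mul1r mul0r add0r.
  by exists e => // x y ex xy ye; have := He x y ex xy ye; lra.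
- have [|e e0 He] := H 0 (-1) m; first by rewrite mulN1r mul0r add0r.
  by exists e => // x y ex xy ye; have := He x y ex xy ye; lra.
Qed.

Lemma crossing_estimate (sg dr di p q wr wi M m h : R) :
  0 < h -> 0 < M -> 0 < m -> sg = 1 \/ sg = -1 ->
  `|dr| <= M * h -> `|di| <= M * h -> `|wr| < m / (4 * M) -> `|wi| < m / (4 * M) ->
  m * h <= sg * p * dr + sg * q * di ->
  0 < sg * (p * dr + q * di + (dr * wi + di * wr)).
Proof.
move=> h0 M0 mq0 sg1 hr hi hwr hwi H.
have : `|sg * (dr * wi + di * wr)| < m * h.
  rewrite normrM; have -> : `|sg| = 1 by case: sg1 => ->; rewrite ?normrN normr1.
  rewrite mul1r; apply: le_lt_trans (ler_normD _ _) _; rewrite !normrM.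
  have A1 : `|dr| * `|wi| <= M * h * (m / (4 * M)) by apply: ler_pM => //; exact: ltW.
  have A2 : `|di| * `|wr| <= M * h * (m / (4 * M)) by apply: ler_pM => //; exact: ltW.
  have A3 : M * h * (m / (4 * M)) = m * h / 4 by field; rewrite lt0r_neq0.
  have A4 : 0 < m * h by exact: mulr_gt0.
  rewrite A3 in A1 A2; clear -A1 A2 A4; lra.
rewrite ltr_norml mulrDr => /andP[K _]; rewrite [X in 0 < X]mulrDr mulrDr !mulrA.
rewrite !mulrDr !mulrA in K *; clear -K H; lra.
Qed.

Lemma filippov_sol_lipschitz (v : R -> R[i]) k1 k2 (s0 t0 t : R) :
  filippov_sol S v s0 t0 -> s0 < t < t0 -> v t != 1 ->
  crossing F G (chart_map kap mu (v t)) k1 k2 -> chart_map kap mu (v t) != 0 ->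
  exists2 M : R, 0 < M & exists2 e : R, 0 < e &
    forall x y, t - e < x -> x <= y -> y < t + e ->
      `|Re (v y) - Re (v x)| <= M * (y - x) /\ `|Im (v y) - Im (v x)| <= M * (y - x).
Proof.
move=> sv ti v1 cr z0.
set g1 := chart_field F G kap mu k1 (v t); set g2 := chart_field F G kap mu k2 (v t).
(* Dominates both components of both adjacent fields; the summand 1 makes the bounds strict. *)
pose M := 1 + `|Re g1| + `|Im g1| + `|Re g2| + `|Im g2|.
have M0 : 0 < M by rewrite /M -!addrA ltr_pwDl// !addr_ge0.
have bd (a b : R) : (a = 1 \/ a = -1) /\ b = 0 \/ (b = 1 \/ b = -1) /\ a = 0 ->
  - M < a * Re g1 + b * Im g1 /\ - M < a * Re g2 + b * Im g2.
  have [Ra Rb] := (ler_norm (Re g1), ler_norm (- Re g1)).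
  have [Ia Ib] := (ler_norm (Im g1), ler_norm (- Im g1)).
  have [Rc Rd] := (ler_norm (Re g2), ler_norm (- Re g2)).
  have [Ic Id] := (ler_norm (Im g2), ler_norm (- Im g2)).
  rewrite !normrN in Rb Ib Rd Id; rewrite /M.
  clear -Ra Rb Ia Ib Rc Rd Ic Id.
  by case=> -[[] -> ->]; split; lra.
have H (a b : R) : (a = 1 \/ a = -1) /\ b = 0 \/ (b = 1 \/ b = -1) /\ a = 0 ->
    exists2 e : R, 0 < e & forall x y, t - e < x -> x <= y -> y < t + e ->
      - M * (y - x) <= a * Re (v y) + b * Im (v y) - (a * Re (v x) + b * Im (v x)).
  move=> /bd[mg1 mg2]; apply: (filippov_sol_incr sv ti).
  exact: (pwfield_near cF cG cS v1 z0 cr mg1 mg2).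
have [e1 e10 E1] := H 1 0 ltac:(by left; split; [left|]).
have [e2 e20 E2] := H (-1) 0 ltac:(by left; split; [right|]).
have [e3 e30 E3] := H 0 1 ltac:(by right; split; [left|]).
have [e4 e40 E4] := H 0 (-1) ltac:(by right; split; [right|]).
exists M => //; exists (Num.min (Num.min e1 e2) (Num.min e3 e4)).
  by rewrite !lt_min e10 e20 e30 e40.
move=> x y; rewrite ltrBlDr -ltrBlDl !lt_min => /andP[/andP[x1 x2] /andP[x3 x4]] xy.
rewrite -ltrBlDl !lt_min => /andP[/andP[y1 y2] /andP[y3 y4]].
have {x1}X1 : t - e1 < x by rewrite ltrBlDr -ltrBlDl.
have {y1}Y1 : y < t + e1 by rewrite -ltrBlDl.
have {}E1 := E1 x y X1 xy Y1.
have {x2}X2 : t - e2 < x by rewrite ltrBlDr -ltrBlDl.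
have {y2}Y2 : y < t + e2 by rewrite -ltrBlDl.
have {}E2 := E2 x y X2 xy Y2.
have {x3}X3 : t - e3 < x by rewrite ltrBlDr -ltrBlDl.
have {y3}Y3 : y < t + e3 by rewrite -ltrBlDl.
have {}E3 := E3 x y X3 xy Y3.
have {x4}X4 : t - e4 < x by rewrite ltrBlDr -ltrBlDl.
have {y4}Y4 : y < t + e4 by rewrite -ltrBlDl.
have {}E4 := E4 x y X4 xy Y4.
by rewrite !ler_norml; split; apply/andP; split; lra.
Qed.

(** The solution need not be differentiable at a crossing, so the chart is expanded to first order
    at [v t]. Both adjacent fields give the linear part a speed above some m > 0, and the Lipschitz
    bound makes the remainder negligible. *)
Lemma crossing_speed (v : R -> R[i]) k1 k2 (sg s0 t0 t : R) :
  filippov_sol S v s0 t0 -> s0 < t < t0 -> v t != 1 ->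
  crossing F G (chart_map kap mu (v t)) k1 k2 ->
  chart_map kap mu (v t) != 0 -> sg = 1 \/ sg = -1 ->
  0 < sg * Im (zfield F G k1 (chart_map kap mu (v t))) ->
  0 < sg * Im (zfield F G k2 (chart_map kap mu (v t))) ->
  exists2 e : R, 0 < e & forall s, t - e < s < t + e ->
    (t < s -> 0 < sg * (Im (chart_map kap mu (v s)) - Im (chart_map kap mu (v t)))) /\
    (s < t -> sg * (Im (chart_map kap mu (v s)) - Im (chart_map kap mu (v t))) < 0).
Proof.
move=> sv ti v1 cr z0 sg1 p1 p2.
have m0 := cS.1.
have [M M0 [e1 e10 E1]] := filippov_sol_lipschitz sv ti v1 cr z0.
pose D := - mu / (v t - 1) ^+ 2.
have v10 : v t - 1 != 0 by rewrite subr_eq0.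
have Dg k : D * chart_field F G kap mu k (v t) = zfield F G k (chart_map kap mu (v t)).
  by rewrite /D /chart_field; field; rewrite v10 m0.
have ImD k : sg * Im (zfield F G k (chart_map kap mu (v t))) =
   sg * Im D * Re (chart_field F G kap mu k (v t)) + sg * Re D * Im (chart_field F G kap mu k (v t)).
  by rewrite -Dg imM; ring.
rewrite !ImD in p1 p2.
have [m mq0 [mq1 mq2]] : exists2 m : R, 0 < m &
    m < sg * Im D * Re (chart_field F G kap mu k1 (v t)) + sg * Re D * Im (chart_field F G kap mu k1 (v t)) /\
    m < sg * Im D * Re (chart_field F G kap mu k2 (v t)) + sg * Re D * Im (chart_field F G kap mu k2 (v t)).
  move: p1 p2; set q1 := _ + _ => q10; set q2 := _ + _ => q20.
  have q0 : 0 < Num.min q1 q2 by rewrite lt_min q10.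
  exists (Num.min q1 q2 / 2); first by rewrite divr_gt0.
  have hq : Num.min q1 q2 / 2 < Num.min q1 q2 by rewrite ltr_pdivrMr// ltr_pMr// ltr1n.
  by split; apply: (lt_le_trans hq); rewrite ge_min lexx ?orbT.
have [e5 e50 E5] := filippov_sol_incr sv ti (pwfield_near cF cG cS v1 z0 cr mq1 mq2).
(* The exact remainder of the expansion: the increment of z is that of v times [D] + [w s], and [w]
   tends to 0 at t. *)
pose w s := (v s - v t) * (mu * ((v s - 1)^-1 * (v t - 1) ^- 2)).
have cv := filippov_sol_ccont sv ti.
have cvB c : ccont (fun s => v s - c) t by exact: ccontD cv (ccont_cst _ _).
have cw : ccont w t.
  apply: ccontM; first exact: cvB.
  apply: ccontM; first exact: ccont_cst.
  by apply: ccontM; [apply: ccontV (cvB _)|exact: ccont_cst].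
have r0 : 0 < m / (4 * M) by rewrite divr_gt0// mulr_gt0.
have /ccontP/(_ _ r0)[e6 e60 E6] := cw.
have [e7 e70 E7] : exists2 e7 : R, 0 < e7 & forall s, `|s - t| < e7 -> v s != 1.
  have [e7 e70 E7] := ccont_nbhs cv (@nbhs_neq R (v t) 1).
  exists e7 => // s /E7; have [->//|_] := eqVneq (v s) (v t); exact.
have zE s : v s != 1 -> chart_map kap mu (v s) - chart_map kap mu (v t) =
    D * (v s - v t) + (v s - v t) * w s.
  move=> vs1; have vs10 : v s - 1 != 0 by rewrite subr_eq0.
  by rewrite /chart_map /D /w; field; rewrite v10 vs10.
exists (Num.min (Num.min e1 e5) (Num.min e6 e7)).
  by rewrite !lt_min e10 e50 e60.
set e := Num.min _ _ => s se.
have [l1 l5 l6 l7] : [/\ e <= e1, e <= e5, e <= e6 & e <= e7].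
  by split; rewrite /e !ge_min lexx ?orbT.
have st : `|s - t| < e by rewrite ltr_distl.
have vs1 : v s != 1 by apply: E7; exact: lt_le_trans l7.
have [wr wi] := E6 s (lt_le_trans st l6).
have wt : w t = 0 by rewrite /w subrr mul0r.
rewrite wt /= !subr0 in wr wi.
have -> : Im (chart_map kap mu (v s)) - Im (chart_map kap mu (v t)) =
   Im D * (Re (v s) - Re (v t)) + Re D * (Im (v s) - Im (v t)) +
   ((Re (v s) - Re (v t)) * Im (w s) + (Im (v s) - Im (v t)) * Re (w s)).
  have := zE s vs1 => /(congr1 (@complex.Im R)).
  have imE (x y p q : R[i]) : Im (x * (p - q) + (p - q) * y) =
      Im x * (Re p - Re q) + Re x * (Im p - Im q) +
      ((Re p - Re q) * Im y + (Im p - Im q) * Re y).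
    by rewrite !reimE; ring.
  by rewrite imE imD imN => ->.
have W x y : t - e < x -> x <= y -> y < t + e ->
    [/\ `|Re (v y) - Re (v x)| <= M * (y - x), `|Im (v y) - Im (v x)| <= M * (y - x) &
        m * (y - x) <= sg * Im D * (Re (v y) - Re (v x)) + sg * Re D * (Im (v y) - Im (v x))].
  move=> ex xy ye.
  have X1 : t - e1 < x by apply: le_lt_trans ex; rewrite lerD2l lerN2.
  have Y1 : y < t + e1 by apply: lt_le_trans ye _; rewrite lerD2l.
  have X5 : t - e5 < x by apply: le_lt_trans ex; rewrite lerD2l lerN2.
  have Y5 : y < t + e5 by apply: lt_le_trans ye _; rewrite lerD2l.
  have [A1 A2] := E1 x y X1 xy Y1.
  have A3 := E5 x y X5 xy Y5.
  split=> //; apply: le_trans A3 _; rewrite le_eqVlt; apply/orP; left; apply/eqP.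
  ring.
case/andP: se => se1 se2.
have e0 : 0 < e by rewrite /e !lt_min e10 e50 e60.
split=> ts.
  have [|||A1 A2 A3] := W t s; [by rewrite gtrBl|exact: ltW|by []|].
  have ts0 : 0 < s - t by rewrite subr_gt0.
  exact: (crossing_estimate ts0 M0 mq0 sg1 A1 A2 wr wi A3).
have [|||A1 A2 A3] := W s t; [by []|exact: ltW|by rewrite ltrDl|].
have ts0 : 0 < t - s by rewrite subr_gt0.
have := crossing_estimate ts0 M0 mq0 sg1 A1 A2 wr wi A3.
by rewrite -oppr_lt0 => H; apply: le_lt_trans H; rewrite le_eqVlt; apply/orP; left; apply/eqP; ring.
Qed.

Lemma filippov_sol_zsol_at (v z : R -> R[i]) (s0 t0 t : R) :
  filippov_sol S v s0 t0 -> s0 < t < t0 ->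
  (forall s, s0 < s < t0 -> [/\ v s != 1, z s = chart_map kap mu (v s) & unblocked F G (z s)]) ->
  zsol_at F G z t.
Proof.
move=> sv ti vz.
have zn s : s0 < s < t0 -> \forall u \near s, chart_map kap mu (v u) = z u.
  move=> /andP[s1 s2]; near=> u; have [|_ -> //] := vz u; apply/andP; split; near: u.
    exact: lt_nbhsr.
  exact: lt_nbhsl.
have cz s : s0 < s < t0 -> ccont z s.
  move=> si; apply: near_ccont (zn _ si) _; have [v1 _ _] := vz s si.
  apply: ccontD; first exact: ccont_cst.
  apply: ccontM; first exact: ccont_cst.
  apply: ccontV; first by rewrite subr_eq0.
  by apply: ccontD; [exact: filippov_sol_ccont sv si|exact: ccont_cst].
have dz k s : s0 < s < t0 -> inzone k (z s) -> cderiv z s (zfield F G k (z s)).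
  move=> si kz; have [v1 zs uz] := vz s si; have z0 := unblocked_neq0 cF cG uz.
  apply: near_cderiv (zn _ si) _; rewrite zs; rewrite zs in kz z0.
  apply: cderiv_chart_map => //; first exact: cS.1.
  exact: (filippov_sol_cderiv sv si v1 z0 kz).
have [v1 zt uz] := vz t ti; have z0 := unblocked_neq0 cF cG uz.
case/andP: (ti) => ti1 ti2.
have cr := crossingP cF cG uz.
suff [e e0 He] : exists2 e : R, 0 < e & forall s, t - e < s < t + e ->
    (t < s -> inzone (zone_after (z t)) (z s)) /\
    (s < t -> inzone (zone_before (z t)) (z s)).
  pose f := Num.min e (Num.min (t - s0) (t0 - t)).
  have f0 : 0 < f by rewrite /f !lt_min e0 !subr_gt0 ti1.
  have [fe f1 f2] : [/\ f <= e, f <= t - s0 & f <= t0 - t].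
    by split; rewrite /f !ge_min lexx ?orbT.
  split => //; first exact: cz.
    exists f => // s /andP[ts sf]; have [|+ _] := He s; first by apply/andP; split; lra.
    move=> /(_ ts) ks; split => //; apply: dz => //; apply/andP; split; lra.
  exists f => // s /andP[ts sf]; have [|_ +] := He s; first by apply/andP; split; lra.
  move=> /(_ sf) ks; split => //; apply: dz => //; apply/andP; split; lra.
have := crossing_transversal cF cG cr; case=> [kz|[sg [sg1 p1 p2 nz]]].
  have [e e0 He] := ccont_nbhs (cz t ti) (inzone_open kz).
  exists e => // s se; have ks : inzone (zone_after (z t)) (z s).
    by apply: He; rewrite ltr_norml; case/andP: se => ? ?; apply/andP; split; lra.
  split => // _; move: ks; rewrite (inzone_before kz) //.
have [e1 e10 H1] := ccont_nbhs (cz t ti) nz.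
rewrite zt in cr p1 p2 z0.
have [e2 e20 H2] := crossing_speed sv ti v1 cr z0 sg1 p1 p2.
pose f := Num.min (Num.min e1 e2) (Num.min (t - s0) (t0 - t)).
have f0 : 0 < f by rewrite /f !lt_min e10 e20 !subr_gt0 ti1.
have [fe1 fe2 f1 f2] : [/\ f <= e1, f <= e2, f <= t - s0 & f <= t0 - t].
  by split; rewrite /f !ge_min lexx ?orbT.
exists f => // s /andP[sf1 sf2].
have [|A B] := H2 s; first by apply/andP; split; lra.
have [_ zs _] := vz s ltac:(by apply/andP; split; lra).
have [|A' B'] := H1 s; first by rewrite ltr_norml; apply/andP; split; lra.
by split=> ts; [apply: A'; rewrite zs zt; exact: A|apply: B'; rewrite zs zt; exact: B].
Unshelve. all: by end_near.
Qed.

End FilippovToClassical.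

(** * From classical solutions to Filippov ones *)

Section LipschitzCurves.
Variable R : realType.
Local Notation C := (R[i]^o).

Lemma lipschitz_abs_continuous (f : R -> R) (s t M : R) :
  (forall x y, s <= x -> x <= y -> y <= t -> `|f y - f x| <= M * (y - x)) ->
  abs_continuous f s t.
Proof.
move=> fM e e0; have M1 : 0 < `|M| + 1 by rewrite ltr_wpDl.
exists (e / (`|M| + 1)); first by rewrite divr_gt0.
move=> n l r lr _; rewrite ltr_pdivlMr// => H; apply: le_lt_trans H.
rewrite mulr_suml; apply: ler_sum => i _; have [sl [lri rt]] := lr i.
apply: le_trans (fM _ _ sl lri rt) _; rewrite mulrC ler_wpM2l ?subr_ge0//.
by apply: le_trans (ler_norm _) _; rewrite lerDl.
Qed.

(** The mean value theorem applies on either side of the possible crossing time t, and the two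
    estimates add up at t. *)
Lemma lipschitz_off_point (f : R -> R) (t e M : R) :
  (forall s, t - e < s < t + e -> {for s, continuous f}) ->
  (forall s, t - e < s < t + e -> s != t ->
     exists2 d, is_derive s (1 : R) f d & `|d| <= M) ->
  forall x y, t - e < x -> x <= y -> y < t + e -> `|f y - f x| <= M * (y - x).
Proof.
move=> cf df.
have H x y : t - e < x -> x <= y -> y < t + e -> ~ (x < t < y) ->
    `|f y - f x| <= M * (y - x).
  move=> ex; rewrite le_eqVlt => /predU1P[<- _ _|xy ye nt].
    by rewrite !subrr normr0 mulr0.
  have si s : x < s < y -> t - e < s < t + e /\ s != t.
    move=> /andP[xs sy]; rewrite (lt_trans ex xs) (lt_trans sy ye); split=> //.
    by apply/eqP => st; apply: nt; rewrite -st xs.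
  have df' s : s \in `]x, y[%R -> is_derive s (1 : R) f ('D_1 f s).
    rewrite in_itv /= => /si[s1 s2]; have [d [fd <-] _] := df s s1 s2.
    exact: DeriveDef.
  have cf' : {within `[x, y], continuous f}.
    apply: continuous_in_subspaceT => s; rewrite inE /= in_itv /= => /andP[xs sy].
    by apply: cf; rewrite (lt_le_trans ex xs) (le_lt_trans sy ye).
  have [s + ->] := MVT xy df' cf'; rewrite in_itv /= => /si[s1 s2].
  have [d [fd <-] dM] := df s s1 s2.
  by rewrite normrM [`|y - x|]gtr0_norm ?subr_gt0// ler_pM2r// subr_gt0.
move=> x y ex xy ye; have [/andP[xt ty]|] := pselect (x < t < y); last exact: H.
have A := H x t ex (ltW xt) (lt_trans ty ye) _.
have B := H t y (lt_trans ex xt) (ltW ty) ye _.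
have -> : f y - f x = (f y - f t) + (f t - f x) by rewrite addrA subrK.
have -> : M * (y - x) = M * (y - t) + M * (t - x) by ring.
apply: le_trans (ler_normD _ _) _; apply: lerD; [apply: B|apply: A].
  by rewrite ltxx.
by rewrite ltxx andbF.
Qed.

Variables (F G : focus R).
Hypotheses (cF : contracting F) (cG : contracting G).
Variables (S : pwsystem R) (kap mu : R[i]).
Hypothesis cS : chart F G S kap mu.

Lemma inzone_upward k (z0 : R[i]) : inzone k z0 ->
  exists2 e : R, 0 < e & forall tau, 0 < tau < e -> inzone k (z0 + 0 +i* tau).
Proof.
move=> /inzone_open/nbhs_complexP[e e0 He]; exists e => // tau /andP[t0 te].
by apply: He; rewrite !reimE /= addrAC subrr add0r ?normr0// gtr0_norm.
Qed.

Lemma zsol_filippov_sol (z : R -> R[i]) t : zsol F G z -> z t != kap ->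
  exists2 e : R, 0 < e & (forall s, t - e < s < t + e -> z s != kap) /\
    filippov_sol S (fun s => chart_inv kap mu (z s)) (t - e) (t + e).
Proof.
move=> sz zk; have m0 := cS.1.
pose v s := chart_inv kap mu (z s).
have [ut cz [e1 e10 H1] [e2 e20 H2]] := sz t.
have [e3 e30 H3] : exists2 e, 0 < e & forall s, `|s - t| < e -> z s != kap.
  have [e3 e30 E3] := ccont_nbhs cz (@nbhs_neq R (z t) kap).
  by exists e3 => // s /E3; have [->//|_] := eqVneq (z s) (z t); exact.
have cv s : z s != kap -> ccont v s.
  move=> zsk; have [_ czs _ _] := sz s.
  apply: ccontD; first exact: ccont_cst.
  apply: ccontM; first exact: ccont_cst.
  by apply: ccontV; [rewrite subr_eq0|exact: ccontD czs (ccont_cst _ _)].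
have vt1 : v t != 1 by exact: chart_inv_neq1.
have zvt : chart_map kap mu (v t) = z t by exact: chart_invK.
have zt0 : chart_map kap mu (v t) != 0 by rewrite zvt; exact: (unblocked_neq0 cF cG ut).
have bound k : exists2 M : R, 0 < M & exists2 e : R, 0 < e &
    forall s, `|s - t| < e -> `|Re (chart_field F G kap mu k (v s))| <= M /\
                            `|Im (chart_field F G kap mu k (v s))| <= M.
  set g := chart_field F G kap mu k; pose q := g (v t).
  exists (`|Re q| + `|Im q| + 1); first by rewrite ltr_wpDl// addr_ge0.
  have N : nbhs (q : C) (fun p => `|Re p - Re q| < 1 /\ `|Im p - Im q| < 1).
    by apply/nbhs_complexP; exists 1.
  have N' := (ccontinuousP _ _).1 (chart_field_ccontinuous (F := F) (G := G) (kap := kap) (mu := mu) (k := k) vt1 zt0) _ N.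
  have [e e0 E] := ccont_nbhs (cv t zk) N'.
  exists e => // s /E[r1 i1]; split.
    rewrite -(subrK (Re q) (Re _)) addrC; apply: le_trans (ler_normD _ _) _.
    by rewrite -addrA lerD2l ler_wpDl// ltW.
  rewrite -(subrK (Im q) (Im _)) addrC; apply: le_trans (ler_normD _ _) _.
  by rewrite [`|Re q| + _]addrC -addrA lerD2l ler_wpDl// ltW.
have [MA MA0 [e4 e40 H4]] := bound (zone_after (z t)).
have [MB MB0 [e5 e50 H5]] := bound (zone_before (z t)).
pose e := Num.min (Num.min e1 e2) (Num.min e3 (Num.min e4 e5)).
have e0 : 0 < e by rewrite !lt_min e10 e20 e30 e40.
have [l1 l2 l3 [l4 l5]] : [/\ e <= e1, e <= e2, e <= e3 & e <= e4 /\ e <= e5].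
  by do !split; rewrite /e !ge_min lexx ?orbT.
have sd s : t - e < s < t + e -> `|s - t| < e by rewrite ltr_distl.
have zsk s : t - e < s < t + e -> z s != kap.
  by move=> /sd se; apply: H3; exact: lt_le_trans l3.
have dv s : t - e < s < t + e -> s != t -> exists k,
    [/\ inzone k (z s), cderiv v s (chart_field F G kap mu k (v s)),
        `|Re (chart_field F G kap mu k (v s))| <= MA + MB &
        `|Im (chart_field F G kap mu k (v s))| <= MA + MB].
  move=> se; rewrite neq_lt => /orP[st|ts].
    have [|kz dz] := H2 s.
      by rewrite st andbT; apply: le_lt_trans (proj1 (andP se)); rewrite lerD2l lerN2.
    exists (zone_before (z t)); split => //.
    - by apply: cderiv_chart_inv => //; exact: zsk.
    - by apply: le_trans (H5 s (lt_le_trans (sd _ se) l5)).1 _; rewrite lerDr ltW.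
    - by apply: le_trans (H5 s (lt_le_trans (sd _ se) l5)).2 _; rewrite lerDr ltW.
  have [|kz dz] := H1 s.
    by rewrite ts /=; apply: lt_le_trans (proj2 (andP se)) _; rewrite lerD2l.
  exists (zone_after (z t)); split => //.
  - by apply: cderiv_chart_inv => //; exact: zsk.
  - by apply: le_trans (H4 s (lt_le_trans (sd _ se) l4)).1 _; rewrite lerDl ltW.
  - by apply: le_trans (H4 s (lt_le_trans (sd _ se) l4)).2 _; rewrite lerDl ltW.
have LR : forall x y, t - e < x -> x <= y -> y < t + e ->
    `|Re (v y) - Re (v x)| <= (MA + MB) * (y - x).
  apply: (@lipschitz_off_point (fun s => Re (v s))) => s se.
    by case: (cv s (zsk s se)).
  by move=> /(dv _ se)[k [_ [d1 _] b _]]; exists (Re (chart_field F G kap mu k (v s))).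
have LI : forall x y, t - e < x -> x <= y -> y < t + e ->
    `|Im (v y) - Im (v x)| <= (MA + MB) * (y - x).
  apply: (@lipschitz_off_point (fun s => Im (v s))) => s se.
    by case: (cv s (zsk s se)).
  by move=> /(dv _ se)[k [_ [_ d1] _ b]]; exists (Im (chart_field F G kap mu k (v s))).
have fil k s : t - e < s < t + e -> (exists2 r : R, 0 < r &
    forall tau, 0 < tau < r -> inzone k (z s + 0 +i* tau)) ->
    filippov S (v s) (chart_field F G kap mu k (v s)).
  move=> se [r r0 Hr]; have [us _ _ _] := sz s.
  have zvs : chart_map kap mu (v s) = z s by apply: chart_invK => //; exact: zsk.
  apply: (filippov_chart_field cS (e := r)) => //.
  - by apply: chart_inv_neq1 => //; exact: zsk.
  - by rewrite zvs; exact: (unblocked_neq0 cF cG us).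
  - by rewrite zvs.
exists e => //; split => //; split.
- move=> s se; have [us _ _ _] := sz s.
  have [k Hk] := crossing_upward cF cG (crossingP cF cG us).
  by exists (chart_field F G kap mu k (v s)); exact: fil.
- move=> x y ex ye; split; apply: (@lipschitz_abs_continuous _ _ _ (MA + MB)) => p q xp pq qy.
    by apply: LR => //; [exact: lt_le_trans xp|exact: le_lt_trans ye].
  by apply: LI => //; [exact: lt_le_trans xp|exact: le_lt_trans ye].
(* The only possible crossing in this time interval is at t, so one point is the exceptional null
   set. *)
- exists [set t]; split.
  + exact: measurable_set1.
  + exact: lebesgue_measure_set1.
  + move=> s ns; apply/eqP/negP => st; apply: ns => se.
    have [k [kz [d1 d2] _ _]] := dv s se (introN idP st).
    exists (chart_field F G kap mu k (v s)) => //.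
    by apply: fil => //; exact: inzone_upward.
Qed.

End LipschitzCurves.

(** * The sphere *)

Section Sphere.
Variable R : realType.
Local Notation C := (R[i]^o).
Implicit Types (kap mu z u w : R[i]).

Lemma compact_square (M : R) :
  compact ([set w | - M <= Re w <= M /\ - M <= Im w <= M] : set C).
Proof.
pose f (p : R * R) : C := p.1 +i* p.2.
have cf : continuous f.
  move=> [x y] P /nbhs_complexP[e e0 He].
  have nx : nbhs x (ball x e) by exact: nbhsx_ballx.
  have ny : nbhs y (ball y e) by exact: nbhsx_ballx.
  exists (ball x e, ball y e) => //= -[x' y'] [/= bx by_].
  by apply: He => /=; rewrite distrC.
have cK : compact (`[- M, M] `*` `[- M, M] : set (R * R)).
  by apply: compact_setX; exact: segment_compact.
have := continuous_compact (continuous_subspaceT cf) cK.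
congr compact; apply/seteqP; split.
  by move=> _ [[x y] [/= + +] <-]; rewrite !in_itv.
by move=> w [wr wi]; exists (Re w, Im w); [rewrite /= !in_itv|case: w {wr wi}].
Qed.

Lemma closed_square (M : R) :
  closed ([set w | - M <= Re w <= M /\ - M <= Im w <= M] : set C).
Proof.
have H k l m := @closed_halfplane R k l m.
have -> : [set w | - M <= Re w <= M /\ - M <= Im w <= M] =
   ([set q | - M <= 1 * Re q + 0 * Im q] `&` [set q | - M <= (-1) * Re q + 0 * Im q]) `&`
   ([set q | - M <= 0 * Re q + 1 * Im q] `&` [set q | - M <= 0 * Re q + (-1) * Im q]).
  apply/seteqP; split=> w /=.
    by move=> [/andP[? ?] /andP[? ?]]; do !split; lra.
  by move=> [[? ?] [? ?]]; split; apply/andP; split; lra.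
by apply: closedI; apply: closedI; exact: H.
Qed.

(** Links the neighbourhoods of infinity, complements of closed compact sets, with those of 0 in the
    coordinate 1/w. *)
Lemma inv_small (r : R) : 0 < r -> exists2 M : R, 0 < M & forall w,
  ~ (- M <= Re w <= M /\ - M <= Im w <= M) ->
  [/\ w != 0, `|Re w^-1| < r & `|Im w^-1| < r].
Proof.
move=> r0; exists (r^-1 + 1); first by rewrite addr_gt0// invr_gt0.
move=> w nw; set M := r^-1 + 1 in nw.
have rM : r^-1 < M by rewrite ltrDl.
have r1 : r * r^-1 = 1 by rewrite mulfV// lt0r_neq0.
have ri0 : 0 < r^-1 by rewrite invr_gt0.
have H : M ^+ 2 < Re w ^+ 2 + Im w ^+ 2.
  rewrite ltNge; apply/negP => nM; apply: nw; rewrite -!ler_norml.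
  have M0 : 0 <= M by lra.
  have [s1 s2] := (sqr_ge0 (Re w), sqr_ge0 (Im w)).
  by split; rewrite -(@ler_pXn2r _ 2) ?nnegrE// real_normK ?num_real//; lra.
have n1 : r^-1 ^+ 2 < Re w ^+ 2 + Im w ^+ 2 by apply: lt_trans H; nra.
set n := Re w ^+ 2 + Im w ^+ 2 in n1 H.
have n0 : 0 < n by apply: lt_trans n1; rewrite exprn_gt0.
have key (x : R) : x ^+ 2 <= n -> `|x / n| < r.
  move=> xn; rewrite normrM [`|n^-1|]gtr0_norm ?invr_gt0// ltr_pdivrMr//.
  rewrite -(@ltr_pXn2r _ 2) ?nnegrE ?mulr_ge0 ?(ltW r0) ?(ltW n0)//.
  rewrite real_normK ?num_real//; apply: le_lt_trans xn _.
  rewrite exprMn [n ^+ 2]expr2 mulrA ltr_pMl//.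
  have -> : 1 = r ^+ 2 * r^-1 ^+ 2 :> R by rewrite -exprMn r1 expr1n.
  by rewrite ltr_pM2l// exprn_gt0.
split.
- by apply/eqP => w0; move: n0; rewrite /n w0 /= expr0n addr0 ltxx.
- by rewrite reV; apply: key; rewrite /n lerDl sqr_ge0.
- by rewrite imV; apply: key; rewrite /n sqrrN lerDr sqr_ge0.
Qed.

Variables (F G : focus R).
Hypotheses (cF : contracting F) (cG : contracting G).

Lemma unblocked_open z : unblocked F G z -> nbhs (z : C) (unblocked F G).
Proof.
have sqn (c : R) : c < Re z ^+ 2 - Im z ^+ 2 + 1 ->
    nbhs (z : C) (fun w => c < Re w ^+ 2 - Im w ^+ 2 + 1).
  move=> H; have H' : c - 1 < Re (z * z) by rewrite reM -!expr2 ltrBlDr.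
  have := (ccontinuousP _ _).1 (ccontinuousM (@ccontinuous_id R z) (@ccontinuous_id R z)) _ (nbhs_Re_gt H').
  by apply: filterS => w; rewrite reM -!expr2 ltrBlDr.
case=> [|[r0 H]|[r0 H]].
- rewrite lter_normr => /orP[H|H].
    by apply: filterS (nbhs_Im_gt H) => w Hw; apply: Or31; rewrite lter_normr Hw.
  rewrite ltrNr in H.
  by apply: filterS (nbhs_Im_lt H) => w Hw; apply: Or31; rewrite lter_normr [1 < - _]ltrNr Hw orbT.
- by apply: filterS2 (nbhs_Re_gt r0) (sqn _ H) => w ? ?; apply: Or32.
- by apply: filterS2 (nbhs_Re_lt r0) (sqn _ H) => w ? ?; apply: Or33.
Qed.

Definition sphere_map kap mu (p : sphere R) : R[i] :=
  if p is Some w then chart_map kap mu w else kap.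

Definition sphere_inv kap mu z : sphere R :=
  if z == kap then None else Some (chart_inv kap mu z).

Lemma sphere_invK kap mu z : mu != 0 -> sphere_map kap mu (sphere_inv kap mu z) = z.
Proof.
by move=> m0; rewrite /sphere_inv; case: eqVneq => [->|zk] //=; exact: chart_invK.
Qed.

Lemma sphere_mapK kap mu p : mu != 0 -> p <> Some 1 ->
  sphere_inv kap mu (sphere_map kap mu p) = p.
Proof.
move=> m0; case: p => [w|_] /=; last by rewrite /sphere_inv eqxx.
move=> w1; have {}w1 : w != 1 by apply/eqP => w1'; apply: w1; rewrite w1'.
by rewrite /sphere_inv (negbTE (chart_map_neq kap m0 w1)) chart_mapK.
Qed.

Lemma sphere_inv_neq1 kap mu z : mu != 0 -> sphere_inv kap mu z <> Some 1.
Proof.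
move=> m0; rewrite /sphere_inv; case: eqVneq => // zk [] /eqP.
by rewrite (negbTE (chart_inv_neq1 m0 zk)).
Qed.

(** Since 1/u - 1 = -(u - 1)/u, the coordinate u = 1/w is a chart of the same form; kap - mu is the
    image of w = 0. *)
Lemma chart_map_inv kap mu u : u != 0 -> u != 1 ->
  chart_map (kap - mu) (- mu) u = chart_map kap mu u^-1.
Proof.
move=> u0 u1; rewrite /chart_map; field.
by rewrite u0 mulN1r !subr_eq0 u1 eq_sym u1.
Qed.

Lemma sphere_map_inv_point kap mu u : u != 1 ->
  sphere_map kap mu (inv_point u) = chart_map (kap - mu) (- mu) u.
Proof.
move=> u1; rewrite /inv_point; case: eqVneq => [->|u0] /=; last by rewrite chart_map_inv.
by rewrite /chart_map sub0r invrN invr1 mulrN1 opprK subrK.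
Qed.

Lemma inv_point_chart kap mu z : mu != 0 -> z != kap - mu ->
  inv_point (chart_inv (kap - mu) (- mu) z) = sphere_inv kap mu z.
Proof.
move=> m0 zk.
have u1 : chart_inv (kap - mu) (- mu) z != 1 by apply: chart_inv_neq1 => //; rewrite oppr_eq0.
rewrite -(sphere_mapK kap m0 (p := inv_point _)).
  by rewrite sphere_map_inv_point// chart_invK// oppr_eq0.
rewrite /inv_point; case: ifP => // _ [] /eqP; rewrite invr_eq1; exact/negP.
Qed.

Lemma chart_inv_system (S : pwsystem R) kap mu : chart F G S kap mu ->
  chart F G (inv_system S) (kap - mu) (- mu).
Proof.
move=> [m0 H]; split; first by rewrite oppr_eq0.
move=> u u0 u1; have ui0 : u^-1 != 0 by rewrite invr_eq0.
have ui1 : u^-1 != 1 by rewrite invr_eq1.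
have [[zp zc zm] fp fc fm] := H _ ui0 ui1.
have e k : - u ^+ 2 * chart_field F G kap mu k u^-1 =
    chart_field F G (kap - mu) (- mu) k u.
  rewrite /chart_field (chart_map_inv kap mu u0 u1); field.
  by rewrite u0 m0.
split; rewrite ?chart_map_inv//.
- by split; [rewrite -zp|rewrite -zc|rewrite -zm]; split=> [[]|].
- by move=> [_ /fp]; rewrite /= -e => ->.
- by move=> [_ /fc]; rewrite /= -e => ->.
- by move=> [_ /fm]; rewrite /= -e => ->.
Qed.

Variables (S : pwsystem R) (kap mu : R[i]).
Hypothesis cS : chart F G S kap mu.

(** The point w = 1 is z = infinity, but because the inverse of 0 is 0 the formula sends it to kap,
    which may be unblocked; it is excluded explicitly. *)
Definition unblocked_sphere : set (sphere R) :=
  [set p | p <> Some 1 /\ unblocked F G (sphere_map kap mu p)].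

Lemma open_unblocked_sphere : open unblocked_sphere.
Proof.
have m0 := cS.1.
rewrite openE => -[w|] [w1 uw].
  have {}w1 : w != 1 by apply/eqP => w1'; apply: w1; rewrite w1'.
  have N : nbhs (w : C) (fun w' => unblocked_sphere (Some w')).
    have N1 := (ccontinuousP _ _).1 (chart_map_ccontinuous (kap := kap) (mu := mu) w1) _ (unblocked_open uw).
    apply: filterS2 N1 (@nbhs_neq R w 1) => w' uw' ww'; split=> // -[] w'1.
    by move: w1; rewrite -w'1 => w'w; have := ww' ltac:(by rewrite eq_sym); rewrite w'1 eqxx.
  exact: N.
have z1 : (0 : R[i]) != 1 by rewrite eq_sym oner_neq0.
have uz : unblocked F G (chart_map (kap - mu) (- mu) 0).
  by rewrite -sphere_map_inv_point// /inv_point eqxx.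
have N1 := (ccontinuousP _ _).1 (chart_map_ccontinuous (kap := kap - mu) (mu := - mu) z1) _ (unblocked_open uz).
have /nbhs_complexP[r r0 Hr] : nbhs ((0 : R[i]) : C) (fun u =>
    unblocked F G (chart_map (kap - mu) (- mu) u) /\ u != 1).
  apply: filterS2 N1 (@nbhs_neq R 0 1) => u uu u1; split=> //.
  by have [->//|/u1] := eqVneq u 0.
have [M M0 HM] := inv_small r0.
exists [set w | - M <= Re w <= M /\ - M <= Im w <= M].
  by split; [exact: compact_square|exact: closed_square].
move=> p [[w nw <-]|->]; last by split.
have [w0 wr wi] := HM w nw.
have [||uw1 u1] := Hr w^-1; [by rewrite subr0|by rewrite subr0|].
split; first by move=> [] w1'; move: u1; rewrite w1' invr1 eqxx.
by rewrite /= -[w]invrK -chart_map_inv// invr_eq0.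
Qed.

Lemma sphere_sol_zsol (gamma : R -> sphere R) : sphere_sol S gamma ->
  (forall t, unblocked_sphere (gamma t)) ->
  zsol F G (fun t => sphere_map kap mu (gamma t)).
Proof.
move=> sg gU t; have [e e0 H] := sg t.
have te : t - e < t < t + e by rewrite gtrBl ltrDl e0.
case: H => [[w sw gw]|[u su gu]].
  apply: (filippov_sol_zsol_at cF cG cS sw te) => s se.
  have [g1 ug] := gU s; split=> //; last by rewrite gw.
  by apply/eqP => w1; apply: g1; rewrite gw// w1.
apply: (filippov_sol_zsol_at cF cG (chart_inv_system cS) su te) => s se.
have [g1 ug] := gU s.
have u1 : u s != 1.
  by apply/eqP => u1; apply: g1; rewrite gu// u1 /inv_point oner_eq0 invr1.
by split=> //; rewrite gu// sphere_map_inv_point.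
Qed.

Lemma zsol_sphere_sol (z : R -> R[i]) : zsol F G z ->
  sphere_sol S (fun t => sphere_inv kap mu (z t)).
Proof.
move=> sz t; have m0 := cS.1.
(* At z = kap, which is w = infinity, the coordinate 1/w is used; it misses only kap - mu, which
   differs from kap. *)
have [zk|zk] := eqVneq (z t) kap.
  have zk' : z t != kap - mu by rewrite zk -subr_eq0 opprB addrC subrK.
  have [e e0 [He sv]] := zsol_filippov_sol cF cG (chart_inv_system cS) sz zk'.
  exists e => //; right; eexists; first exact: sv.
  by move=> s /He zs; rewrite inv_point_chart.
have [e e0 [He sv]] := zsol_filippov_sol cF cG cS sz zk.
exists e => //; left; eexists; first exact: sv.
by move=> s /He zs; rewrite /sphere_inv (negbTE zs).
Qed.

Lemma closed_orbit_limit_cycle (X Y : R) : 0 < X -> 0 < Y ->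
  half_return F X Y -> half_return G Y X ->
  limit_cycle S (range (fun t => sphere_inv kap mu (closed_orbit F G X Y t))).
Proof.
move=> X0 Y0 HY HX; have m0 := cS.1.
have so := closed_orbit_zsol cF cG X0 Y0 HY HX.
split.
  exists (fun t => sphere_inv kap mu (closed_orbit F G X Y t)), (loop_time F G X Y); split=> //.
  - exact: zsol_sphere_sol.
  - exact: loop_time_gt0.
  - by move=> t; rewrite closed_orbit_periodic.
  - have [t ot] := closed_orbit_nonconst cF cG X0 Y0 HY HX; exists t => e; apply: ot.
    by rewrite -[LHS](sphere_invK kap _ m0) e sphere_invK.
exists unblocked_sphere; split.
- exact: open_unblocked_sphere.
- move=> _ [t _ <-]; split; first exact: sphere_inv_neq1.
  by rewrite sphere_invK//; case: (so t).
move=> _ [gamma [T [sg T0 gT _ ->]]] gU.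
have gU' t : unblocked_sphere (gamma t) by apply: gU; exists t.
have sz := sphere_sol_zsol sg gU'.
have zT t : sphere_map kap mu (gamma (t + T)) = sphere_map kap mu (gamma t) by rewrite gT.
have [s Hs] := zsol_periodic_orbit cF cG X0 Y0 HY HX sz T0 zT.
have gE h : gamma h = sphere_inv kap mu (closed_orbit F G X Y (s + h)).
  by rewrite -Hs sphere_mapK//; case: (gU' h).
apply/seteqP; split=> [_ [h _ <-]|_ [t _ <-]].
  by rewrite gE; exists (s + h).
by exists (t - s) => //; rewrite gE addrC subrK.
Qed.

End Sphere.

(** * The two given systems read in the strip coordinate *)

Section Charts.
Variable R : realType.

Lemma normc_ltE (w : R[i]) (r : R) : 0 <= r ->
  (`|w| < r%:C) = (Re w ^+ 2 + Im w ^+ 2 < r ^+ 2).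
Proof.
move=> r0; rewrite normc_def ltcR -[in LHS](ger0_norm r0) -sqrtr_sqr.
case: (ltrgtP r 0) r0 => // [rp|->] _; first by rewrite ltr_sqrt// exprn_gt0.
by rewrite expr0n /= sqrtr0 !ltNge sqrtr_ge0 addr_ge0 ?sqr_ge0.
Qed.

Lemma normc_gtE (w : R[i]) (r : R) : 0 <= r ->
  (r%:C < `|w|) = (r ^+ 2 < Re w ^+ 2 + Im w ^+ 2).
Proof.
move=> r0; rewrite normc_def ltcR.
have s0 : 0 <= Num.sqrt (Re w ^+ 2 + Im w ^+ 2) := sqrtr_ge0 _.
by rewrite -(@ltr_pXn2r _ 2) ?nnegrE// sqr_sqrtr// addr_ge0 ?sqr_ge0.
Qed.

Lemma complex_i_neq0 : 'i%C != 0 :> R[i].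
Proof. by rewrite eq_complex /= oner_eq0 andbF. Qed.

Lemma natr_complex (n : nat) : n%:R = (n%:R : R)%:C.
Proof. by rewrite rmorph_nat. Qed.

Lemma invr_m2i : (- 2 * 'i%C)^-1 = 'i%C / 2 :> R[i].
Proof.
have i0 := complex_i_neq0; apply: (mulfI (x := - 2 * 'i%C)).
  by rewrite mulf_neq0// oppr_eq0 pnatr_eq0.
rewrite divff; last by rewrite mulf_neq0// oppr_eq0 pnatr_eq0.
by rewrite [RHS](_ : _ = - 'i%C ^+ 2); [rewrite sqr_i opprK|field].
Qed.

Variables (a b c d x0 x1 : R).

Definition upper_focus := Focus a b x1.
Definition lower_focus := Focus c d x0.

Lemma focus_factor (p q : R) : (q%:C - p%:C * 'i%C) = - 'i%C * (p +i* q) :> R[i].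
Proof. by apply: complexP; rewrite !reimE /=; ring. Qed.

Lemma focus_ptE (p q r : R) : focus_pt (Focus p q r) = 'i%C - r%:C.
Proof. by apply: complexP; rewrite /focus_pt !reimE /=; ring. Qed.

(** Here z = -2i/(w - 1): circles tangent at w = 1 become parallel lines, Im z > 1 amounts to |w|^2
    < 1, and w = infinity is the pole z = 0. *)
Lemma external_chart :
  chart upper_focus lower_focus
    (PwSystem (@SigmaE_p R) (@SigmaE_c R) (@SigmaE_m R)
          (fun w => (b%:C - a%:C * 'i%C) / 2 * (w - 1) *
                    (- 2 * 'i%C + (w - 1) * (- 'i%C + x1%:C)))
          (fun w => 'i%C / 4 * (w - 1) ^+ 3)
          (fun w => (d%:C - c%:C * 'i%C) / 2 * (w - 1) *
                    (- 2 * 'i%C + (w - 1) * ('i%C - x0%:C))))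
    0 (- 2 * 'i%C).
Proof.
have i0 := complex_i_neq0.
split; first by rewrite mulf_neq0// oppr_eq0 pnatr_eq0.
move=> v v0 v1; have p0 : v - 1 != 0 by rewrite subr_eq0.
split.
- have n0 := complex_neq0 p0.
  have -> : Im (chart_map 0 (- 2 * 'i%C) v) =
      (- 2 * (Re v - 1)) / ((Re v - 1) ^+ 2 + Im v ^+ 2).
    rewrite /chart_map !reimE /= ?oppr0 ?subr0 ?addr0; ring.
  rewrite !reimE /= ?oppr0 ?subr0 ?addr0 in n0.
  rewrite !ltr_pdivlMr// !ltr_pdivrMr// mul1r.
  have E1 : (`|v| < 1) = (Re v ^+ 2 + Im v ^+ 2 < 1).
    by rewrite (@normc_ltE v 1)// expr1n.
  have E2 : (1 < `|v|) = (1 < Re v ^+ 2 + Im v ^+ 2).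
    by rewrite (@normc_gtE v 1)// expr1n.
  have E3 : (`|v - 2| < 1) = ((Re v - 2) ^+ 2 + Im v ^+ 2 < 1).
    by rewrite (natr_complex 2) (@normc_ltE _ 1)// expr1n !reimE /= subr0.
  have E4 : (1 < `|v - 2|) = (1 < (Re v - 2) ^+ 2 + Im v ^+ 2).
    by rewrite (natr_complex 2) (@normc_gtE _ 1)// expr1n !reimE /= subr0.
  rewrite /= /SigmaE_p /SigmaE_c /SigmaE_m /= E1 E2 E3 E4.
  split.
  + by split; lra.
  + split; first by move=> [? ?]; apply/andP; split; lra.
    by move=> /andP[? ?]; split; lra.
  + by split; lra.
- move=> _ /=; rewrite /chart_field /chart_map /= /focus_field focus_ptE invr_m2i.
  by rewrite focus_factor; field.
- move=> _ /=; rewrite /chart_field /chart_map /= invr_m2i.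
  by field; rewrite i0 p0.
- move=> _ /=; rewrite /chart_field /chart_map /= /focus_field focus_ptE invr_m2i.
  by rewrite focus_factor; field.
Qed.

(** Here z = -2i w/(w - 1): the pole z = 0 is w = 0, infinity is -2i, and Im z > 1 amounts to 3|w|^2
    - 4 Re w + 1 < 0, the disc of radius 1/3 about 2/3. *)
Lemma internal_chart :
  chart upper_focus lower_focus
    (PwSystem (@SigmaI_p R) (@SigmaI_c R) (@SigmaI_m R)
          (fun w => (b%:C - a%:C * 'i%C) / 2 * (w - 1) *
                    (- 2 * 'i%C * w + (w - 1) * (- 'i%C + x1%:C)))
          (fun w => 'i%C * (w - 1) ^+ 3 / (4 * w))
          (fun w => (d%:C - c%:C * 'i%C) / 2 * (w - 1) *
                    (- 2 * 'i%C * w + (w - 1) * ('i%C - x0%:C))))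
    (- 2 * 'i%C) (- 2 * 'i%C).
Proof.
have i0 := complex_i_neq0.
split; first by rewrite mulf_neq0// oppr_eq0 pnatr_eq0.
move=> v v0 v1; have p0 : v - 1 != 0 by rewrite subr_eq0.
split.
- have n0 := complex_neq0 p0.
  rewrite !reimE /= ?oppr0 ?subr0 ?addr0 in n0.
  have -> : Im (chart_map (- 2 * 'i%C) (- 2 * 'i%C) v) =
      - (2 * ((Re v - 1) ^+ 2 + Im v ^+ 2) + 2 * (Re v - 1)) /
      ((Re v - 1) ^+ 2 + Im v ^+ 2).
    rewrite /chart_map !reimE /= ?oppr0 ?subr0 ?addr0; field.
    by rewrite lt0r_neq0.
  rewrite !ltr_pdivlMr// !ltr_pdivrMr// mul1r.
  have q23 : 2 / 3 = (2 / 3 : R)%:C by rewrite rmorphM fmorphV /= !rmorph_nat.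
  have q13 : 1 / 3 = (1 / 3 : R)%:C by rewrite rmorphM fmorphV /= rmorph_nat rmorph1.
  have E1 : (`|v| < 1) = (Re v ^+ 2 + Im v ^+ 2 < 1).
    by rewrite (@normc_ltE v 1)// expr1n.
  have E2 : (1 < `|v|) = (1 < Re v ^+ 2 + Im v ^+ 2).
    by rewrite (@normc_gtE v 1)// expr1n.
  have E3 : (`|v - 2 / 3| < 1 / 3) = ((Re v - 2 / 3) ^+ 2 + Im v ^+ 2 < (1 / 3) ^+ 2).
    by rewrite q23 q13 normc_ltE ?divr_ge0// !reimE /= subr0.
  have E4 : (1 / 3 < `|v - 2 / 3|) = ((1 / 3) ^+ 2 < (Re v - 2 / 3) ^+ 2 + Im v ^+ 2).
    by rewrite q23 q13 normc_gtE ?divr_ge0// !reimE /= subr0.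
  rewrite /= /SigmaI_p /SigmaI_c /SigmaI_m /= E1 E2 E3 E4.
  split.
  + by split; lra.
  + split; first by move=> [? ?]; apply/andP; split; lra.
    by move=> /andP[? ?]; split; lra.
  + by split; lra.
- move=> _ /=; rewrite /chart_field /chart_map /= /focus_field focus_ptE invr_m2i.
  by rewrite focus_factor; field.
- move=> _ /=; rewrite /chart_field /chart_map /= invr_m2i.
  field; rewrite p0 v0 andbT /=.
  rewrite (_ : _ + _ = (- 2 * 'i%C) * v); last by ring.
  by rewrite !mulf_neq0// oppr_eq0 pnatr_eq0.
- move=> _ /=; rewrite /chart_field /chart_map /= /focus_field focus_ptE invr_m2i.
  by rewrite focus_factor; field.
Qed.

End Charts.

(** Eliminates X from the two half returns. The lower arc starts at -Y - i, at distance Y + [fx G]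
    from its focus [fx G] - i. *)
Lemma half_return_gap (R : realType) (F G : focus R) (X Y : R) :
  half_return F X Y -> half_return G Y X ->
  (Y + fx G) * (1 - expR (fa F / fb F * pi + fa G / fb G * pi)) =
  (fx G + fx F) * (1 + expR (fa F / fb F * pi)).
Proof.
rewrite /half_return expRD; set p := expR _; set q := expR _ => HY HX.
have : Y - p * q * Y = fx F + p * (fx G + q * fx G + fx F).
  by rewrite {1}HY {1}HX; ring.
lra.
Qed.

(** Both systems have the same closed orbit in z and differ in the position of w = infinity. For the
    first it is z = 0, which is blocked; for the second it is z = -2i in the lower half plane, which
    the orbit can meet only under the stated relation. *)
Theorem corollary4 (R : realType) (a b c d x0 x1 : R)
    (ha0 : a != 0) (hb0 : b != 0) (hc0 : c != 0) (hd0 : d != 0)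
    (hx00 : x0 != 0) (hx10 : x1 != 0)
    (ha : a < 0) (hc : c < 0) (hb : 0 < b) (hd : 0 < d)
    (hx0 : 1 < x0) (hx1 : 1 < x1) :
  (exists Gamma : set (sphere R),
     limit_cycle
       (PwSystem (@SigmaE_p R) (@SigmaE_c R) (@SigmaE_m R)
          (fun w => (b%:C - a%:C * 'i%C) / 2 * (w - 1) *
                    (- 2 * 'i%C + (w - 1) * (- 'i%C + x1%:C)))
          (fun w => 'i%C / 4 * (w - 1) ^+ 3)
          (fun w => (d%:C - c%:C * 'i%C) / 2 * (w - 1) *
                    (- 2 * 'i%C + (w - 1) * ('i%C - x0%:C))))
       Gamma /\
     ~ Gamma None)
  /\
  (exists Gamma : set (sphere R),
     limit_cycle
       (PwSystem (@SigmaI_p R) (@SigmaI_c R) (@SigmaI_m R)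
          (fun w => (b%:C - a%:C * 'i%C) / 2 * (w - 1) *
                    (- 2 * 'i%C * w + (w - 1) * (- 'i%C + x1%:C)))
          (fun w => 'i%C * (w - 1) ^+ 3 / (4 * w))
          (fun w => (d%:C - c%:C * 'i%C) / 2 * (w - 1) *
                    (- 2 * 'i%C * w + (w - 1) * ('i%C - x0%:C))))
       Gamma /\
     (Gamma None -> orbit_through_infinity a b c d x0 x1)).
Proof.
have cF : contracting (upper_focus a b x1) by [].
have cG : contracting (lower_focus c d x0) by [].
have [X [Y [X0 Y0 HY HX]]] := half_returns_exist cF cG.
have so := closed_orbit_zsol cF cG X0 Y0 HY HX.
have at_infinity kap mu t :
    sphere_inv kap mu (closed_orbit (upper_focus a b x1) (lower_focus c d x0) X Y t) = None ->
    closed_orbit (upper_focus a b x1) (lower_focus c d x0) X Y t = kap.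
  by rewrite /sphere_inv; case: eqP.
split.
  eexists; split; first exact: (closed_orbit_limit_cycle cF cG (external_chart a b c d x0 x1) X0 Y0 HY HX).
  move=> [t _ /at_infinity ot]; have [ut _ _ _] := so t.
  by have := unblocked_neq0 cF cG ut; rewrite ot eqxx.
eexists; split; first exact: (closed_orbit_limit_cycle cF cG (internal_chart a b c d x0 x1) X0 Y0 HY HX).
move=> [t _ /at_infinity ot].
have m2i : - 2 * 'i%C = 0 +i* -2 :> R[i].
  by apply: complexP; rewrite (natr_complex R 2) !reimE /=; ring.
rewrite m2i in ot; rewrite /orbit_through_infinity.
have := closed_orbit_at_infinity cF cG X0 Y0 HY HX ot; rewrite /= => ->.
have := half_return_gap HY HX; rewrite /= => <-.
by rewrite mulrAC.
Qed.
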